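(* Let $k>k_*$. There exists a positive constant $C_{\mathrm{global},6}$, depending only on $R$, $k_*$ and $\Sigma$, such that for every true mixing measure $G_*=\sum_{j=1}^{k_*}\pi_j^*\delta_{\theta_j^*}$ as in the context (no assumption being made on the cluster structure of its atoms), $$d_H(p_G,p_{G_*})\ \ge\ C_{\mathrm{global},6}\,\Delta_{\mathrm{sep}}^{4k_*-3}\,W_2^2(G,G_* )$$ uniformly for all $G\in\mathcal{G}_k(\Theta)$ (at most $k$ components). As a consequence, there exist positive constants $C_{\mathrm{density}},c_{\mathrm{density}}$ (the constants of the density estimation rate, see context) depending only on $\Theta$ and $k_*$ such that, for the over-specified maximum likelihood estimator $\widehat G_n$ over $\mathcal{G}_k(\Theta)$, $$\mathbb{P}\left(W_2(\widehat G_n,G_* )>\Big(\frac{C_{\mathrm{density}}}{C_{\mathrm{global},6}}\Big)^{1/2}\Big(\frac{d\log n}{n}\Big)^{1/4}\Delta_{\mathrm{sep}}^{-\left(2k_*-\frac32\right)}\right)\ \lesssim\ \exp(-c_{\mathrm{density}}\log n).$$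
   Context: Setting. $\Sigma$ is a known, fixed symmetric positive-definite $d\times d$ matrix with eigenvalues in $[\lambda_{\min},\lambda_{\max}]$, $0<\lambda_{\min}\le\lambda_{\max}$; $f(\cdot\mid\theta,\Sigma)$ is the density of the Gaussian $N(\theta,\Sigma)$ on $\mathbb{R}^d$. $\Theta\subset\mathbb{R}^d$ is compact and contained in the closed ball of radius $R>0$ centred at $0$. For a discrete probability measure $G=\sum_i\pi_i\delta_{\theta_i}$ put $p_G(x)=\sum_i\pi_i f(x\mid\theta_i,\Sigma)$. The true mixing measure is $G_*=\sum_{j=1}^{k_*}\pi_j^*\delta_{\theta_j^*}$ with $k_*\ge 2$, $\theta_j^*\in\Theta$, $\pi_j^*>0$, $\sum_j\pi_j^*=1$. Put $\Delta_{\mathrm{sep}}=\min_{j\ne l}\|\theta_j^*-\theta_l^*\|$ (Euclidean norm), assumed positive. $\mathcal{G}_k(\Theta)=\{\sum_{i=1}^{k'}\pi_i\delta_{\theta_i}:1\le k'\le k,\ \theta_i\in\Theta,\ 0\le\pi_i\le1,\ \sum_i\pi_i=1\}$. Hellinger distance: $d_H(p,q)=\big(\tfrac12\int(\sqrt p-\sqrt q)^2dx\big)^{1/2}$. $W_2$ is the 2-Wasserstein distance with respect to the Euclidean norm. Estimator. $X_1,\dots,X_n$ are i.i.d. with density $p_{G_*}$, and $\widehat G_n\in\arg\max_{G\in\mathcal{G}_k(\Theta)}\frac1n\sum_{i=1}^n\log p_G(X_i)$. Probabilities are under the true law. $\lesssim$ means inequality up to a positive multiplicative constant independent of $n$ and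 $G_*$. $C_{\mathrm{density}},c_{\mathrm{density}}$ are the constants in the density estimation bound $\mathbb{P}(d_H(p_{\widehat G_n},p_{G_*})>C_{\mathrm{density}}[d\log(n)/n]^{1/2})\lesssim n^{-c_{\mathrm{density}}}$. *)

(* Defs.v *)
(* MathComp / MathComp-Analysis. *)
From HB Require Import structures.
From mathcomp Require Import all_boot all_order all_algebra.
From mathcomp Require Import all_classical all_reals all_analysis.

Set Implicit Arguments.
Unset Strict Implicit.
Unset Printing Implicit Defensive.

Import Order.TTheory GRing.Theory Num.Theory.
Import numFieldNormedType.Exports.

Local Open Scope classical_set_scope.
Local Open Scope ring_scope.

(* The sigma-algebra on R^d = 'rV[R]_d is generated by the coordinate maps into
   the Borel line; it is the Borel sigma-algebra. *)
Definition measure_rV_display : measure_display.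
Proof. exact: default_measure_display. Qed.

Section measurable_rV.
Variables (R : realType) (d : nat).

Let coord (i : 'I_d) (x : 'rV[R]_d) : measurableTypeR R := x ord0 i.

Let rV_set0 : g_sigma_preimage coord set0.
Proof. exact: sigma_algebra0. Qed.

Let rV_setC A : g_sigma_preimage coord A -> g_sigma_preimage coord (~` A).
Proof. exact: sigma_algebraC. Qed.

Let rV_bigcup (F : (set 'rV[R]_d)^nat) :
  (forall i, g_sigma_preimage coord (F i)) ->
  g_sigma_preimage coord (\bigcup_i F i).
Proof. exact: sigma_algebra_bigcup. Qed.

HB.instance Definition _ := @isMeasurable.Build measure_rV_display
  'rV[R]_d (g_sigma_preimage coord) rV_set0 rV_setC rV_bigcup.

Lemma measurable_coord (i : 'I_d) :
  measurable_fun [set: 'rV[R]_d] (fun x => x ord0 i : measurableTypeR R).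
Proof.
move=> _ Y mY; rewrite setTI; apply: sub_sigma_algebra => /=.
rewrite -bigcup_seq/=; exists i => /=; first by rewrite mem_index_enum.
by exists Y => //; rewrite setTI.
Qed.

Lemma measurable_fun_rV d1 (T1 : measurableType d1) (f : T1 -> 'rV[R]_d) :
  (forall i, measurable_fun [set: T1] (fun t => f t ord0 i : measurableTypeR R)) ->
  measurable_fun [set: T1] f.
Proof.
move=> mf.
have pre : g_sigma_preimage (fun i => coord i \o f) `<=` measurable.
  apply: smallest_sub; first exact: sigma_algebra_measurable.
  rewrite -bigcup_seq/=; apply: bigcup_sub => i _.
  by move=> A [B mB <-]; exact: mf.
rewrite (@g_sigma_preimage_comp _ _ _ ('rV[R]_d)) in pre.
by move=> _ A mA; apply: pre; exists A.
Qed.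

End measurable_rV.

Section lebesgue_rV.
Variable R : realType.

Lemma sigma_finite_product d1 d2 (T1 : measurableType d1) (T2 : measurableType d2)
    (m1 : {sigma_finite_measure set T1 -> \bar R})
    (m2 : {sigma_finite_measure set T2 -> \bar R}) :
  sigma_finite setT (m1 \x m2)%E.
Proof.
have /sigma_finiteP[F [TF ndF Foo]] := sigma_finiteT m1.
have /sigma_finiteP[G [TG ndG Goo]] := sigma_finiteT m2.
exists (fun n => F n `*` G n).
  rewrite -setXTT TF TG predeqE => -[x y]; split.
    move=> [/= [n _ Fnx] [k _ Gky]]; exists (maxn n k) => //; split.
    - by move: x Fnx; exact/subsetPset/ndF/leq_maxl.
    - by move: y Gky; exact/subsetPset/ndG/leq_maxr.
  by move=> [n _ []/= ? ?]; split; exists n.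
move=> k; have [? ?] := Foo k; have [? ?] := Goo k.
split; first exact: measurableX.
by rewrite product_measure1E// lte_mul_pinfty// ge0_fin_numE.
Qed.

Definition cons_rV d (p : measurableTypeR R * 'rV[R]_d) : 'rV[R]_d.+1 :=
  row_mx (const_mx p.1 : 'rV_1) p.2.

Lemma measurable_cons_rV d :
  measurable_fun [set: measurableTypeR R * 'rV[R]_d] (@cons_rV d).
Proof.
apply: measurable_fun_rV => i.
case: (@split_ordP 1 d i) => j ->.
  rewrite (_ : (fun _ => _) = fst); first exact: measurable_fst.
  by apply/funext => p; apply: etrans (@row_mxEl R 1 1 d _ _ _ _) _; rewrite mxE.
rewrite (_ : (fun _ => _) = (fun y : 'rV[R]_d => y ord0 j : measurableTypeR R) \o snd).
  by apply: measurableT_comp => //; exact: measurable_coord.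
by apply/funext => p; exact: (@row_mxEr R 1 1 d).
Qed.

HB.instance Definition _ d := @isMeasurableFun.Build _ _
  (measurableTypeR R * 'rV[R]_d)%type 'rV[R]_d.+1 (@cons_rV d)
  (@measurable_cons_rV d).

Section step.
Variables (d : nat) (mu : {sigma_finite_measure set 'rV[R]_d -> \bar R}).

Definition lebesgue_step : set 'rV[R]_d.+1 -> \bar R :=
  pushforward (lebesgue_measure \x mu)%E (@cons_rV d).

Let step0 : lebesgue_step set0 = 0%E.
Proof. by rewrite /lebesgue_step /pushforward preimage_set0 measure0. Qed.

Let step_ge0 A : (0 <= lebesgue_step A)%E.
Proof. exact: measure_ge0. Qed.

Let step_sigma_additive : semi_sigma_additive lebesgue_step.
Proof.
exact: measure_semi_sigma_additive.
Qed.

HB.instance Definition _ := isMeasure.Build _ _ _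
  lebesgue_step step0 step_ge0 step_sigma_additive.

Let sigma_finite_step : sigma_finite setT lebesgue_step.
Proof.
have [F TF mF] := sigma_finite_product (@lebesgue_measure R) mu.
pose u (x : 'rV[R]_d.+1) : measurableTypeR R * 'rV[R]_d :=
  (x ord0 ord0, @rsubmx _ 1 1 d x).
have cu : cancel (@cons_rV d) u.
  move=> [a y]; rewrite /u /cons_rV /=; congr pair; last exact: row_mxKr.
  rewrite (_ : ord0 = lshift d (ord0 : 'I_1)); last exact/val_inj.
  by apply: etrans (@row_mxEl R 1 1 d _ _ _ _) _; rewrite mxE.
have mu_u : measurable_fun setT u.
  apply/measurable_fun_pairP; split.
    exact: (@measurable_coord R d.+1 ord0).
  apply: measurable_fun_rV => i /=.
  rewrite (_ : (fun _ => _) = (fun x : 'rV[R]_d.+1 => x ord0 (rshift 1 i) : measurableTypeR R)).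
    exact: measurable_coord.
  by apply/funext => x; rewrite /= mxE.
exists (fun n => u @^-1` F n).
  by rewrite -preimage_bigcup -TF.
move=> n; have [mFn Fn] := mF n; split.
  by rewrite -[X in measurable X]setTI; exact: mu_u.
rewrite /lebesgue_step /pushforward -comp_preimage.
by rewrite (_ : u \o _ = id) //; exact/funext.
Qed.

HB.instance Definition _ := Measure_isSigmaFinite.Build _ _ _
  lebesgue_step sigma_finite_step.
End step.

(* Lebesgue measure on R^d: the d-fold product of the one-dimensional one. *)
Fixpoint lebesgue_rV (d : nat) : {sigma_finite_measure set 'rV[R]_d -> \bar R} :=
  match d with
  | 0 => \d_(0 : 'rV[R]_0)
  | d'.+1 => lebesgue_step (lebesgue_rV d')
  end.

End lebesgue_rV.

Section gaussian_mixtures.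
Variables (R : realType) (d : nat).
Local Notation E := 'rV[R]_d.

(* The library norm on 'rV[R]_d is the sup norm; this is the Euclidean one. *)
Definition enorm (x : E) : R := Num.sqrt (\sum_(i < d) x ord0 i ^+ 2).

Definition posdef (Sigma : 'M[R]_d) : Prop :=
  Sigma^T = Sigma /\
  forall x : E, x != 0 -> 0 < (x *m Sigma *m x^T) ord0 ord0.

Definition gauss_pdf (Sigma : 'M[R]_d) (theta x : E) : R :=
  (Num.sqrt ((2 * pi) ^+ d * \det Sigma))^-1 *
  expR (- (((x - theta) *m invmx Sigma *m (x - theta)^T) ord0 ord0) / 2).

(* Formal finite combination of Dirac masses; what is used below depends on it
   only through the set function [mixing_measure]. *)
Record mixing := Mixing {
  order : nat;
  weight : 'I_order -> R;
  atom : 'I_order -> E }.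

Definition mixing_measure (G : mixing) (A : set E) : \bar R :=
  (\sum_(i < order G) (weight i)%:E * \d_(@atom G i) A)%E.

Definition mixture_pdf (Sigma : 'M[R]_d) (G : mixing) (x : E) : R :=
  \sum_(i < order G) weight i * gauss_pdf Sigma (@atom G i) x.

Definition mixings (Theta : set E) (k : nat) : set mixing :=
  [set G | [/\ (1 <= order G <= k)%N,
               forall i, Theta (@atom G i),
               forall i, 0 <= @weight G i <= 1 &
               \sum_(i < order G) @weight G i = 1]].

(* Minimum over a finite set, nonempty as soon as there are two atoms. *)
Definition separation (G : mixing) : R :=
  inf [set s | exists i j : 'I_(order G),
    i != j /\ s = enorm (atom i - atom j)].

Definition true_mixings (Theta : set E) (kstar : nat) : set mixing :=
  [set G | [/\ order G = kstar,
               forall i, Theta (@atom G i),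
               forall i, 0 < @weight G i,
               \sum_(i < order G) @weight G i = 1 &
               0 < separation G]].

Definition hellinger (p q : E -> R) : \bar R :=
  ((2^-1)%:E * \int[lebesgue_rV R d]_x
     ((Num.sqrt (p x) - Num.sqrt (q x)) ^+ 2)%:E)%E `^ 2^-1.

Definition couplings (G H : mixing) : set (probability (E * E)%type R) :=
  [set gamma | forall A : set E, measurable A ->
     gamma (A `*` setT) = mixing_measure G A /\
     gamma (setT `*` A) = mixing_measure H A].

Definition wasserstein2 (G H : mixing) : \bar R :=
  (ereal_inf [set (\int[gamma]_z (enorm (z.1 - z.2) ^+ 2)%:E)%E
             | gamma in couplings G H]) `^ 2^-1.

Section estimator.
Variables (dO : measure_display) (Omega : measurableType dO).
Variables (P : probability Omega R) (n : nat).

Definition iid_with_density (p : E -> R) (X : 'I_n -> {RV P >-> E}) : Prop :=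
  (forall i (B : set E), measurable B ->
     distribution P (X i) B = \int[lebesgue_rV R d]_(x in B) (p x)%:E)%E /\
  (forall B : 'I_n -> set E, (forall i, measurable (B i)) ->
     P [set w | forall i, B i (X i w)] = (\prod_(i < n) P (X i @^-1` B i))%E).

Definition mean_loglik (Sigma : 'M[R]_d) (X : 'I_n -> {RV P >-> E})
    (w : Omega) (G : mixing) : R :=
  n%:R^-1 * \sum_(i < n) ln (mixture_pdf Sigma G (X i w)).

(* Any selection from the argmax: [Ghat] is not assumed measurable, so events
   about it are to be measured with the outer probability [P^*]. *)
Definition is_mle (Sigma : 'M[R]_d) (Theta : set E) (k : nat)
    (X : 'I_n -> {RV P >-> E}) (Ghat : Omega -> mixing) : Prop :=
  forall w, mixings Theta k (Ghat w) /\
    forall G, mixings Theta k G ->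
      mean_loglik Sigma X w G <= mean_loglik Sigma X w (Ghat w).

End estimator.

End gaussian_mixtures.

(* Main.v *)
Require Import Defs.
From HB Require Import structures.
From mathcomp Require Import all_boot all_order all_algebra.
From mathcomp Require Import all_classical all_reals all_analysis.
From mathcomp Require Import measurable_realfun.
From mathcomp Require Import ring lra.

Set Implicit Arguments.
Unset Strict Implicit.
Unset Printing Implicit Defensive.

Import Order.TTheory GRing.Theory Num.Theory.
Import numFieldNormedType.Exports.

Local Open Scope classical_set_scope.
Local Open Scope ring_scope.

(* Lower bound.  Testing both densities against monomials gives, by
   Cauchy-Schwarz and induction on the degree, that all moments of [G] and [G*] of
   bounded degree differ by at most a constant times the Hellinger distance.  With
   a_1, ..., a_k* the atoms of [G*], integrate against [G] and [G*] the polynomial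
   prod_j |x - a_j|^2, which bounds the mean squared distance of [G] to the atoms,
   and for each j the polynomial prod_(l <> j) |x - a_l|^2 normalised at a_j and
   corrected by an affine factor so that its gradient vanishes at a_j, which
   compares the mass of the j-th Voronoi cell with the weight of a_j.  A coupling
   that moves mass inside cells first then has the required quadratic cost.

   Deviation.  Let s = p_G / p_* - 1, let sigma be its L^2(p_* dx) norm (at least
   the Hellinger distance) and S = s / sigma.  If eps < sigma, concavity of the
   logarithm turns "G is at least as likely as G*" into
   0 <= sum_i ln (1 + eps S(X_i)), i.e. only the normalised scores S matter, at the
   scale eps = sqrt (d ln n / n).  These scores are pairings of the exponential
   kernel with signed measures having a bounded number of atoms and bounded
   moments.  As the coordinates of the atoms satisfy a monic recurrence of bounded
   degree, finitely many moments control the whole measure, so that finitely many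
   scores approximate all of them up to a small multiple of an envelope, whatever
   n is.  Chernoff bounds treat these finitely many scores, and expanding the
   remainder in powers of the kernel treats it with one Chernoff bound per word.
   The number of cells enters only the multiplicative constant, which keeps the
   exponent independent of the number of components. *)

(** * Integration of independent samples *)

(** In the lower bound the vanishing gradient is what makes the error of the interpolating
    polynomials quadratic near every atom, as a bound on a squared Wasserstein distance requires.

    The deviation part is shaped by the order of the quantifiers: [Cdensity] and [cdensity] are
    fixed before [rad], [Sigma] and [k], and the prefactor [M] before [n] and [Gstar]. A covering
    whose size is polynomial in [n] would cost a power of [n] that depends on [k]. Hence the
    covering has a fixed precision, and what it misses is paid for by a geometric series. Moments
    are the right coordinates for it: divided by [sigma], the difference of [G] and [G*] has moments
    bounded by the constant of the lower bound, even when atoms merge and the normalised weights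
    diverge.

    The exponential of the envelope is not integrable against a Gaussian, so samples are truncated
    where the envelope exceeds [n^(1/4)]; its eighth moment makes the loss of order [1/n]. The
    maximiser need not be measurable, so every event is dominated by a measurable function before
    integrating. *)

Section transfer.
Context d1 d2 (T1 : measurableType d1) (T2 : measurableType d2) (R : realType).
Variables (m1 : {measure set T1 -> \bar R}) (m2 : {measure set T2 -> \bar R}).
Variables (X : T1 -> T2) (H : T1 -> R).
Hypothesis mX : measurable_fun setT X.
Hypothesis mH : measurable_fun setT H.
Hypothesis H0 : forall x, 0 <= H x.
Hypothesis m2E : forall A, measurable A -> m2 A = (\int[m1]_(x in X @^-1` A) (H x)%:E)%E.

Let H0e x : (0 <= (H x)%:E)%E. Proof. by rewrite lee_fin. Qed.
Let mHe : measurable_fun setT (EFin \o H). Proof. exact/measurable_EFinP. Qed.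

Import HBNNSimple.

Let transfer_indic (A : set T2) : measurable A ->
  (\int[m2]_x (\1_A x)%:E = \int[m1]_x ((\1_A (X x))%:E * (H x)%:E))%E.
Proof.
move=> mA; rewrite integral_indic// setIT m2E//.
rewrite integral_mkcond; apply: eq_integral => x _.
rewrite patchE indicE.
have -> : (x \in X @^-1` A) = (X x \in A).
  by apply/idP/idP; rewrite !inE.
by case: (X x \in A); rewrite /= ?mul1e ?mul0e.
Qed.

Let transfer_nnsfun (f : {nnsfun T2 >-> R}) :
  (\int[m2]_x (f x)%:E = \int[m1]_x ((f (X x))%:E * (H x)%:E))%E.
Proof.
have mXA (A : set T2) : measurable A -> measurable_fun setT (fun x => (\1_A (X x) : R)).
  by move=> mA; apply: (measurableT_comp (measurable_indic mA) mX).
have fE (y : T2) : ((f y)%:E = \sum_(r \in range f) (r * \1_(f @^-1` [set r]) y)%:E)%E.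
  by rewrite fsumEFin// -fimfunE.
under eq_integral do rewrite fE.
rewrite ge0_integral_fsum//; last first.
- move=> r y _; rewrite /= EFinM; exact: nnfun_muleindic_ge0.
- by move=> r; apply/measurable_EFinP; apply: measurable_funM => //.
transitivity (\int[m1]_x (\sum_(r \in range f) ((r * \1_(f @^-1` [set r]) (X x))%:E * (H x)%:E)))%E; last first.
  apply: eq_integral => x _; rewrite fE ge0_mule_fsuml//.
  by move=> r; rewrite /= EFinM; exact: nnfun_muleindic_ge0.
rewrite ge0_integral_fsum//; last first.
- move=> r x _; apply: mule_ge0 => //; rewrite /= EFinM; exact: nnfun_muleindic_ge0.
- move=> r; apply: emeasurable_funM => //; apply/measurable_EFinP => /=.
  by apply: measurable_funM => //; exact: mXA.
apply: eq_fsbigr => r /set_mem[y _ ry].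
have r0 : 0 <= r by rewrite -ry.
under eq_integral do rewrite EFinM.
rewrite ge0_integralZl//; last by apply/measurable_EFinP; exact: measurable_indic.
rewrite transfer_indic//.
rewrite -ge0_integralZl//.
- by apply: eq_integral => x _; rewrite EFinM muleA.
- by apply: emeasurable_funM => //; apply/measurable_EFinP => /=; exact: mXA.
- by move=> z _; apply: mule_ge0 => //; rewrite lee_fin.
Qed.

(** One statement covers three uses: the law of a sample ([H = 1]), a density ([X = id]), and the
    factor carried by the other samples (general [H]). Indicators give simple functions, and
    monotone convergence the rest. *)
Lemma transfer_ge0 (F : T2 -> \bar R) : measurable_fun setT F ->
  (forall y, 0 <= F y)%E ->
  (\int[m2]_y F y = \int[m1]_x (F (X x) * (H x)%:E))%E.
Proof.
move=> mF F0.
pose f_ := nnsfun_approx measurableT mF.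
transitivity (limn (fun n => \int[m2]_x (f_ n x)%:E)%E).
  rewrite -monotone_convergence//.
  - apply: eq_integral => y _; apply/esym/cvg_lim => //.
    by apply: cvg_nnsfun_approx.
  - by move=> n; exact/measurable_EFinP/measurable_funP.
  - by move=> n y _; rewrite lee_fin.
  - by move=> y _ m n mn; rewrite lee_fin; exact/lefP/nd_nnsfun_approx.
rewrite [X in limn X](_ : _ =
    (fun n => \int[m1]_x ((f_ n (X x))%:E * (H x)%:E))%E); last first.
  by apply/funext => n; exact: transfer_nnsfun.
rewrite -monotone_convergence//.
- apply: eq_integral => x _; apply/cvg_lim => //.
  by apply: cvgeZr => //; apply: cvg_nnsfun_approx.
- move=> n; apply: emeasurable_funM => //; apply/measurable_EFinP => /=.
  by apply: measurableT_comp.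
- by move=> n x _; apply: mule_ge0 => //; rewrite lee_fin.
- move=> x _ m n mn; apply: lee_wpmul2r => //; rewrite lee_fin.
  exact/lefP/nd_nnsfun_approx.
Qed.
End transfer.

(** The set where [F] is at least 1 is a measurable superset of [A], so Markov's inequality holds
    for events that are not known to be measurable, such as those about an arbitrary maximiser. *)
Lemma outer_markov d (T : measurableType d) (R : realType)
    (P : probability T R) (A : set T) (F : T -> \bar R) :
  measurable_fun setT F -> (forall x, 0 <= F x)%E -> (forall x, A x -> 1 <= F x)%E ->
  ((P^*)%mu A <= \int[P]_x F x)%E.
Proof.
move=> mF F0 AF.
have mB : measurable [set x | (1 <= F x)%E].
  rewrite -[X in measurable X]setTI.
  exact: emeasurable_fun_c_infty.
apply: (@le_trans _ _ ((P^*)%mu [set x | (1 <= F x)%E])).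
  by apply: le_outer_measure => x /AF.
rewrite measurable_mu_extE//=.
have -> : (P [set x | (1 <= F x)%E] = \int[P]_(x in [set x | (1 <= F x)%E]) 1)%E.
  by rewrite integral_cst// mul1e.
apply: (@le_trans _ _ (\int[P]_(x in [set x | (1 <= F x)%E]) F x)%E).
  by apply: ge0_le_integral => //; apply: measurable_funTS.
by apply: ge0_subset_integral.
Qed.

Section iid.
Context d1 d2 (T1 : measurableType d1) (T2 : measurableType d2) (R : realType).
Variables (P : probability T1 R) (n : nat) (X : 'I_n -> {RV P >-> T2}).
Variable mu : probability T2 R.
Hypothesis lawX : forall i B, measurable B -> P (X i @^-1` B) = mu B.
Hypothesis indX : forall B : 'I_n -> set T2, (forall i, measurable (B i)) ->
     P [set w | forall i, B i (X i w)] = (\prod_(i < n) P (X i @^-1` B i))%E.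

Variables (f : T2 -> R) (e : R).
Hypothesis mf : measurable_fun setT f.
Hypothesis f0 : forall x, 0 <= f x.
Hypothesis fe : (\int[mu]_x (f x)%:E = e%:E)%E.

(** Hybrid factors: indices below [m] carry [f], the others an indicator. Independence is assumed
    for events, and [f] replaces the indicators one index at a time. *)
Let fac m (B : 'I_n -> set T2) (i : 'I_n) (w : T1) : R :=
  if (i < m)%N then f (X i w) else \1_(B i) (X i w).

Let fac0 m B i w : 0 <= fac m B i w.
Proof. by rewrite /fac; case: ifP => //; rewrite indicE. Qed.

Let mfac m (B : 'I_n -> set T2) i : (forall i, measurable (B i)) ->
  measurable_fun setT (fac m B i).
Proof.
move=> mB; rewrite /fac; case: (i < m)%N.
  by apply: measurableT_comp => //; exact: measurable_funPT.
by apply: (measurableT_comp (measurable_indic (mB i))); exact: measurable_funPT.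
Qed.

Let prod_fac m (B : 'I_n -> set T2) : (m <= n)%N -> (forall i, measurable (B i)) ->
  (\int[P]_w (\prod_(i < n) fac m B i w)%:E =
   (e ^+ m * \prod_(i < n | (m <= i)%N) fine (mu (B i)))%:E)%E.
Proof.
have e0 : 0 <= e by rewrite -lee_fin -fe integral_ge0// => x _; rewrite lee_fin.
elim: m B => [|m IH] B mn mB.
  rewrite expr0 mul1r.
  under eq_integral => w _.
    rewrite (_ : \prod_(i < n) _ = \1_[set w | forall i, B i (X i w)] w); last first.
      rewrite indicE /fac /=; case: (boolP (w \in _)) => [/set_mem|/negP] H /=.
        by rewrite big1// => i _; rewrite indicE mem_set//; exact: H.
      have [i Hi] : exists i, ~ B i (X i w).
        by apply/existsNP => Hi; apply: H; rewrite inE.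
      by rewrite (bigD1 i)//= indicE memNset// mul0r.
    over.
  rewrite integral_indic//=; last first.
    rewrite (_ : [set w | _] = \bigcap_(i in [set: 'I_n]) (X i @^-1` B i)).
      apply: fin_bigcap_measurable => // i _.
      by rewrite -[X in measurable X]setTI; exact: measurable_funPT.
    by apply/seteqP; split => w /= H i; [move=> _; exact: H | exact: (H i)].
  rewrite setIT indX// -prodEFin//.
  apply: eq_bigr => i _; rewrite lawX// fineK//; exact: fin_num_measure.
pose i0 := Ordinal mn.
pose K w := \prod_(i < n | i != i0) fac m B i w.
pose c := e ^+ m * \prod_(i < n | (m < i)%N) fine (mu (B i)).
have c0 : 0 <= c.
  by apply: mulr_ge0; rewrite ?exprn_ge0// prodr_ge0// => i _; exact: fine_ge0.
have mK : measurable_fun setT K.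
  rewrite /K; under eq_fun do rewrite -big_filter.
  by apply: measurable_prod => i _; exact: mfac.
have K0 w : 0 <= K w by exact: prodr_ge0.
(* With the set at index [m] left free, the induction hypothesis says that [m2] is the image under
   [X i0] of the measure with density [K]; transfer then replaces the indicator by [f]. *)
pose m2 := mscale (NngNum c0) mu.
have m2E A : measurable A -> m2 A = (\int[P]_(x in X i0 @^-1` A) (K x)%:E)%E.
  move=> mA; pose B' i := if i == i0 then A else B i.
  have mB' i : measurable (B' i) by rewrite /B'; case: ifP.
  have := IH B' (ltnW mn) mB'.
  have B'0 : B' i0 = A by rewrite /B' eqxx.
  rewrite (bigD1 i0)//= B'0 mulrCA.
  rewrite (eq_bigl (fun i : 'I_n => (m < i)%N)); last first.
    by move=> i; rewrite [RHS]ltn_neqAle eq_sym andbC.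
  rewrite (eq_bigr (fun i : 'I_n => fine (mu (B i)))); last first.
    move=> i mi; rewrite /B'; case: eqP => // ii0; move: mi; rewrite ii0 /=.
    by rewrite ltnn.
  rewrite -/c mulrC EFinM fineK; last exact: fin_num_measure.
  move=> cE; rewrite (_ : m2 A = (c%:E * mu A)%E)// -cE [RHS]integral_mkcond; apply: eq_integral => w _.
  rewrite patchE (bigD1 i0)//= {1}/fac ltnn B'0 indicE.
  have -> : (w \in X i0 @^-1` A) = (X i0 w \in A).
    by apply/idP/idP; rewrite !inE.
  case: (X i0 w \in A); rewrite ?mul1r ?mul0r//.
  congr (_%:E); by apply: eq_bigr => i /negPf ii0; rewrite /fac /B' ii0.
have mfe : measurable_fun setT (EFin \o f) by exact/measurable_EFinP.
transitivity (\int[P]_w ((f (X i0 w))%:E * (K w)%:E))%E.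
  apply: eq_integral => w _; rewrite (bigD1 i0)//= {1}/fac /= ltnSn EFinM.
  congr (_ * _%:E)%E; apply: eq_bigr => i ii0; rewrite /fac ltnS leq_eqVlt.
  by have /negPf -> : (i : nat) != m by exact: ii0.
have mX0 : measurable_fun setT (X i0) by exact: measurable_funPT.
rewrite -(transfer_ge0 mX0 mK K0 m2E mfe); last by move=> x; rewrite lee_fin.
rewrite ge0_integral_mscale//=; last by move=> x _; rewrite lee_fin.
by rewrite fe -EFinM /c exprSr mulrAC.
Qed.

Lemma iid_expectation_prod : (\int[P]_w (\prod_(i < n) f (X i w))%:E = (e ^+ n)%:E)%E.
Proof.
have := @prod_fac n (fun=> setT) (leqnn n) (fun=> measurableT).
rewrite [X in (_ * X)%:E]big1 => [|i]; last by rewrite leqNgt ltn_ord.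
rewrite mulr1 => <-; apply: eq_integral => w _; congr (_%:E).
by apply: eq_bigr => i _; rewrite /fac ltn_ord.
Qed.
End iid.

(** * Lebesgue and Gaussian integrals *)

Section lebesgue_line.
Variable R : realType.
Local Notation mu := (@lebesgue_measure R).

Lemma measurable_shift (c : R) :
  measurable_fun setT (fun t : measurableTypeR R => t + c : measurableTypeR R).
Proof. by apply: measurable_funD. Qed.

Lemma ge0_integral_shift (c : R) (f : R -> \bar R) :
  measurable_fun setT f -> (forall t, 0 <= f t)%E ->
  (\int[mu]_t f (t + c)%R = \int[mu]_t f t)%E.
Proof.
move=> mf f0.
have := @ge0_integral_pushforward _ _ (measurableTypeR R) (measurableTypeR R) R
  _ (measurable_shift c) mu setT f measurableT mf (fun y _ => f0 y).
rewrite preimage_setT => <-.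
apply: eq_measure_integral => [|mphi A mA _]; first exact: measurable_shift.
apply/esym; apply: lebesgue_measure_unique => //= _ [[a b]] _ <-.
rewrite /pushforward /=.
rewrite (_ : _ @^-1` _ = `]a - c, b - c]%classic); last first.
  by apply/seteqP; split => t /=; rewrite !in_itv /= ltrBlDr lerBrDr.
by rewrite !lebesgue_measure_itv/= !lte_fin ltrD2r -!EFinD; case: ifP => // _; congr (_%:E); ring.
Qed.

Lemma gauss_line_integrable (l : R) : 0 < l ->
  (\int[mu]_t (expR (- (l * t ^+ 2)))%:E < +oo)%E.
Proof.
(* [s ^+ 2] is the variance [1 / (2 l)] of the centred normal law whose density is proportional to
   the integrand. *)
move=> l0; pose s := Num.sqrt (l *+ 2)^-1.
have s0 : s != 0 by rewrite gt_eqF// sqrtr_gt0 invr_gt0 mulrn_wgt0.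
have sE : s ^+ 2 *+ 2 = l^-1.
  by rewrite sqr_sqrtr ?invr_ge0 ?mulrn_wge0 1?ltW// -mulr_natr; field; lra.
have p0 := normal_peak_gt0 s0.
under eq_integral => t _.
  rewrite (_ : expR _ = (normal_peak s)^-1 * normal_pdf 0 s t); last first.
    rewrite normal_pdfE// mulrA mulVf ?mul1r ?gt_eqF//.
    by rewrite /normal_fun sE subr0 invrK mulNr mulrC.
  rewrite EFinM.
  over.
rewrite ge0_integralZl//=.
- by rewrite integral_normal_pdf mule1 ltry.
- by apply/measurable_EFinP; exact: measurable_normal_pdf.
- by move=> t _; rewrite lee_fin normal_pdf_ge0.
- by rewrite lee_fin invr_ge0 ltW.
Qed.

(** Completing the square gives [a |t| <= a^2 / (2 l) + l t^2 / 2], so half of the Gaussian decay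
    absorbs the linear term. *)
Lemma exp_gauss_line_integrable (a l : R) : 0 <= a -> 0 < l ->
  (\int[mu]_t (expR (a * `|t| - l * t ^+ 2))%:E < +oo)%E.
Proof.
move=> a0 l0.
have l20 : 0 < l / 2 by lra.
have mE (r b : R) : measurable_fun setT (fun t : R => (expR (r * `|t| - b * t ^+ 2))%:E).
  apply/measurable_EFinP; apply: measurableT_comp => //.
  apply: measurable_funB; apply: measurable_funM => //.
apply: (@le_lt_trans _ _ (\int[mu]_t ((expR (a ^+ 2 / (2 * l)))%:E *
   (expR (- (l / 2 * t ^+ 2)))%:E))%E).
  apply: ge0_le_integral => //.
  - exact: mE.
  - apply: emeasurable_funM => //.
    by have := mE 0 (l / 2); under eq_fun do rewrite mul0r sub0r.
  move=> t _; rewrite -EFinM -expRD lee_fin ler_expR.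
  have : 0 <= (a - l * `|t|) ^+ 2 / (2 * l).
    by rewrite divr_ge0 ?sqr_ge0//; lra.
  have -> : (a - l * `|t|) ^+ 2 / (2 * l) =
     a ^+ 2 / (2 * l) - a * `|t| + l / 2 * `|t| ^+ 2 by field; lra.
  rewrite real_normK ?num_real//; lra.
rewrite ge0_integralZl//=.
- by rewrite lte_mul_pinfty ?lee_fin ?expR_ge0// gauss_line_integrable.
- by have := mE 0 (l / 2); under eq_fun do rewrite mul0r sub0r.
Qed.
End lebesgue_line.

Section lebesgue_space.
Variable R : realType.
Local Notation leb := (lebesgue_rV R).

Lemma cons_rV0 d (p : measurableTypeR R * 'rV[R]_d) : cons_rV p ord0 ord0 = p.1.
Proof.
rewrite (_ : ord0 = lshift d (ord0 : 'I_1)); last exact/val_inj.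
by apply: etrans (@row_mxEl R 1 1 d _ _ _ _) _; rewrite mxE.
Qed.

Lemma cons_rVS d (p : measurableTypeR R * 'rV[R]_d) (i : 'I_d) :
  cons_rV p ord0 (lift ord0 i) = p.2 ord0 i.
Proof.
rewrite (_ : lift ord0 i = rshift 1 i); last exact/val_inj.
exact: (@row_mxEr R 1 1 d).
Qed.

Lemma ge0_integral_lebesgue_rVS d (g : 'rV[R]_d.+1 -> \bar R) :
  measurable_fun setT g -> (forall x, 0 <= g x)%E ->
  (\int[leb d.+1]_x g x = \int[lebesgue_measure]_t \int[leb d]_y g (cons_rV (t, y)))%E.
Proof.
move=> mg g0.
rewrite /lebesgue_rV -/(leb d) ge0_integral_pushforward//=.
rewrite fubini_tonelli1//=.
by apply: measurableT_comp => //; exact: measurable_cons_rV.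
Qed.

End lebesgue_space.

Section lebesgue_space.
Variable R : realType.
Local Notation leb := (lebesgue_rV R).

Lemma measurable_addrV d (c : 'rV[R]_d) :
  measurable_fun setT (fun x : 'rV[R]_d => x + c).
Proof.
apply: measurable_fun_rV => i.
rewrite (_ : (fun _ => _) = (fun x : 'rV[R]_d => x ord0 i + c ord0 i)).
  by apply: measurable_funD => //; exact: measurable_coord.
by apply/funext => x; rewrite mxE.
Qed.

Lemma ge0_integral_shift_rV d (c : 'rV[R]_d) (g : 'rV[R]_d -> \bar R) :
  measurable_fun setT g -> (forall x, 0 <= g x)%E ->
  (\int[leb d]_x g (x + c)%R = \int[leb d]_x g x)%E.
Proof.
elim: d c g => [|d IH] c g mg g0.
  by apply: eq_integral => x _; rewrite [c]thinmx0 addr0.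
have mgc : measurable_fun setT (g \o @cons_rV R d).
  by apply: measurableT_comp => //; exact: measurable_cons_rV.
rewrite !ge0_integral_lebesgue_rVS//; last first.
  by apply: measurableT_comp => //; exact: measurable_addrV.
pose c' : 'rV[R]_d := \row_i c ord0 (lift ord0 i).
pose F (t : measurableTypeR R) := (\int[leb d]_y g (cons_rV (t, y)))%E.
transitivity (\int[lebesgue_measure]_t F (t + c ord0 ord0)%R)%E; last first.
  rewrite (@ge0_integral_shift R _ F)//.
  - by apply: (measurable_fun_fubini_tonelli_F (m2 := leb d) (g \o @cons_rV R d)) => // z; exact: g0.
  - by move=> t; exact: integral_ge0.
apply: eq_integral => t _.
rewrite /F -(IH c' (fun y => g (cons_rV (t + c ord0 ord0, y))))//; last first.
  exact: (measurable_fun_pair2 _ mgc).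
apply: eq_integral => y _; congr (g _).
apply/rowP => i; rewrite mxE.
have [j ->|->] := unliftP ord0 i.
  by rewrite !cons_rVS /= !mxE.
by rewrite !cons_rV0.
Qed.

(** Growth is measured in the l1 norm because [expR (a * l1norm x)], like the exponential of
    [sqnorm], factors over the coordinates, which reduces integrability to the line. *)
Definition l1norm d (x : 'rV[R]_d) : R := \sum_(i < d) `|x ord0 i|.
Definition sqnorm d (x : 'rV[R]_d) : R := \sum_(i < d) x ord0 i ^+ 2.

Lemma measurable_l1norm d : measurable_fun setT (@l1norm d).
Proof.
apply: measurable_sum => i; apply: measurableT_comp => //; exact: measurable_coord.
Qed.

Lemma measurable_sqnorm d : measurable_fun setT (@sqnorm d).
Proof.
apply: measurable_sum => i; apply: measurable_funX; exact: measurable_coord.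
Qed.

Lemma exp_gauss_integrable d (a l : R) : 0 <= a -> 0 < l ->
  (\int[leb d]_x (expR (a * l1norm x - l * sqnorm x))%:E < +oo)%E.
Proof.
move=> a0 l0.
have mE e : measurable_fun setT (fun x : 'rV[R]_e => (expR (a * l1norm x - l * sqnorm x))%:E).
  apply/measurable_EFinP; apply: measurableT_comp => //.
  by apply: measurable_funB; apply: measurable_funM => //;
    [exact: measurable_l1norm|exact: measurable_sqnorm].
elim: d => [|d IH].
  rewrite integral_dirac//=; last exact: mE.
  by rewrite diracT mul1e ltry.
rewrite (ge0_integral_lebesgue_rVS (mE d.+1)); last first.
  by move=> x; rewrite lee_fin expR_ge0.
have [c0 ccE] : (0 <= \int[leb d]_x (expR (a * l1norm x - l * sqnorm x))%:E)%E /\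
   (\int[leb d]_x (expR (a * l1norm x - l * sqnorm x))%:E \is a fin_num)%E.
  have c0 : (0 <= \int[leb d]_x (expR (a * l1norm x - l * sqnorm x))%:E)%E.
    by apply: integral_ge0 => x _; rewrite lee_fin expR_ge0.
  by split=> //; rewrite ge0_fin_numE.
rewrite (_ : (fun t : R => _) = (fun t : R => (expR (a * `|t| - l * t ^+ 2))%:E *
   (\int[leb d]_x (expR (a * l1norm x - l * sqnorm x))%:E))%E); last first.
  apply/funext => t; rewrite -(ge0_integralZl _ _ (mE d))//=.
  apply: eq_integral => y _; rewrite -EFinM -expRD; congr (expR _)%:E.
  rewrite /l1norm /sqnorm !big_ord_recl !cons_rV0 /=.
  under eq_bigr do rewrite cons_rVS /=.
  by under [X in _ - l * (_ + X)]eq_bigr do rewrite cons_rVS /=; ring.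
rewrite ge0_integralZr//=; last first.
  apply/measurable_EFinP; apply: measurableT_comp => //.
  by apply: measurable_funB; apply: measurable_funM => //.
by rewrite muleC lte_mul_pinfty// exp_gauss_line_integrable.
Qed.

End lebesgue_space.

(** * Positive definite forms and their inverses *)

Section posdef.
Variables (R : realType) (d : nat).
Local Notation E := 'rV[R]_d.

Definition bform (A : 'M[R]_d) (x y : E) : R := (x *m A *m y^T) ord0 ord0.

Lemma bformDl A x x' y : bform A (x + x') y = bform A x y + bform A x' y.
Proof. by rewrite /bform !mulmxDl mxE. Qed.

Lemma bformDr A x y y' : bform A x (y + y') = bform A x y + bform A x y'.
Proof. by rewrite /bform linearD /= mulmxDr mxE. Qed.

Lemma bformZl A c x y : bform A (c *: x) y = c * bform A x y.
Proof. by rewrite /bform -!scalemxAl mxE. Qed.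

Lemma bformZr A c x y : bform A x (c *: y) = c * bform A x y.
Proof. by rewrite /bform linearZ /= -scalemxAr mxE. Qed.

Lemma bform_sym A x y : A^T = A -> bform A x y = bform A y x.
Proof.
move=> sA; rewrite /bform -[in LHS](trmxK (x *m A *m y^T)) mxE.
by rewrite !trmx_mul trmxK sA mulmxA.
Qed.

Lemma bformE A x y : bform A x y = \sum_(j < d) (x *m A) ord0 j * y ord0 j.
Proof. by rewrite /bform mxE; apply: eq_bigr => j _; rewrite [y^T _ _]mxE. Qed.

Variable S : 'M[R]_d.
Hypothesis pdS : posdef S.

Let symS : S^T = S. Proof. by case: pdS. Qed.
Let posS x : x != 0 -> 0 < bform S x x. Proof. by case: pdS => _; apply. Qed.

Lemma posdef_unitmx : S \in unitmx.
Proof.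
rewrite -row_free_unit -kermx_eq0; apply/negPn/negP => /rowV0Pn[v /sub_kermxP vS v0].
by have := posS v0; rewrite /bform vS mul0mx mxE ltxx.
Qed.

(** A nonnegative root of the characteristic polynomial of [- S] would be an eigenvalue
    contradicting positivity. This monic polynomial is nonnegative at large arguments, so by the
    intermediate value theorem it is positive at 0, where its value is [\det S]. *)
Lemma posdef_det_gt0 : 0 < \det S.
Proof.
pose p := char_poly (- S).
have p0 : p.[0] = \det S.
  by rewrite horner_coef0 char_poly_det -(scaleN1r S) detZ mulrA -exprMn mulrNN mulr1 expr1n mul1r.
have pr a : 0 <= a -> ~~ root p a.
  move=> a0; rewrite -eigenvalue_root_char; apply/negP => /eigenvalueP[v vS v0].
  have := posS v0; rewrite ltNge => /negP; apply.
  have -> : bform S v v = - (a * \sum_(j < d) v ord0 j * v ord0 j).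
    rewrite mulr_sumr -sumrN bformE; apply: eq_bigr => j _.
    have -> : v *m S = - (a *: v) by rewrite -vS mulmxN opprK.
    by rewrite !mxE; ring.
  rewrite oppr_le0 mulr_ge0//; apply: sumr_ge0 => j _; exact: sqr_ge0.
have [b bP] := monic_Cauchy_bound (char_poly_monic (- S)).
rewrite ltNge; apply/negP => det0.
have b0 : 0 <= Num.max 0 b by rewrite le_max lexx.
have pb : 0 <= p.[Num.max 0 b] by apply/ltW/bP; rewrite le_max lexx orbT.
have := @poly_ivt R p 0 (Num.max 0 b) b0; rewrite p0 det0 pb => /(_ isT)[x /andP[x0 _]].
by apply/negP/pr.
Qed.

Let A := invmx S.

Lemma invmx_sym : A^T = A.
Proof. by rewrite /A trmx_inv symS. Qed.

Lemma bform_inv_ge0 x : 0 <= bform A x x.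
Proof.
have -> : bform A x x = bform S (x *m A) (x *m A).
  rewrite /bform trmx_mul invmx_sym !mulmxA -[x *m A *m S]mulmxA mulVmx ?mulmx1//.
  exact: posdef_unitmx.
have [->|/posS/ltW//] := eqVneq (x *m A) 0.
by rewrite /bform !mul0mx mxE.
Qed.

Lemma diag_posdef_gt0 (i : 'I_d) : 0 < S i i.
Proof.
have := @posS (delta_mx ord0 i).
have -> : bform S (delta_mx 0 i) (delta_mx 0 i) = S i i.
  by rewrite /bform trmx_delta -rowE -colE !mxE.
apply; apply/negP => /eqP/matrixP/(_ ord0 i)/eqP.
by rewrite !mxE !eqxx/= oner_eq0.
Qed.

(** Cauchy-Schwarz for the form [A] between [x] and the [i]-th row [y] of [S]: [y] represents the
    [i]-th coordinate and its own square is [S i i]. Summed over [i], this yields a Gaussian decay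
    rate in terms of the trace of [S]. *)
Lemma sqr_le_bform_inv (x : E) (i : 'I_d) : x ord0 i ^+ 2 <= bform A x x * S i i.
Proof.
have Si := diag_posdef_gt0 i.
pose y : E := delta_mx ord0 i *m S.
have yA : y *m A = delta_mx ord0 i by rewrite /y mulmxK// posdef_unitmx.
have xy : bform A y x = x ord0 i.
  by rewrite /bform yA -rowE !mxE.
have yy : bform A y y = S i i.
  by rewrite /bform yA -rowE /y -rowE !mxE.
have := bform_inv_ge0 (x + (- (x ord0 i / S i i)) *: y).
rewrite bformDl !bformDr !bformZl !bformZr (bform_sym x y) ?invmx_sym// xy yy.
have -> : bform A x x + - (x ord0 i / S i i) * x ord0 i +
    (- (x ord0 i / S i i) * x ord0 i +
     - (x ord0 i / S i i) * (- (x ord0 i / S i i) * S i i)) =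
   bform A x x - x ord0 i ^+ 2 / S i i by field; rewrite gt_eqF.
by rewrite subr_ge0 ler_pdivrMr.
Qed.

Lemma sqnorm_le_bform_inv x : sqnorm x <= bform A x x * \tr S.
Proof. by rewrite /sqnorm /mxtrace mulr_sumr ler_sum// => i _; exact: sqr_le_bform_inv. Qed.

Definition mxsum (B : 'M[R]_d) : R := \sum_i \sum_j `|B i j|.

Lemma normr_mulmx_le (B : 'M[R]_d) (x : E) j :
  `|(x *m B) ord0 j| <= mxsum B * l1norm x.
Proof.
rewrite mxE; apply: le_trans (ler_norm_sum _ _ _) _.
rewrite /l1norm mulr_sumr; apply: ler_sum => i _.
rewrite normrM mulrC; apply: ler_wpM2r => //.
rewrite /mxsum (bigD1 i)//= (bigD1 j)//= -addrA lerDl.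
by rewrite addr_ge0// sumr_ge0// => k _; rewrite ?sumr_ge0.
Qed.

End posdef.

(** * Functions of exponential growth and monomials *)

Section exp_growth.
Variables (R : realType) (d : nat).
Local Notation E := 'rV[R]_d.
Implicit Types (u v g : E -> R) (x theta : E).

Lemma l1norm_ge0 x : 0 <= l1norm x.
Proof. exact: sumr_ge0. Qed.

Lemma coord_le_l1norm x i : `|x ord0 i| <= l1norm x.
Proof. by rewrite /l1norm (bigD1 i)//= lerDl sumr_ge0. Qed.

Lemma l1normD x y : l1norm (x + y) <= l1norm x + l1norm y.
Proof. by rewrite /l1norm -big_split ler_sum// => i _; rewrite mxE ler_normD. Qed.

Lemma enorm_sqr x : enorm x ^+ 2 = sqnorm x.
Proof. by rewrite sqr_sqrtr// sumr_ge0// => i _; exact: sqr_ge0. Qed.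

Lemma coord_le_enorm x i : `|x ord0 i| <= enorm x.
Proof.
rewrite -sqrtr_sqr ler_wsqrtr// (bigD1 i)//= lerDl.
by rewrite sumr_ge0// => j _; exact: sqr_ge0.
Qed.

Lemma l1norm_le_enorm x : l1norm x <= d%:R * enorm x.
Proof.
rewrite /l1norm; apply: le_trans (_ : \sum_(i < d) enorm x <= _).
  by apply: ler_sum => i _; exact: coord_le_enorm.
by rewrite sumr_const card_ord mulr_natl.
Qed.

(** This class is closed under sums, products, square roots and translations, contains the mixture
    ratios and their inverses, and consists of functions integrable against the Gaussian; membership
    is how that integrability is obtained. *)
Definition exp_growth u := measurable_fun setT u /\
  exists C a, [/\ 0 <= C, 0 <= a & forall x, `|u x| <= C * expR (a * l1norm x)].

Lemma exp_growth_le u v : measurable_fun setT u -> exp_growth v ->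
  (forall x, `|u x| <= `|v x|) -> exp_growth u.
Proof.
move=> mu [_ [C [a [C0 a0 vC]]]] uv; split=> //; exists C, a; split=> // x.
exact: le_trans (uv x) (vC x).
Qed.

Lemma exp_growth_cst c : exp_growth (fun=> c).
Proof.
split; first exact: measurable_cst.
by exists `|c|, 0; split=> // x; rewrite mul0r expR0 mulr1.
Qed.

Lemma exp_growthD u v : exp_growth u -> exp_growth v -> exp_growth (fun x => u x + v x).
Proof.
move=> [mu [C [a [C0 a0 uC]]]] [mv [D [b [D0 b0 vD]]]].
split; first exact: measurable_funD.
exists (C + D), (a + b); split; rewrite ?addr_ge0// => x.
apply: le_trans (ler_normD _ _) _; rewrite mulrDl lerD//.
  apply: le_trans (uC x) _; rewrite ler_wpM2l// ler_expR mulrDl lerDl.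
  by rewrite mulr_ge0// l1norm_ge0.
apply: le_trans (vD x) _; rewrite ler_wpM2l// ler_expR mulrDl lerDr.
by rewrite mulr_ge0// l1norm_ge0.
Qed.

Lemma exp_growthM u v : exp_growth u -> exp_growth v -> exp_growth (fun x => u x * v x).
Proof.
move=> [mu [C [a [C0 a0 uC]]]] [mv [D [b [D0 b0 vD]]]].
split; first exact: measurable_funM.
exists (C * D), (a + b); split; rewrite ?addr_ge0 ?mulr_ge0// => x.
by rewrite normrM mulrDl expRD mulrACA ler_pM.
Qed.

Lemma exp_growthZ c u : exp_growth u -> exp_growth (fun x => c * u x).
Proof. by move=> gu; apply: exp_growthM => //; exact: exp_growth_cst. Qed.

Lemma exp_growthN u : exp_growth u -> exp_growth (fun x => - u x).
Proof.
move=> /(exp_growthZ (-1)); congr exp_growth.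
by apply/funext => x; rewrite mulN1r.
Qed.

Lemma exp_growthB u v : exp_growth u -> exp_growth v -> exp_growth (fun x => u x - v x).
Proof. by move=> gu gv; apply: exp_growthD => //; exact: exp_growthN. Qed.

Lemma exp_growth_sum (I : Type) (s : seq I) (u : I -> E -> R) :
  (forall i, exp_growth (u i)) -> exp_growth (fun x => \sum_(i <- s) u i x).
Proof.
move=> gu; elim: s => [|i s IH].
  by under eq_fun do rewrite big_nil; exact: exp_growth_cst.
by under eq_fun do rewrite big_cons; exact: exp_growthD.
Qed.

Lemma exp_growthX u k : exp_growth u -> exp_growth (fun x => u x ^+ k).
Proof.
move=> gu; elim: k => [|k IH].
  by under eq_fun do rewrite expr0; exact: exp_growth_cst.
by under eq_fun do rewrite exprS; exact: exp_growthM.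
Qed.

Lemma exp_growth_norm u : exp_growth u -> exp_growth (fun x => `|u x|).
Proof.
move=> gu; apply: (exp_growth_le _ gu) => [|x]; last by rewrite normr_id.
by apply: measurableT_comp => //; case: gu.
Qed.

Lemma exp_growth_sqrt u : exp_growth u -> exp_growth (fun x => Num.sqrt (u x)).
Proof.
move=> gu.
have gv : exp_growth (fun x => 1 + `|u x|).
  by apply: exp_growthD; [exact: exp_growth_cst|exact: exp_growth_norm].
apply: exp_growth_le gv _ => [|x].
  by apply: measurableT_comp; [exact: continuous_measurable_fun (@sqrt_continuous R)|case: gu].
rewrite (ger0_norm (sqrtr_ge0 _)) [leRHS]ger0_norm ?addr_ge0//.
have [u0|/ltW u0] := leP (u x) 0; first by rewrite ler0_sqrtr// addr_ge0.
rewrite -[leRHS]ger0_norm ?addr_ge0// -sqrtr_sqr ler_sqrt ?sqr_ge0//.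
rewrite [`|u x|]ger0_norm// sqrrD expr1n mul1r.
by have := sqr_ge0 (u x); lra.
Qed.

Lemma exp_growth_coord i : exp_growth (fun x => x ord0 i).
Proof.
split; first exact: measurable_coord.
exists 1, 1; split=> // x; rewrite !mul1r.
apply: le_trans (coord_le_l1norm x i) _.
by apply: le_trans (expR_ge1Dx _); rewrite lerDr.
Qed.

Lemma exp_growth_l1norm : exp_growth (@l1norm R d).
Proof.
split; first exact: measurable_l1norm.
exists 1, 1; split=> // x; rewrite !mul1r ger0_norm ?l1norm_ge0//.
by apply: le_trans (expR_ge1Dx _); rewrite lerDr.
Qed.

Lemma exp_growth_expR u c a : measurable_fun setT u -> 0 <= a ->
  (forall x, u x <= c + a * l1norm x) -> exp_growth (fun x => expR (u x)).
Proof.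
move=> mu a0 uc; split; first exact: measurableT_comp.
exists (expR c), a; split; rewrite ?expR_ge0// => x.
by rewrite ger0_norm ?expR_ge0// -expRD ler_expR.
Qed.

(** Words replace multi-indices, so that induction on the degree is induction on a list; reorderings
    of a word give the same function. *)
Definition mono (w : seq 'I_d) x : R := \prod_(l <- w) x ord0 l.

Lemma mono_cons l w x : mono (l :: w) x = x ord0 l * mono w x.
Proof. by rewrite /mono big_cons. Qed.

Lemma mono_nil x : mono [::] x = 1.
Proof. by rewrite /mono big_nil. Qed.

Lemma mono_cat w w' x : mono (w ++ w') x = mono w x * mono w' x.
Proof. by rewrite /mono big_cat. Qed.

Lemma exp_growth_mono w : exp_growth (mono w).
Proof.
elim: w => [|l w IH].
  rewrite (_ : mono _ = fun=> 1); first exact: exp_growth_cst.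
  by apply/funext => x; rewrite mono_nil.
rewrite (_ : mono _ = fun x => x ord0 l * mono w x).
  by apply: exp_growthM => //; exact: exp_growth_coord.
by apply/funext => x; rewrite mono_cons.
Qed.

End exp_growth.

Arguments exp_growth_mono {R d}.
Arguments exp_growth_coord {R d}.
Arguments exp_growth_l1norm {R d}.

Section integral_lebesgue_rV.
Variables (R : realType) (d : nat).
Local Notation leb := (lebesgue_rV R d).

Lemma integral_shift_rV (c : 'rV[R]_d) (g : 'rV[R]_d -> \bar R) :
  measurable_fun setT g -> (\int[leb]_x g (x + c)%R = \int[leb]_x g x)%E.
Proof.
move=> mg; rewrite [LHS]integralE [RHS]integralE; congr (_ - _)%E.
- rewrite -[RHS](ge0_integral_shift_rV c)//; last exact: measurable_funepos.
  by apply: eq_integral => x _; rewrite /= !funeposE.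
- rewrite -[RHS](ge0_integral_shift_rV c)//; last exact: measurable_funeneg.
  by apply: eq_integral => x _; rewrite /= !funenegE.
Qed.

Lemma lebesgue_rV_neq0 : leb setT != 0%E.
Proof.
elim: d => [|e IH].
  rewrite (_ : lebesgue_rV R 0 setT = \d_(0 : 'rV[R]_0) setT)//.
  by rewrite diracT.
have := @ge0_integral_lebesgue_rVS R e (cst 1%E) (measurable_cst _) (fun=> lee01).
rewrite integral_cst// mul1e => ->.
rewrite (_ : (fun t : R => _) = fun t => lebesgue_rV R e setT); last first.
  by apply/funext => t; rewrite integral_cst// mul1e.
rewrite integral_cst//.
rewrite mule_eq0 negb_or IH/=.
rewrite (_ : [set: R] = `]-oo, +oo[%classic); last by rewrite set_itvNyy.
by rewrite lebesgue_measure_itv.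
Qed.

End integral_lebesgue_rV.

(** * Integration against the centred Gaussian density *)

Section gaussian.
Variables (R : realType) (d : nat) (S : 'M[R]_d).
Hypothesis pdS : posdef S.
Local Notation E := 'rV[R]_d.
Local Notation leb := (lebesgue_rV R d).
Local Notation A := (invmx S).
Implicit Types (u v : E -> R) (x theta : E).

Definition gauss0 x : R := gauss_pdf S 0 x.

(** Logarithm of the density of [N(theta, S)] relative to that of [N(0, S)]; it is affine in [x]. *)
Definition tilt_exponent theta x : R :=
  \sum_(l < d) (x *m A) ord0 l * theta ord0 l - bform A theta theta / 2.

Definition tilt theta x : R := expR (tilt_exponent theta x).

Lemma gauss_pdf_gt0 theta x : 0 < gauss_pdf S theta x.
Proof.
rewrite mulr_gt0 ?expR_gt0// invr_gt0 sqrtr_gt0 mulr_gt0 ?posdef_det_gt0//.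
by rewrite exprn_gt0// mulr_gt0// pi_gt0.
Qed.

Lemma gauss_pdf_shift theta x : gauss_pdf S theta (x + theta) = gauss0 x.
Proof. by rewrite /gauss0 /gauss_pdf subr0 addrK. Qed.

Lemma gauss_pdf_tilt theta x : gauss_pdf S theta x = tilt theta x * gauss0 x.
Proof.
rewrite /gauss0 /gauss_pdf subr0 mulrCA; congr (_ * _).
rewrite /tilt /tilt_exponent -expRD; congr expR.
rewrite -!/(bform _ _ _) -bformE -(scaleN1r theta).
rewrite bformDl !bformDr !bformZl !bformZr (bform_sym theta x) ?invmx_sym//.
by field.
Qed.

Lemma exp_growth_mulmx (B : 'M[R]_d) l : exp_growth (fun x => (x *m B) ord0 l).
Proof.
under eq_fun do rewrite mxE.
apply: exp_growth_sum => i.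
under eq_fun do rewrite mulrC.
exact/exp_growthZ/exp_growth_coord.
Qed.

Lemma measurable_tilt_exponent theta : measurable_fun setT (tilt_exponent theta).
Proof.
apply: measurable_funB => //; apply: measurable_sum => l.
by apply: measurable_funM => //; have [] := exp_growth_mulmx A l.
Qed.

Lemma tilt_exponent_le theta x :
  `|tilt_exponent theta x| <= bform A theta theta / 2 + (mxsum A * l1norm theta) * l1norm x.
Proof.
apply: le_trans (ler_normB _ _) _; rewrite addrC lerD//.
  by rewrite ger0_norm// divr_ge0// bform_inv_ge0.
apply: le_trans (ler_norm_sum _ _ _) _.
rewrite mulrAC [X in _ <= _ * X]/l1norm mulr_sumr; apply: ler_sum => l _.
by rewrite normrM ler_wpM2r// normr_mulmx_le.
Qed.

Lemma exp_growth_tilt theta : exp_growth (tilt theta).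
Proof.
apply: (exp_growth_expR (c := bform A theta theta / 2) (a := mxsum A * l1norm theta)).
- exact: measurable_tilt_exponent.
- by rewrite mulr_ge0 ?l1norm_ge0// /mxsum sumr_ge0// => i _; rewrite sumr_ge0.
- by move=> x; apply: le_trans (tilt_exponent_le theta x); exact: ler_norm.
Qed.

Lemma measurable_gauss0 : measurable_fun setT gauss0.
Proof.
rewrite /gauss0 /gauss_pdf; apply: measurable_funM => //.
apply: measurableT_comp => //; apply: measurable_funM => //.
apply: measurable_funN; under eq_fun do rewrite subr0 -/(bform _ _ _) bformE.
apply: measurable_sum => l; apply: measurable_funM; last exact: measurable_coord.
by have [] := exp_growth_mulmx A l.
Qed.

Lemma gauss0_gt0 x : 0 < gauss0 x.
Proof. exact: gauss_pdf_gt0. Qed.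

Lemma gauss0_ub : exists Z l, [/\ 0 < Z, 0 < l & forall x, gauss0 x <= Z * expR (- (l * sqnorm x))].
Proof.
have tr0 : 0 <= \tr S by apply: sumr_ge0 => i _; exact/ltW/diag_posdef_gt0.
(* [sqnorm x] is at most [\tr S] times the quadratic form; the added 1 keeps the rate positive. *)
exists (Num.sqrt ((2 * pi) ^+ d * \det S))^-1, (2 * (1 + \tr S))^-1; split.
- rewrite invr_gt0 sqrtr_gt0 mulr_gt0 ?posdef_det_gt0//.
  by rewrite exprn_gt0// mulr_gt0// pi_gt0.
- by rewrite invr_gt0 mulr_gt0// ltr_wpDr.
- move=> x; rewrite /gauss0 /gauss_pdf ler_wpM2l// ?invr_ge0 ?sqrtr_ge0//.
  rewrite ler_expR mulNr lerN2 subr0 -/(bform _ _ _) invfM -mulrA mulrC ler_pM2r//.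
  rewrite mulrC ler_pdivrMr ?ltr_wpDr//.
  apply: le_trans (sqnorm_le_bform_inv pdS x) _.
  by rewrite ler_wpM2l ?bform_inv_ge0// lerDr.
Qed.

Lemma integrable_gauss0 u : exp_growth u ->
  leb.-integrable setT (EFin \o (fun x => u x * gauss0 x)).
Proof.
move=> [mu [C [a [C0 a0 uC]]]]; have [Z [l [Z0 l0 gZ]]] := gauss0_ub.
have mg : measurable_fun setT (fun x : E => expR (a * l1norm x - l * sqnorm x)).
  apply: measurableT_comp => //.
  by apply: measurable_funB; apply: measurable_funM => //;
    [exact: measurable_l1norm|exact: measurable_sqnorm].
have ig : leb.-integrable setT (EFin \o (fun x => (C * Z) * expR (a * l1norm x - l * sqnorm x))).
  rewrite (_ : _ \o _ = fun x => (C * Z)%:E * (EFin \o (fun x => expR (a * l1norm x - l * sqnorm x))) x)%E//.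
  apply: integrableZl => //; apply/integrableP; split; first exact/measurable_EFinP.
  under eq_integral do rewrite /= ger0_norm ?expR_ge0//.
  exact: exp_gauss_integrable.
apply: le_integrable ig => //.
  by apply/measurable_EFinP; apply: measurable_funM => //; exact: measurable_gauss0.
move=> x _ /=; rewrite lee_fin normrM [leRHS]ger0_norm; last first.
  by rewrite !mulr_ge0 ?expR_ge0// ltW.
rewrite (ger0_norm (ltW (gauss0_gt0 x))) expRD mulrACA ler_pM//.
by apply/ltW; exact: gauss0_gt0.
Qed.

Definition I0 u : R := (\int[leb]_x (u x * gauss0 x))%R.

Lemma I0D u v : exp_growth u -> exp_growth v -> I0 (fun x => u x + v x) = I0 u + I0 v.
Proof.
move=> gu gv; rewrite /I0 -RintegralD//; try exact: integrable_gauss0.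
by apply: eq_Rintegral => x _; rewrite mulrDl.
Qed.

Lemma I0Z c u : exp_growth u -> I0 (fun x => c * u x) = c * I0 u.
Proof.
move=> gu; rewrite /I0 -RintegralZl//; try exact: integrable_gauss0.
by apply: eq_Rintegral => x _; rewrite mulrA.
Qed.

Lemma I0B u v : exp_growth u -> exp_growth v -> I0 (fun x => u x - v x) = I0 u - I0 v.
Proof.
move=> gu gv; rewrite /I0 -RintegralB//; try exact: integrable_gauss0.
by apply: eq_Rintegral => x _; rewrite mulrBl.
Qed.

Lemma I0_sum (I : Type) (s : seq I) (c : I -> R) (u : I -> E -> R) :
  (forall i, exp_growth (u i)) ->
  I0 (fun x => \sum_(i <- s) c i * u i x) = \sum_(i <- s) c i * I0 (u i).
Proof.
move=> gu; elim: s => [|i s IH].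
  rewrite big_nil /I0; under eq_Rintegral do rewrite big_nil mul0r.
  by rewrite Rintegral_cst// mul0r.
rewrite big_cons -IH -I0Z// -I0D//; last 2 first.
- exact: exp_growthZ.
- by apply: exp_growth_sum => j; exact: exp_growthZ.
by congr I0; apply/funext => x; rewrite big_cons.
Qed.

Lemma I0_le u v : exp_growth u -> exp_growth v -> (forall x, u x <= v x) -> I0 u <= I0 v.
Proof.
move=> gu gv uv; apply: le_Rintegral => //; try exact: integrable_gauss0.
by move=> x _; rewrite ler_wpM2r// ltW// gauss0_gt0.
Qed.

Lemma I0_ge0 u : (forall x, 0 <= u x) -> 0 <= I0 u.
Proof.
by move=> u0; apply: Rintegral_ge0 => x _; rewrite mulr_ge0// ltW// gauss0_gt0.
Qed.

Lemma I0_norm u : exp_growth u -> `|I0 u| <= I0 (fun x => `|u x|).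
Proof.
move=> gu; rewrite ler_norml -[X in X <= _]mulN1r -I0Z; last exact: exp_growth_norm.
apply/andP; split; apply: I0_le => //; try exact: exp_growth_norm.
- exact/exp_growthZ/exp_growth_norm.
- by move=> x; rewrite mulN1r lerNnormlW.
- by move=> x; exact: ler_norm.
Qed.

(** The moment comparison divides by this mass. Were it zero, the positive function [gauss0] would
    vanish almost everywhere and the whole space would be negligible. *)
Lemma I0_gt0 : 0 < I0 (fun=> 1).
Proof.
rewrite lt_neqAle I0_ge0// andbT eq_sym; apply/negP => /eqP I00.
have i1 := integrable_gauss0 (exp_growth_cst d 1).
have : (\int[leb]_x `|(1 * gauss0 x)%:E| = 0)%E.
  under eq_integral do rewrite gee0_abs ?lee_fin ?mulr_ge0 ?(ltW (gauss0_gt0 _))//.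
  by rewrite -[LHS]fineK ?integrable_fin_num// -/(Rintegral _ _ _) -/(I0 _) I00.
have mf : measurable_fun setT (fun x => (1 * gauss0 x)%:E) by case/integrableP: i1.
move=> /(ae_eq_integral_abs leb measurableT mf) ae0.
have : leb.-negligible setT.
  apply: negligibleS ae0 => x _ /= /(_ Logic.I) [] /eqP.
  by rewrite mul1r gt_eqF// gauss0_gt0.
by move=> /(negligibleP leb measurableT)/eqP; apply/negP/lebesgue_rV_neq0.
Qed.

(** [tilt theta] turns the centred density into the one centred at [theta], and translation
    invariance moves the shift into the test function. *)
Lemma I0_shift theta u : measurable_fun setT u ->
  I0 (fun x => u x * tilt theta x) = I0 (fun x => u (x + theta)).
Proof.
move=> mu; rewrite /I0 /Rintegral; congr fine.
under eq_integral do rewrite -mulrA -gauss_pdf_tilt.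
rewrite -(integral_shift_rV theta).
  by apply: eq_integral => x _; rewrite gauss_pdf_shift.
apply/measurable_EFinP; apply: measurable_funM => //.
rewrite (_ : gauss_pdf S theta = fun x => tilt theta x * gauss0 x); last first.
  by apply/funext => x; exact: gauss_pdf_tilt.
by apply: measurable_funM; [have [] := exp_growth_tilt theta|exact: measurable_gauss0].
Qed.

End gaussian.

(** Young's inequality for the product of [u (p + q)] and [p - q], followed by
    [(p + q)^2 <= 2 (p^2 + q^2)]. With [p] and [q] the square roots of mixture ratios, the last
    square integrates to twice the squared Hellinger distance. *)
Lemma amgm_sqr (R : realType) (u p q t : R) : 0 < t ->
  `|u * p ^+ 2 - u * q ^+ 2| <=
  t * (u ^+ 2 * p ^+ 2 + u ^+ 2 * q ^+ 2) + t^-1 * (p - q) ^+ 2.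
Proof.
move=> t0; have ti : 0 < t^-1 by rewrite invr_gt0.
have pq : 0 <= t * (u * (p - q)) ^+ 2 by rewrite mulr_ge0 ?sqr_ge0// ltW.
have pq' : 0 <= t * (u * (p + q)) ^+ 2 by rewrite mulr_ge0 ?sqr_ge0// ltW.
have h1 : 0 <= t * (u * (p + q) / 2 - t^-1 * (p - q)) ^+ 2.
  by rewrite mulr_ge0 ?sqr_ge0// ltW.
have h2 : 0 <= t * (u * (p + q) / 2 + t^-1 * (p - q)) ^+ 2.
  by rewrite mulr_ge0 ?sqr_ge0// ltW.
have e1 : t * (u * (p + q) / 2 - t^-1 * (p - q)) ^+ 2 =
   t * (u * (p + q)) ^+ 2 / 4 - (u * p ^+ 2 - u * q ^+ 2) + t^-1 * (p - q) ^+ 2.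
  by field; rewrite gt_eqF.
have e2 : t * (u * (p + q) / 2 + t^-1 * (p - q)) ^+ 2 =
   t * (u * (p + q)) ^+ 2 / 4 + (u * p ^+ 2 - u * q ^+ 2) + t^-1 * (p - q) ^+ 2.
  by field; rewrite gt_eqF.
have e3 : t * (u ^+ 2 * p ^+ 2 + u ^+ 2 * q ^+ 2) =
   t * (u * (p + q)) ^+ 2 / 2 + t * (u * (p - q)) ^+ 2 / 2 by field.
rewrite e1 in h1; rewrite e2 in h2; rewrite e3 ler_norml; apply/andP; split; lra.
Qed.

(** * Hellinger distance and moments *)

Section mixture_ratio.
Variables (R : realType) (d : nat) (S : 'M[R]_d).
Hypothesis pdS : posdef S.
Local Notation E := 'rV[R]_d.
Local Notation leb := (lebesgue_rV R d).
Local Notation I0 := (I0 S).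
Local Notation gauss0 := (gauss0 S).
Implicit Types (u v : E -> R) (x theta : E) (G H : mixing R d).

Definition mixture_ratio (G : mixing R d) x : R :=
  \sum_(i < Defs.order G) weight i * tilt S (@atom _ _ G i) x.

Lemma mixture_pdf_ratio G x : mixture_pdf S G x = mixture_ratio G x * gauss0 x.
Proof.
rewrite /mixture_pdf /mixture_ratio mulr_suml; apply: eq_bigr => i _.
by rewrite (gauss_pdf_tilt pdS) mulrA.
Qed.

Lemma exp_growth_mixture_ratio G : exp_growth (mixture_ratio G).
Proof. by apply: exp_growth_sum => i; exact/exp_growthZ/(exp_growth_tilt pdS). Qed.

Lemma mixture_ratio_ge0 G x : (forall i, 0 <= @weight _ _ G i) -> 0 <= mixture_ratio G x.
Proof. by move=> w0; apply: sumr_ge0 => i _; rewrite mulr_ge0// expR_ge0. Qed.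

(** Twice the squared Hellinger distance, as a real number. *)
Definition hell2 (G H : mixing R d) : R :=
  I0 (fun x => (Num.sqrt (mixture_ratio G x) - Num.sqrt (mixture_ratio H x)) ^+ 2).

Lemma exp_growth_hell G H : exp_growth
  (fun x => (Num.sqrt (mixture_ratio G x) - Num.sqrt (mixture_ratio H x)) ^+ 2).
Proof.
apply: exp_growthX; apply: exp_growthB; apply: exp_growth_sqrt;
  exact: exp_growth_mixture_ratio.
Qed.

Lemma hell2_ge0 G H : 0 <= hell2 G H.
Proof. by apply: (I0_ge0 pdS) => x; exact: sqr_ge0. Qed.

Lemma hellingerE G H :
  hellinger (mixture_pdf S G) (mixture_pdf S H) = (Num.sqrt (hell2 G H / 2))%:E.
Proof.
rewrite /hellinger.
have -> : (\int[leb]_x ((Num.sqrt (mixture_pdf S G x) -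
    Num.sqrt (mixture_pdf S H x)) ^+ 2)%:E = (hell2 G H)%:E)%E.
  rewrite /hell2 /I0 /Rintegral fineK; last first.
    by apply: integrable_fin_num => //; apply: (integrable_gauss0 pdS); exact: exp_growth_hell.
  apply: eq_integral => x _; congr EFin.
  rewrite !mixture_pdf_ratio !(mulrC _ (gauss0 x)) !(sqrtrM _ (ltW (gauss0_gt0 pdS x))).
  by rewrite -mulrBr exprMn sqr_sqrtr// ltW// (gauss0_gt0 pdS).
by rewrite -EFinM poweR_EFin powR12_sqrt 1?mulrC// mulr_ge0// hell2_ge0.
Qed.

(* Cauchy-Schwarz, in the form given by the inequality of arithmetic and
   geometric means with a free parameter. *)
Lemma I0_mixture_ratioB u (G H : mixing R d) (K : R) :
  exp_growth u -> (forall i, 0 <= @weight _ _ G i) -> (forall i, 0 <= @weight _ _ H i) ->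
  I0 (fun x => u x ^+ 2 * mixture_ratio G x) <= K ->
  I0 (fun x => u x ^+ 2 * mixture_ratio H x) <= K ->
  `|I0 (fun x => u x * mixture_ratio G x) - I0 (fun x => u x * mixture_ratio H x)|
    <= (2 * K + 1) * Num.sqrt (hell2 G H).
Proof.
move=> gu G0 H0 GK HK.
have gG := exp_growth_mixture_ratio G; have gH := exp_growth_mixture_ratio H.
have gh := exp_growth_hell G H; have gu2 := exp_growthX 2 gu.
have K0 : 0 <= K.
  apply: le_trans GK; apply: (I0_ge0 pdS) => x.
  by rewrite mulr_ge0 ?sqr_ge0 ?mixture_ratio_ge0.
rewrite -(I0B pdS); try exact: exp_growthM.
set D := I0 _.
have key t : 0 < t -> `|D| <= t * (2 * K) + t^-1 * hell2 G H.
  move=> t0; apply: le_trans (I0_norm pdS _) _.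
    by apply: exp_growthB; exact: exp_growthM.
  apply: (@le_trans _ _ (I0 (fun x => t * (u x ^+ 2 * mixture_ratio G x + u x ^+ 2 * mixture_ratio H x) +
     t^-1 * (Num.sqrt (mixture_ratio G x) - Num.sqrt (mixture_ratio H x)) ^+ 2))).
    apply: (I0_le pdS) => [||x].
    - by apply: exp_growth_norm; apply: exp_growthB; exact: exp_growthM.
    - apply: exp_growthD; apply: exp_growthZ => //.
      by apply: exp_growthD; exact: exp_growthM.
    have := amgm_sqr (u x) (Num.sqrt (mixture_ratio G x)) (Num.sqrt (mixture_ratio H x)) t0.
    by rewrite !sqr_sqrtr// mixture_ratio_ge0.
  have gGH : exp_growth (fun x => u x ^+ 2 * mixture_ratio G x + u x ^+ 2 * mixture_ratio H x).
    by apply: exp_growthD; exact: exp_growthM.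
  rewrite (I0D pdS (exp_growthZ t gGH) (exp_growthZ t^-1 gh)).
  rewrite (I0Z pdS _ gGH) (I0Z pdS _ gh) (I0D pdS); try exact: exp_growthM.
  rewrite lerD2r; apply: ler_wpM2l; first exact: ltW.
  by rewrite mulr_natl mulr2n lerD.
(* The free parameter is the square root of [hell2 G H]; if that vanishes, arbitrarily small
   parameters give the bound 0. *)
have h0 := hell2_ge0 G H; move: h0; rewrite le0r => /orP[/eqP h0|h0].
  rewrite h0 sqrtr0 mulr0; apply/ler_addgt0Pr => e e0; rewrite add0r.
  have t0 : 0 < e / (2 * K + 1) by rewrite divr_gt0// ltr_wpDl// mulr_ge0.
  apply: le_trans (key _ t0) _; rewrite h0 mulr0 addr0 -mulrA mulrC.
  rewrite -[leRHS]mul1r ler_wpM2r ?(ltW e0)// ler_pdivrMl ?mulr1 ?lerDl//.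
  by rewrite ltr_wpDl// mulr_ge0.
have s0 : 0 < Num.sqrt (hell2 G H) by rewrite sqrtr_gt0.
apply: le_trans (key _ s0) _.
have -> : (Num.sqrt (hell2 G H))^-1 * hell2 G H = Num.sqrt (hell2 G H).
  by rewrite -[X in _^-1 * X](sqr_sqrtr (ltW h0)) expr2 mulrA mulVf ?mul1r// gt_eqF.
by rewrite le_eqVlt; apply/orP; left; apply/eqP; ring.
Qed.

End mixture_ratio.

(** * Polynomials with bounded coefficients *)

Section bounded_polynomials.
Variables (R : realType) (d : nat).
Local Notation E := 'rV[R]_d.
Implicit Types (g : E -> R) (theta : E) (w : seq 'I_d).

(* Polynomials of degree less than [n] whose coefficients sum to at most [B] in
   absolute value. *)
Definition bounded_poly (n : nat) (B : R) g :=
  exists s : seq (R * seq 'I_d),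
  [/\ all (fun p => size p.2 < n)%N s, \sum_(p <- s) `|p.1| <= B &
      forall theta, g theta = \sum_(p <- s) p.1 * mono p.2 theta].

Lemma bounded_poly_le n m B C g : (n <= m)%N -> B <= C ->
  bounded_poly n B g -> bounded_poly m C g.
Proof.
move=> nm BC [s [/allP sn sB gE]]; exists s; split=> //; last exact: le_trans BC.
by apply/allP => p /sn /leq_trans; apply.
Qed.

Lemma bounded_poly_ext n B g g' : g =1 g' -> bounded_poly n B g -> bounded_poly n B g'.
Proof. by move=> /funext ->. Qed.

Lemma bounded_poly0 n : bounded_poly n 0 (fun=> 0).
Proof. by exists [::]; split=> //= [|theta]; rewrite big_nil. Qed.

Lemma bounded_poly_mono c w : bounded_poly (size w).+1 `|c| (fun theta => c * mono w theta).
Proof.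
exists [:: (c, w)]; split=> /= [||theta]; first by rewrite ltnS leqnn.
  by rewrite big_seq1.
by rewrite big_seq1.
Qed.

Lemma bounded_polyD n B C g h : bounded_poly n B g -> bounded_poly n C h ->
  bounded_poly n (B + C) (fun theta => g theta + h theta).
Proof.
move=> [s [sn sB gE]] [t [tn tC hE]]; exists (s ++ t); split.
- by rewrite all_cat sn.
- by rewrite big_cat lerD.
- by move=> theta; rewrite big_cat gE hE.
Qed.

Lemma bounded_polyZ c n B g : bounded_poly n B g ->
  bounded_poly n (`|c| * B) (fun theta => c * g theta).
Proof.
move=> [s [/allP sn sB gE]]; exists [seq (c * p.1, p.2) | p <- s]; split.
- by apply/allP => _ /mapP[p /sn pn ->].
- rewrite big_map; under eq_bigr do rewrite normrM.
  by rewrite -mulr_sumr ler_wpM2l.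
- move=> theta; rewrite big_map gE mulr_sumr.
  by apply: eq_bigr => p _; rewrite mulrA.
Qed.

Lemma bounded_polyM n m B C g h : bounded_poly n B g -> bounded_poly m C h ->
  bounded_poly (n + m) (B * C) (fun theta => g theta * h theta).
Proof.
move=> [s [/allP sn sB gE]] [t [/allP tm tC hE]].
exists [seq (p.1 * q.1, p.2 ++ q.2) | p <- s, q <- t]; split.
- apply/allP => _ /allpairsP[[p q] /= [/sn pn /tm qm ->]] /=.
  by rewrite size_cat (leq_ltn_trans (_ : _ <= size p.2 + m)%N) ?leq_add2l ?ltn_add2r// ltnW.
- rewrite big_allpairs_dep /=.
  under eq_bigr do under eq_bigr do rewrite normrM.
  under eq_bigr do rewrite -mulr_sumr.
  by rewrite -mulr_suml ler_pM// sumr_ge0.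
- move=> theta; rewrite big_allpairs_dep gE hE mulr_suml; apply: eq_bigr => p _.
  rewrite mulr_sumr; apply: eq_bigr => q _ /=.
  by rewrite mono_cat; ring.
Qed.

Lemma bounded_poly_prod (I : eqType) (s : seq I) (g : I -> E -> R) n B :
  {in s, forall i, bounded_poly n B (g i)} ->
  bounded_poly (size s * n).+1 (B ^+ size s) (fun theta => \prod_(i <- s) g i theta).
Proof.
elim: s => [_|i s IH gB] /=.
  rewrite expr0; apply: bounded_poly_ext (bounded_poly_le _ _ (bounded_poly_mono 1 [::])) => //.
  - by move=> theta; rewrite mono_nil mulr1 big_nil.
  - by rewrite normr1.
apply: (@bounded_poly_ext _ _ (fun theta => g i theta * \prod_(j <- s) g j theta)).
  by move=> theta; rewrite big_cons.
rewrite exprS mulSn -addnS; apply: bounded_polyM; first by apply: gB; rewrite mem_head.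
by apply: IH => j js; apply: gB; rewrite in_cons js orbT.
Qed.

Definition mean (G : mixing R d) g : R := \sum_(i < Defs.order G) weight i * g (@atom _ _ G i).

Lemma meanB_bounded_poly (G H : mixing R d) n B C g : 0 <= C ->
  (forall w, (size w < n)%N -> `|mean G (mono w) - mean H (mono w)| <= C) ->
  bounded_poly n B g -> `|mean G g - mean H g| <= B * C.
Proof.
move=> C0 GH [s [/allP sn sB gE]].
have mE K : mean K g = \sum_(p <- s) p.1 * mean K (mono p.2).
  rewrite /mean; under eq_bigr do rewrite gE mulr_sumr.
  rewrite exchange_big/=; apply: eq_bigr => p _.
  by rewrite mulr_sumr; apply: eq_bigr => i _; rewrite mulrCA.
rewrite !mE -sumrB; apply: le_trans (ler_norm_sum _ _ _) _.
apply: le_trans (ler_wpM2r C0 sB); rewrite mulr_suml big_seq [leRHS]big_seq.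
apply: ler_sum => p /sn pn; rewrite -mulrBr normrM ler_wpM2l//; exact: GH.
Qed.

End bounded_polynomials.

(** * Comparison of moments by the Hellinger distance *)

Section moment_comparison.
Variables (R : realType) (d : nat) (S : 'M[R]_d).
Hypothesis pdS : posdef S.
Local Notation E := 'rV[R]_d.
Local Notation I0 := (I0 S).
Implicit Types (u v : E -> R) (x theta : E) (G H : mixing R d) (w : seq 'I_d).

Lemma bounded_polyX l n B (g : E -> R) : bounded_poly n B g ->
  bounded_poly n.+1 B (fun theta => theta ord0 l * g theta).
Proof.
move=> [s [/allP sn sB gE]]; exists [seq (p.1, l :: p.2) | p <- s]; split.
- by apply/allP => _ /mapP[p /sn pn ->].
- by rewrite big_map.
- move=> theta; rewrite big_map gE mulr_sumr.
  by apply: eq_bigr => p _; rewrite mono_cons mulrCA.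
Qed.

Lemma mono_le_expR w (D : nat) x : (size w <= D)%N -> `|mono w x| <= expR (D%:R * l1norm x).
Proof.
move=> wD; apply: (@le_trans _ _ (expR ((size w)%:R * l1norm x))); last first.
  by rewrite ler_expR ler_wpM2r ?l1norm_ge0// ler_nat.
elim: w {wD} => [|l w IH] /=; first by rewrite mono_nil normr1 mul0r expR0.
rewrite mono_cons normrM -natr1 mulrDl mul1r addrC expRD ler_pM//.
apply: le_trans (coord_le_l1norm x l) _.
by apply: le_trans (expR_ge1Dx _); rewrite lerDr.
Qed.

Lemma exp_growth_shift u theta : exp_growth u -> exp_growth (fun x => u (x + theta)).
Proof.
move=> [mu [C [a [C0 a0 uC]]]]; split.
  by apply: (measurableT_comp mu); exact: measurable_addrV.
exists (C * expR (a * l1norm theta)), a; split; rewrite ?mulr_ge0 ?expR_ge0// => x.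
apply: le_trans (uC _) _; rewrite -mulrA -expRD ler_wpM2l// ler_expR -mulrDr.
by rewrite ler_wpM2l// addrC l1normD.
Qed.

Lemma I0_mixture_ratio u G : exp_growth u ->
  I0 (fun x => u x * mixture_ratio S G x) = mean G (fun theta => I0 (fun x => u (x + theta))).
Proof.
move=> gu; rewrite /mean.
transitivity (I0 (fun x => \sum_(i < Defs.order G) weight i * (u x * tilt S (@atom _ _ G i) x))).
  congr (I0 _); apply/funext => x; rewrite mulr_sumr.
  by apply: eq_bigr => i _; rewrite mulrCA.
rewrite (I0_sum pdS); last by move=> i; apply: exp_growthM => //; exact: exp_growth_tilt.
by apply: eq_bigr => i _; rewrite (I0_shift pdS)//; case: gu.
Qed.

(** With [x] the Gaussian noise, the word [mono w (x + theta)] is expanded one letter at a time;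
    [w'] stores the letters already taken from the noise. *)
Definition shifted_moment w' w theta : R := I0 (fun x => mono w' x * mono w (x + theta)).

Let gmono w w' theta : exp_growth (fun x => mono w' x * mono w (x + theta)).
Proof.
by apply: exp_growthM; [exact: exp_growth_mono|exact/exp_growth_shift/exp_growth_mono].
Qed.

Lemma shifted_moment_cons w' l w theta :
  shifted_moment w' (l :: w) theta =
  shifted_moment (l :: w') w theta + theta ord0 l * shifted_moment w' w theta.
Proof.
rewrite /shifted_moment -(I0Z pdS)// -(I0D pdS)//; last exact: exp_growthZ.
by congr (I0 _); apply/funext => x; rewrite !mono_cons !mxE; ring.
Qed.

(** Each letter of [w] is read either from the noise or from [theta]. Reading all of them from
    [theta] gives the leading term; the other [2 ^+ size w - 1] choices have lower degree, each with
    a coefficient that is a Gaussian moment of size at most [m]. *)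
Lemma shifted_moment_poly D m : (forall w, (size w <= D)%N -> `|I0 (mono w)| <= m) ->
  forall w w', (size w + size w' <= D)%N ->
  bounded_poly (size w) ((2 ^+ size w - 1) * m)
    (fun theta => shifted_moment w' w theta - I0 (mono w') * mono w theta).
Proof.
move=> mD; elim=> [|l w IH] w' /= wD.
  rewrite expr0 subrr mul0r; apply: bounded_poly_ext (bounded_poly0 _ _ _) => theta.
  rewrite mono_nil mulr1 /shifted_moment.
  rewrite (_ : (fun x => _) = mono w') ?subrr//.
  by apply/funext => x; rewrite mono_nil mulr1.
have p1 := IH (l :: w') ltac:(by rewrite /= addnS).
have p2 := bounded_polyX l (IH w' (ltnW wD)).
have p3 := bounded_poly_mono (I0 (mono (l :: w'))) w.
have := bounded_polyD (bounded_polyD (bounded_poly_le (leqnSn _) (lexx _) p1) p3) p2.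
move/(@bounded_poly_ext _ _ _ _ _ _) => H; apply: bounded_poly_le (H _ _) => //.
  have : `|I0 (mono (l :: w'))| <= m by apply: mD; rewrite /= (leq_trans _ wD)// ltnS leq_addl.
  by rewrite exprS; lra.
by move=> theta /=; rewrite shifted_moment_cons mono_cons; ring.
Qed.

Definition in_ball (rad : R) G := [/\ forall i, enorm (@atom _ _ G i) <= rad,
  forall i, 0 <= @weight _ _ G i & \sum_(i < Defs.order G) @weight _ _ G i = 1].

Lemma mean_ub G g (K : R) : (forall i, 0 <= @weight _ _ G i) -> \sum_(i < Defs.order G) @weight _ _ G i = 1 ->
  (forall i, g (@atom _ _ G i) <= K) -> mean G g <= K.
Proof.
move=> w0 w1 gK; rewrite -[leRHS]mul1r -w1 mulr_suml.
by apply: ler_sum => i _; rewrite ler_wpM2l.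
Qed.

Lemma moment_comparison (rad : R) (D : nat) : exists2 C : R, 0 < C &
  forall G H, in_ball rad G -> in_ball rad H -> forall w, (size w < D)%N ->
  `|mean G (mono w) - mean H (mono w)| <= C * Num.sqrt (hell2 S G H).
Proof.
elim: D => [|D [C C0 IH]]; first by exists 1.
pose m := I0 (fun x => expR (D%:R * l1norm x)).
pose K := I0 (fun x => expR (2 * (D%:R * (l1norm x + d%:R * rad)))).
have gexp (c a : R) : 0 <= a -> exp_growth (fun x : E => expR (c + a * l1norm x)).
  move=> a0; apply: exp_growth_expR a0 (fun x => lexx _).
  by apply: measurable_funD => //; apply: measurable_funM => //; exact: measurable_l1norm.
have gm : exp_growth (fun x : E => expR (D%:R * l1norm x)).
  have := gexp 0 D%:R (ler0n _ _); congr exp_growth.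
  by apply/funext => x; rewrite add0r.
have gK : exp_growth (fun x : E => expR (2 * (D%:R * (l1norm x + d%:R * rad)))).
  have := gexp (2 * (D%:R * (d%:R * rad))) (2 * D%:R) ltac:(by rewrite mulr_ge0).
  by congr exp_growth; apply/funext => x; congr expR; ring.
have mD w : (size w <= D)%N -> `|I0 (mono w)| <= m.
  move=> wD; have gw : exp_growth (mono w : E -> R) := exp_growth_mono w.
  have h := I0_norm pdS gw; apply: le_trans h _.
  apply: (I0_le pdS) => //; first exact/exp_growth_norm/exp_growth_mono.
  by move=> x; exact: mono_le_expR.
have m0 : 0 <= m by apply: le_trans (mD [::] _).
have K0 : 0 <= K by apply: (I0_ge0 pdS) => x; exact: expR_ge0.
have c0 := I0_gt0 pdS; set c := I0 _ in c0.
(* [c] is the coefficient of the leading moment, [2 * K + 1] the Cauchy-Schwarz constant of the test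
   monomial, and [2 ^+ D * m] bounds the coefficients of the lower-degree part, to which the
   induction hypothesis applies. *)
exists (c^-1 * ((2 * K + 1) + (2 ^+ D * m) * C)).
  rewrite mulr_gt0 ?invr_gt0// ltr_wpDr//.
    by rewrite !mulr_ge0// ?ltW// exprn_gt0.
  by rewrite ltr_wpDl// mulr_ge0.
move=> G H GB HB w wD.
have IHw := IH _ _ GB HB.
have [Ga G0 G1] := GB; have [Ha H0 H1] := HB.
have KG L : in_ball rad L -> I0 (fun x => mono w x ^+ 2 * mixture_ratio S L x) <= K.
  move=> [La L0 L1]; rewrite I0_mixture_ratio; last exact/exp_growthX/exp_growth_mono.
  apply: mean_ub => // i; apply: (I0_le pdS) => //.
    apply: (@exp_growth_shift (fun x => mono w x ^+ 2)).
    exact/exp_growthX/exp_growth_mono.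
  move=> x; rewrite expRM_natl -real_normK ?num_real// ler_pXn2r ?nnegrE ?expR_ge0//.
  apply: le_trans (mono_le_expR _ (wD : (size w <= D)%N)) _.
  rewrite ler_expR ler_wpM2l//; apply: le_trans (l1normD _ _) _.
  rewrite lerD2l; apply: le_trans (l1norm_le_enorm _) _.
  by rewrite ler_wpM2l.
have CS := I0_mixture_ratioB pdS (exp_growth_mono w) G0 H0 (KG G GB) (KG H HB).
rewrite !I0_mixture_ratio in CS; try exact: exp_growth_mono.
have sE L : mean L (fun theta => I0 (fun x => mono w (x + theta))) =
    c * mean L (mono w) + mean L (fun theta => shifted_moment [::] w theta - I0 (mono [::]) * mono w theta).
  rewrite /mean mulr_sumr -big_split; apply: eq_bigr => i _ /=.
  have -> : I0 (mono [::]) = c by congr (I0 _); apply/funext => x; rewrite mono_nil.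
  have -> : shifted_moment [::] w (atom i) = I0 (fun x => mono w (x + atom i)).
    by congr (I0 _); apply/funext => x; rewrite mono_nil mul1r.
  by ring.
have wD' : (size w + size ([::] : seq 'I_d) <= D)%N by rewrite addn0.
have pw := shifted_moment_poly mD wD'.
have pb := meanB_bounded_poly (mulr_ge0 (ltW C0) (sqrtr_ge0 (hell2 S G H)))
  (fun (w1 : seq 'I_d) (w1D : (size w1 < size w)%N) => IHw w1 (leq_trans (w1D : (size w1 < size w)%N) (wD : (size w <= D)%N))) pw.
rewrite !sE in CS.
rewrite -[leRHS]mulrA ler_pdivlMl// -[X in X * _ <= _](gtr0_norm c0) -normrM.
set a := mean G (mono w) in CS *; set b := mean H (mono w) in CS *.
move: CS pb; set p := mean G _; set q := mean H _ => CS pb.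
have -> : c * (a - b) = (c * a + p - (c * b + q)) - (p - q) by ring.
apply: le_trans (ler_normB _ _) _; rewrite mulrDl lerD//.
apply: le_trans pb _; rewrite !mulrA ler_wpM2r ?sqrtr_ge0// ler_wpM2r ?(ltW C0)//.
rewrite ler_wpM2r// lerBlDr (le_trans (_ : _ <= 2 ^+ D)) ?lerDl//.
by rewrite ler_weXn2l// ler1n.
Qed.

End moment_comparison.

(** * Lower bound on the Hellinger distance *)

Section interpolation.
Variables (R : realType) (d : nat).
Local Notation E := 'rV[R]_d.
Implicit Types (x y a b theta : E) (t z rad : R).

Definition dotp x y : R := \sum_(i < d) x ord0 i * y ord0 i.

Lemma sqnorm_ge0 x : 0 <= sqnorm x.
Proof. by apply: sumr_ge0 => i _; exact: sqr_ge0. Qed.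

Lemma sqnormZD (s r : R) x y :
  sqnorm (s *: x + r *: y) = s ^+ 2 * sqnorm x + 2 * s * r * dotp x y + r ^+ 2 * sqnorm y.
Proof.
rewrite /sqnorm /dotp !mulr_sumr -!big_split; apply: eq_bigr => i _ /=.
by rewrite !mxE; ring.
Qed.

Lemma dotp_sqr_le x y : dotp x y ^+ 2 <= sqnorm x * sqnorm y.
Proof.
have [y0|y0] := eqVneq (sqnorm y) 0.
  have {}y0 i : y ord0 i = 0.
    apply/eqP; rewrite -sqrf_eq0; apply/eqP.
    have /psumr_eq0P := y0; apply => // j _; exact: sqr_ge0.
  by rewrite /dotp big1 ?expr0n ?mulr_ge0 ?sqnorm_ge0//= => i _; rewrite y0 mulr0.
have yp : 0 < sqnorm y by rewrite lt_neqAle eq_sym y0 sqnorm_ge0.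
have := sqnorm_ge0 (sqnorm y *: x + (- dotp x y) *: y).
rewrite sqnormZD.
have -> : sqnorm y ^+ 2 * sqnorm x + 2 * sqnorm y * - dotp x y * dotp x y +
  (- dotp x y) ^+ 2 * sqnorm y = sqnorm y * (sqnorm x * sqnorm y - dotp x y ^+ 2) by ring.
by rewrite pmulr_rge0// subr_ge0.
Qed.

Lemma sqnormD_le x y : sqnorm (x + y) <= 2 * sqnorm x + 2 * sqnorm y.
Proof.
rewrite /sqnorm !mulr_sumr -big_split; apply: ler_sum => i _ /=; rewrite mxE.
by have := sqr_ge0 (x ord0 i - y ord0 i); nra.
Qed.

Lemma sqnormN x : sqnorm (- x) = sqnorm x.
Proof. by apply: eq_bigr => i _; rewrite mxE sqrrN. Qed.

Lemma sqnormB_ball rad x y : enorm x <= rad -> enorm y <= rad ->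
  sqnorm (x - y) <= 4 * rad ^+ 2.
Proof.
move=> xr yr; apply: le_trans (sqnormD_le _ _) _; rewrite sqnormN -!enorm_sqr.
have e0 (v : E) : 0 <= enorm v by exact: sqrtr_ge0.
have := lerXn2r 2 (e0 x) (le_trans (e0 x) xr) xr.
by have := lerXn2r 2 (e0 y) (le_trans (e0 y) yr) yr; lra.
Qed.

Lemma bounded_poly_coordB rad (a : E) i : enorm a <= rad ->
  bounded_poly 2 (1 + rad) (fun theta : E => theta ord0 i - a ord0 i).
Proof.
move=> ar; have p1 := bounded_poly_mono (1 : R) [:: i].
have p2 := bounded_poly_le (isT : 1 <= 2)%N (lexx _) (bounded_poly_mono (- a ord0 i) ([::] : seq 'I_d)).
have := bounded_polyD p1 p2; rewrite normr1 normrN => p.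
apply: bounded_poly_ext (bounded_poly_le (leqnn _) _ p) => [theta|].
  by rewrite mono_cons !mono_nil mul1r !mulr1.
by rewrite lerD2l (le_trans (coord_le_enorm _ _)).
Qed.

Lemma bounded_poly_sum (I : Type) (s : seq I) (g : I -> E -> R) n B :
  (forall i, bounded_poly n B (g i)) ->
  bounded_poly n ((size s)%:R * B) (fun theta => \sum_(i <- s) g i theta).
Proof.
move=> gB; elim: s => [|i s IH] /=.
  rewrite mul0r; apply: bounded_poly_ext (bounded_poly0 _ _ _) => theta.
  by rewrite big_nil.
apply: (@bounded_poly_ext _ _ _ _ (fun theta => g i theta + \sum_(j <- s) g j theta)).
  by move=> theta; rewrite big_cons.
by rewrite -natr1 mulrDl mul1r addrC; exact: bounded_polyD.
Qed.

Lemma bounded_poly_sqdist rad (a : E) : enorm a <= rad ->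
  bounded_poly 4 (d%:R * (1 + rad) ^+ 2) (fun theta => sqnorm (theta - a)).
Proof.
move=> ar; have := @bounded_poly_sum _ (index_enum 'I_d)
  (fun i theta => (theta ord0 i - a ord0 i) * (theta ord0 i - a ord0 i)) 4 ((1 + rad) ^+ 2).
have -> : size (index_enum 'I_d) = d.
  by rewrite -[RHS]card_ord cardT enumT.
move=> H; apply: bounded_poly_ext (H _).
  by move=> theta; apply: eq_bigr => i _; rewrite !mxE expr2.
move=> i; rewrite expr2.
by apply: (bounded_polyM (n := 2) (m := 2)); exact: bounded_poly_coordB.
Qed.

(** First-order expansion with an error quadratic in [t]. Both sides carry [(1 + t) ^+ 2], because
    the natural exponent [2 * size s - 2] is negative for the empty list, from which the induction
    starts. *)
Lemma prod_expansion (I : Type) (s : seq I) (L e : I -> R) t :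
  0 <= t -> (forall i, `|L i| <= 2 * t) -> (forall i, 0 <= e i <= t ^+ 2) ->
  (forall i, 0 <= 1 + L i + e i) ->
  `|\prod_(i <- s) (1 + L i + e i) - 1 - \sum_(i <- s) L i| * (1 + t) ^+ 2
     <= 2 * (size s)%:R ^+ 2 * t ^+ 2 * (1 + t) ^+ (2 * size s).
Proof.
move=> t0 Lt et Le0.
have sL (s' : seq I) : `|\sum_(i <- s') L i| <= 2 * (size s')%:R * t.
  elim: s' => [|i s' IH]; first by rewrite big_nil normr0 mulr0 mul0r.
  rewrite big_cons (le_trans (ler_normD _ _))//= -natr1.
  by have := Lt i; lra.
elim: s => [|i s IH].
  by rewrite !big_nil subr0 subrr normr0 mul0r !mulr_ge0// exprn_ge0// addr_ge0.
rewrite !big_cons /=; have := sL s; have := Lt i; have /andP[e0 et2] := et i; have := Le0 i.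
move: IH; set n := size s; set P := \prod_(_ <- _) _; set M := \sum_(_ <- _) _.
move=> IH x0 Li Mn.
have -> : (1 + L i + e i) * P - 1 - (L i + M) =
   e i + (L i + e i) * M + (1 + L i + e i) * (P - 1 - M) by ring.
have u1 : 1 <= 1 + t by rewrite lerDl.
have xu : 1 + L i + e i <= (1 + t) ^+ 2 by move: Li; rewrite ler_norml => /andP[]; lra.
have Lei : `|L i + e i| <= 2 * t + t ^+ 2.
  by rewrite (le_trans (ler_normD _ _))// lerD// ger0_norm.
have U1 : n%:R * (1 + t) <= n%:R * (1 + t) ^+ (2 * n).
  case: (n) => [|m]; first by rewrite !mul0r.
  by rewrite ler_wpM2l// mulnS exprD -[leLHS]mulr1 ler_pM// ?expr2 ?ler_peMl// ?exprn_ege1// (le_trans ler01).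
have U2 : 1 <= (1 + t) ^+ (2 * n) by rewrite exprn_ege1.
apply: (@le_trans _ _ ((t ^+ 2 + (2 * t + t ^+ 2) * (2 * n%:R * t)) * (1 + t) ^+ 2 +
    (1 + t) ^+ 2 * (2 * n%:R ^+ 2 * t ^+ 2 * (1 + t) ^+ (2 * n)))).
  apply: (@le_trans _ _ ((e i + `|L i + e i| * `|M|) * (1 + t) ^+ 2 +
      (1 + L i + e i) * (`|P - 1 - M| * (1 + t) ^+ 2))).
    rewrite [X in _ <= _ + X]mulrA -mulrDl ler_wpM2r ?sqr_ge0//.
    apply: le_trans (ler_normD _ _) _; rewrite lerD//; last by rewrite normrM ger0_norm.
    by apply: le_trans (ler_normD _ _) _; rewrite normrM (ger0_norm e0).
  apply: lerD; first by rewrite ler_wpM2r ?sqr_ge0// lerD// ler_pM.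
  by apply: ler_pM => //; rewrite mulr_ge0// sqr_ge0.
rewrite mulnS exprD (_ : n.+1%:R = n%:R + 1 :> R); last by rewrite natr1.
set U := (1 + t) ^+ (2 * n) in U1 U2 *; set v := (1 + t) ^+ 2.
have -> : (t ^+ 2 + (2 * t + t ^+ 2) * (2 * n%:R * t)) * v + v * (2 * n%:R ^+ 2 * t ^+ 2 * U) =
  (t ^+ 2 * v) * (1 + 2 * n%:R * (2 + t) + 2 * n%:R ^+ 2 * U) by ring.
have -> : 2 * (n%:R + 1) ^+ 2 * t ^+ 2 * (v * U) =
  (t ^+ 2 * v) * (2 * n%:R ^+ 2 * U + 4 * (n%:R * U) + 2 * U) by ring.
rewrite ler_wpM2l//; first by rewrite mulr_ge0// sqr_ge0.
have n0 : 0 <= n%:R :> R by [].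
have nt : 0 <= n%:R * t by rewrite mulr_ge0.
lra.
Qed.

End interpolation.

(** * Interpolating polynomials at separated atoms *)

Section interpolation_polynomial.
Variables (R : realType) (d m : nat) (rad Delta : R).
Local Notation E := 'rV[R]_d.
Variable a : 'I_m.+2 -> E.
Hypothesis Delta0 : 0 < Delta.
Hypothesis Delta_rad : Delta <= 2 * rad.
Hypothesis a_ball : forall j, enorm (a j) <= rad.
Hypothesis a_sep : forall i j, i != j -> Delta ^+ 2 <= sqnorm (a i - a j).
Implicit Types (theta : E) (j l : 'I_m.+2).

Let rad0 : 0 < rad. Proof. by have := lt_le_trans Delta0 Delta_rad; rewrite pmulr_rgt0. Qed.

Definition others j : seq 'I_m.+2 := enum (predC1 j).

Lemma size_others j : size (others j) = m.+1.
Proof. by rewrite -cardE cardC1 card_ord. Qed.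

Lemma mem_others j l : (l \in others j) = (l != j).
Proof. by rewrite mem_enum. Qed.

Definition sep_product j theta : R :=
  \prod_(l <- others j) (sqnorm (theta - a l) / sqnorm (a j - a l)).

(** Differential of [sep_product j] at [a j], applied to [theta - a j]. *)
Definition sep_slope j theta : R :=
  \sum_(l <- others j) (2 * dotp (theta - a j) (a j - a l) / sqnorm (a j - a l)).

(* The factor [1 - sep_slope j] cancels the gradient of [sep_product j] at [a j]. *)
Definition interp j theta : R := sep_product j theta * (1 - sep_slope j theta).

Lemma interp_node j : interp j (a j) = 1.
Proof.
rewrite /interp /sep_product /sep_slope big_seq big1 => [|l]; last first.
  rewrite mem_others => lj; rewrite divff// gt_eqF//.
  by rewrite (lt_le_trans _ (a_sep _)) ?exprn_gt0// eq_sym.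
rewrite big1 ?subr0 ?mulr1// => l _.
by rewrite /dotp big1 ?mulr0 ?mul0r// => i _; rewrite subrr mxE mul0r.
Qed.

Lemma sqnorm0 : sqnorm (0 : E) = 0.
Proof. by rewrite /sqnorm big1// => i _; rewrite mxE expr0n. Qed.

Lemma interp_other j l : l != j -> interp j (a l) = 0.
Proof.
move=> lj; rewrite /interp /sep_product.
by rewrite (bigD1_seq l) ?mem_others ?enum_uniq//= subrr sqnorm0 !mul0r.
Qed.

Let sep_sqr j l : l != j -> 0 < sqnorm (a j - a l).
Proof.
by move=> lj; rewrite (lt_le_trans _ (a_sep _)) ?exprn_gt0// eq_sym.
Qed.

Let ratioE j l theta : l != j ->
  sqnorm (theta - a l) / sqnorm (a j - a l) =
  1 + 2 * dotp (theta - a j) (a j - a l) / sqnorm (a j - a l) +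
  sqnorm (theta - a j) / sqnorm (a j - a l).
Proof.
move=> /sep_sqr N0.
have -> : theta - a l = 1 *: (theta - a j) + 1 *: (a j - a l).
  by rewrite !scale1r addrA subrK.
by rewrite sqnormZD; field; rewrite gt_eqF.
Qed.

Section at_theta.
Variables (j : 'I_m.+2) (theta : E) (t : R).
Hypothesis t0 : 0 <= t.
Hypothesis t2 : t ^+ 2 = sqnorm (theta - a j) / Delta ^+ 2.
Hypothesis t1 : 1 + t <= 4 * rad / Delta.

Let slope l := if l == j then 0 else 2 * dotp (theta - a j) (a j - a l) / sqnorm (a j - a l).
Let rest l := if l == j then 0 else sqnorm (theta - a j) / sqnorm (a j - a l).

Let t20 : 0 <= 2 * t.
Proof. by apply: mulr_ge0 => //; exact: t0. Qed.

Let slope_le l : `|slope l| <= 2 * t.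
Proof.
rewrite /slope; case: eqVneq => [_|lj]; first by rewrite normr0; exact: t20.
rewrite -(@ler_pXn2r _ 2)// ?nnegrE//.
rewrite real_normK ?num_real//.
have N0 := sep_sqr lj; have NX := dotp_sqr_le (theta - a j) (a j - a l).
have DN : Delta ^+ 2 <= sqnorm (a j - a l) by apply: a_sep; rewrite eq_sym.
have -> : (2 * t) ^+ 2 = 4 * t ^+ 2 by ring.
rewrite t2; move: N0 NX DN (sqnorm_ge0 (theta - a j)).
move: (dotp _ _) (sqnorm _) (sqnorm _) => D X N N0 DX DN X0.
have -> : (2 * D / N) ^+ 2 = 4 * (D ^+ 2 / N ^+ 2) by field; rewrite gt_eqF.
rewrite ler_wpM2l// ler_pdivrMr ?exprn_gt0// (le_trans DX)//.
rewrite expr2 mulrA ler_wpM2r ?(ltW N0)// -mulrA ler_peMr//.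
by rewrite mulrC ler_pdivlMr ?mulr_gt0// mul1r -expr2.
Qed.

Let rest_le l : 0 <= rest l <= t ^+ 2.
Proof.
rewrite /rest; case: eqVneq => [_|lj]; first by rewrite lexx exprn_ge0.
have N0 := sep_sqr lj.
rewrite divr_ge0 ?sqnorm_ge0//= t2 ler_wpM2l ?sqnorm_ge0//.
rewrite lef_pV2 ?posrE ?exprn_gt0//.
by apply: a_sep; rewrite eq_sym.
Qed.

Let ratio_slope l : l != j ->
  sqnorm (theta - a l) / sqnorm (a j - a l) = 1 + slope l + rest l.
Proof. by move=> lj; rewrite ratioE// /slope /rest (negbTE lj). Qed.

Let factor_ge0 l : 0 <= 1 + slope l + rest l.
Proof.
have [->|lj] := eqVneq l j; first by rewrite /slope /rest eqxx !addr0.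
by rewrite -ratio_slope// divr_ge0 ?sqnorm_ge0.
Qed.

Let factor_le l : 1 + slope l + rest l <= (1 + t) ^+ 2.
Proof. by have := slope_le l; have := rest_le l; rewrite ler_norml => /andP[? ?] /andP[? ?]; lra. Qed.

Let sep_productE : sep_product j theta = \prod_(l <- others j) (1 + slope l + rest l).
Proof.
rewrite /sep_product big_seq [RHS]big_seq; apply: eq_bigr => l.
by rewrite mem_others => lj; rewrite ratio_slope.
Qed.

Let sep_slopeE : sep_slope j theta = \sum_(l <- others j) slope l.
Proof.
rewrite /sep_slope big_seq [RHS]big_seq; apply: eq_bigr => l.
by rewrite mem_others => /negPf lj; rewrite /slope lj.
Qed.

Let sep_slope_le : `|sep_slope j theta| <= 2 * m.+1%:R * t.
Proof.
rewrite sep_slopeE; apply: le_trans (ler_norm_sum _ _ _) _.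
apply: le_trans (ler_sum _ (fun l _ => slope_le l)) _.
by rewrite big_const_seq count_predT size_others iter_addr_0 -mulr_natr; lra.
Qed.

(** Relative to [t ^+ 2], the first summand bounds the squared slope and the second the remainder of
    the product times [1 - sep_slope]; the power of [4 * rad] comes from trading [1 + t] for
    [4 * rad / Delta]. *)
Definition interp_cst : R :=
  (4 * m.+1%:R ^+ 2 + 2 * m.+1%:R ^+ 2 * (1 + 2 * m.+1%:R)) * (4 * rad) ^+ (2 * m + 1).

Let u1 : 1 <= 1 + t. Proof. by rewrite lerDl. Qed.

Let powt (X c : R) : 0 <= X -> 0 <= c ->
  c * (X / Delta ^+ 2) * (1 + t) ^+ (2 * m + 1) <=
  c * (4 * rad) ^+ (2 * m + 1) * X * Delta^-1 ^+ (2 * m + 3).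
Proof.
move=> X0 c0; rewrite (_ : 2 * m + 3 = 2 * m + 1 + 2)%N; last by rewrite -addnA.
rewrite (exprD _ (2 * m + 1) 2) -exprVn.
have -> : c * (4 * rad) ^+ (2 * m + 1) * X * (Delta^-1 ^+ (2 * m + 1) * Delta^-1 ^+ 2) =
  c * (X * Delta^-1 ^+ 2) * ((4 * rad) ^+ (2 * m + 1) * Delta^-1 ^+ (2 * m + 1)) by ring.
rewrite -exprMn ler_wpM2l//.
  by apply: mulr_ge0 => //; apply: mulr_ge0 => //; exact: sqr_ge0.
by apply: lerXn2r => //; rewrite nnegrE ?(le_trans ler01 u1)// divr_ge0 ?ltW// mulr_gt0.
Qed.

Let interp_cst_ge0 : 0 <= 4 * m.+1%:R ^+ 2 + 2 * m.+1%:R ^+ 2 * (1 + 2 * m.+1%:R) :> R.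
Proof. by rewrite !(addr_ge0, mulr_ge0). Qed.

Let interp_near_subproof : `|interp j theta - 1| <=
  interp_cst * sqnorm (theta - a j) * Delta^-1 ^+ (2 * m + 3).
Proof.
apply: le_trans (powt (sqnorm_ge0 _) interp_cst_ge0); rewrite -t2.
have u0 := lt_le_trans ltr01 u1.
have := prod_expansion (others j) t0 slope_le rest_le factor_ge0.
rewrite -sep_productE -sep_slopeE size_others mulnS addnC exprD mulrA.
rewrite ler_pM2r ?exprn_gt0//; set M := sep_slope j theta; move=> HE.
(* The terms of first order cancel: [(1 + M + rho) (1 - M) = 1 - M^2 + rho (1 - M)]. *)
have -> : interp j theta - 1 =
   - M ^+ 2 + (sep_product j theta - 1 - M) * (1 - M) by rewrite /interp -/M; ring.
have M2 : M ^+ 2 <= 4 * m.+1%:R ^+ 2 * t ^+ 2.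
  have -> : 4 * m.+1%:R ^+ 2 * t ^+ 2 = (2 * m.+1%:R * t) ^+ 2 by ring.
  rewrite -real_normK ?num_real//; apply: lerXn2r; rewrite ?nnegrE//.
  by apply: mulr_ge0 => //; apply: mulr_ge0.
have M1 : `|1 - M| <= (1 + 2 * m.+1%:R) * (1 + t).
  apply: le_trans (ler_normB _ _) _; rewrite normr1.
  have : 0 <= m.+1%:R :> R by []. have := sep_slope_le; have := t0; rewrite -/M; lra.
apply: le_trans (ler_normD _ _) _.
apply: (@le_trans _ _ (4 * m.+1%:R ^+ 2 * t ^+ 2 * (1 + t) ^+ (2 * m + 1) +
    (2 * m.+1%:R ^+ 2 * t ^+ 2 * (1 + t) ^+ (2 * m)) * ((1 + 2 * m.+1%:R) * (1 + t)))).
  apply: lerD; last by rewrite normrM; exact: ler_pM.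
  rewrite normrN (ger0_norm (sqr_ge0 M)); apply: (le_trans M2).
  rewrite ler_peMr ?exprn_ege1//.
  by apply: mulr_ge0; [apply: mulr_ge0 => //; exact: sqr_ge0|exact: sqr_ge0].
by rewrite exprD expr1 le_eqVlt; apply/orP; left; apply/eqP; ring.
Qed.

(** The factor of [a l] supplies [sqnorm (theta - a l)]; each of the [m] others is at most
    [(1 + t) ^+ 2], and [1 - sep_slope] is of order [1 + t]. *)
Let interp_far_subproof l : l != j -> `|interp j theta| <=
  interp_cst * sqnorm (theta - a l) * Delta^-1 ^+ (2 * m + 3).
Proof.
move=> lj; apply: le_trans (powt (sqnorm_ge0 _) interp_cst_ge0).
have u0 := lt_le_trans ltr01 u1.
rewrite /interp normrM /sep_product (bigD1_seq l) ?mem_others ?enum_uniq//=.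
rewrite normrM [X in X * _ * _]ger0_norm ?divr_ge0 ?sqnorm_ge0//.
have Q : `|\prod_(l0 <- others j | l0 != l) (sqnorm (theta - a l0) / sqnorm (a j - a l0))|
    <= (1 + t) ^+ (2 * m).
  have -> : (1 + t) ^+ (2 * m) = \prod_(l0 <- others j | l0 != l) (1 + t) ^+ 2.
    rewrite big_const_seq iter_mulr_1 -exprM; congr (_ ^+ (2 * _)).
    have := count_predC (pred1 l) (others j); rewrite size_others count_uniq_mem ?enum_uniq//.
    by rewrite mem_others lj /= add1n => -[cE]; apply: etrans (esym cE) _; exact: eq_count.
  rewrite normr_prod big_seq_cond [leRHS]big_seq_cond.
  apply: ler_prod => l0; rewrite mem_others => /andP[l0j _].
  by rewrite ratio_slope// ger0_norm// factor_ge0 factor_le.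
have M1 : `|1 - sep_slope j theta| <= (1 + 2 * m.+1%:R) * (1 + t).
  apply: le_trans (ler_normB _ _) _; rewrite normr1.
  have : 0 <= m.+1%:R :> R by []. have := sep_slope_le; have := t0; lra.
have P1 : sqnorm (theta - a l) / sqnorm (a j - a l) <= sqnorm (theta - a l) / Delta ^+ 2.
  rewrite ler_wpM2l ?sqnorm_ge0// lef_pV2 ?posrE ?exprn_gt0// ?sep_sqr//.
  by apply: a_sep; rewrite eq_sym.
apply: (@le_trans _ _ (sqnorm (theta - a l) / Delta ^+ 2 * (1 + t) ^+ (2 * m) *
   ((1 + 2 * m.+1%:R) * (1 + t)))).
  have r0 : 0 <= sqnorm (theta - a l) / sqnorm (a j - a l).
    by rewrite divr_ge0 ?sqnorm_ge0.
  apply: ler_pM => //; last exact: ler_pM.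
  exact: mulr_ge0.
rewrite exprD expr1.
have -> : sqnorm (theta - a l) / Delta ^+ 2 * (1 + t) ^+ (2 * m) * ((1 + 2 * m.+1%:R) * (1 + t)) =
   (1 + 2 * m.+1%:R) * (sqnorm (theta - a l) / Delta ^+ 2) * ((1 + t) ^+ (2 * m) * (1 + t)) by ring.
rewrite ler_wpM2r ?mulr_ge0 ?exprn_ge0 ?(ltW u0)// ler_wpM2r//.
  by rewrite divr_ge0 ?sqnorm_ge0// exprn_ge0// ltW.
have m1 : 1 <= m.+1%:R ^+ 2 :> R by rewrite -natrX ler1n expn_gt0.
have : 0 <= m.+1%:R ^+ 3 :> R by [].
have : m.+1%:R <= m.+1%:R ^+ 2 :> R by rewrite -natrX ler_nat -mulnn leq_pmulr.
by rewrite exprS; nra.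
Qed.

Lemma interp_node_bounds : `|interp j theta - 1| <=
    interp_cst * sqnorm (theta - a j) * Delta^-1 ^+ (2 * m + 3) /\
  forall l, l != j -> `|interp j theta| <=
    interp_cst * sqnorm (theta - a l) * Delta^-1 ^+ (2 * m + 3).
Proof. by split => [|l lj]; [exact: interp_near_subproof|exact: interp_far_subproof]. Qed.

End at_theta.

(** Taken at the atom [a l] nearest to [theta], this makes [interp j] a polynomial stand-in for the
    indicator of the [j]-th cell, with errors that average to a multiple of the mean squared
    distance. *)
Lemma interp_bound j l theta : enorm theta <= rad -> `|interp j theta - (l == j)%:R| <=
    interp_cst * sqnorm (theta - a l) * Delta^-1 ^+ (2 * m + 3).
Proof.
move=> theta_ball; pose t := enorm (theta - a j) / Delta.
have t0 : 0 <= t by rewrite divr_ge0 ?sqrtr_ge0// ltW.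
have t2 : t ^+ 2 = sqnorm (theta - a j) / Delta ^+ 2.
  by rewrite exprMn enorm_sqr exprVn.
have t1 : 1 + t <= 4 * rad / Delta.
  rewrite ler_pdivlMr// mulrDl mul1r divfK ?gt_eqF//.
  have : enorm (theta - a j) <= 2 * rad.
    rewrite -(@ler_pXn2r _ 2)// ?nnegrE ?sqrtr_ge0 ?mulr_ge0 ?(ltW rad0)//.
    rewrite enorm_sqr (le_trans (sqnormB_ball theta_ball (a_ball j)))//.
    by rewrite exprMn -natrX.
  by have := Delta_rad; lra.
have [near far] := interp_node_bounds t0 t2 t1.
by have [->//|lj] := eqVneq l j; rewrite subr0; exact: far.
Qed.

Definition interp_weight : R :=
  (d%:R * (1 + rad) ^+ 2) ^+ m.+1 * (2 * rad + m.+1%:R * (d%:R * (2 * (1 + rad)))).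

(** Each of the [m + 1] normalised factors contributes two powers of [Delta^-1] to the coefficients
    and the affine factor one more, its constant term 1 being at most [2 * rad / Delta]. *)
Lemma interp_poly j : bounded_poly (m.+1 * 4 + 3)
  (interp_weight * Delta^-1 ^+ (2 * m + 3)) (interp j).
Proof.
have D2 : 0 < Delta ^+ 2 by rewrite exprn_gt0.
have Di : 0 < Delta^-1 by rewrite invr_gt0.
pose B := d%:R * (1 + rad) ^+ 2 * Delta^-1 ^+ 2.
have Q : bounded_poly (m.+1 * 4).+1 (B ^+ m.+1) (sep_product j).
  rewrite -[in (m.+1 * 4).+1](size_others j) -[in B ^+ _](size_others j).
  apply: bounded_poly_prod => l; rewrite mem_others => lj.
  have N0 := sep_sqr lj.
  apply: (bounded_poly_ext (g := fun theta => (sqnorm (a j - a l))^-1 * sqnorm (theta - a l))).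
    by move=> theta; rewrite mulrC.
  apply: bounded_poly_le (bounded_polyZ _ (bounded_poly_sqdist (a_ball l))) => //.
  rewrite mulrC ler_wpM2l//; first by rewrite mulr_ge0// sqr_ge0.
  have Ni : 0 < (sqnorm (a j - a l))^-1 by rewrite invr_gt0.
  rewrite (gtr0_norm Ni) exprVn lef_pV2 ?posrE//.
  by apply: a_sep; rewrite eq_sym.
have Z : bounded_poly 2 (m.+1%:R * (d%:R * (2 * (1 + rad) * Delta^-1))) (sep_slope j).
  rewrite (_ : m.+1%:R = (size (others j))%:R :> R); last by rewrite size_others.
  apply: (bounded_poly_ext (g := fun theta => \sum_(l <- others j) (if l == j then 0 else
     2 * dotp (theta - a j) (a j - a l) / sqnorm (a j - a l)))).
    move=> theta; rewrite /sep_slope big_seq [RHS]big_seq; apply: eq_bigr => l.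
    by rewrite mem_others => /negPf ->.
  apply: bounded_poly_sum => l.
  have [_|lj] := eqVneq l j.
    apply: bounded_poly_le (bounded_poly0 R d 2) => //.
    rewrite mulr_ge0// mulr_ge0 ?invr_ge0 ?(ltW Delta0)// mulr_ge0// addr_ge0//.
    exact: ltW.
  have N0 := sep_sqr lj.
  pose c i := 2 * (a j - a l) ord0 i / sqnorm (a j - a l).
  apply: (bounded_poly_ext (g := fun theta =>
     \sum_(i <- index_enum 'I_d) c i * (theta ord0 i - a j ord0 i))).
    move=> theta; rewrite /dotp mulrAC mulr_sumr; apply: eq_bigr => i _.
    by rewrite /c !mxE; ring.
  have -> : d%:R = (size (index_enum 'I_d))%:R :> R.
    by congr (_ *+ _); rewrite -[LHS]card_ord cardT enumT.
  apply: bounded_poly_sum => i.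
  apply: bounded_poly_le (bounded_polyZ (c i) (bounded_poly_coordB i (a_ball j))) => //.
  have -> : 2 * (1 + rad) * Delta^-1 = 2 * Delta^-1 * (1 + rad) by ring.
  rewrite ler_wpM2r ?addr_ge0 ?(ltW rad0)//.
  rewrite /c !normrM normfV (gtr0_norm N0) (@ger0_norm R 2)// -mulrA ler_wpM2l//.
  have DN : Delta ^+ 2 <= sqnorm (a j - a l) by apply: a_sep; rewrite eq_sym.
  have e0 : 0 < enorm (a j - a l) by rewrite sqrtr_gt0.
  have De : Delta <= enorm (a j - a l).
    by rewrite -(@ler_pXn2r _ 2)// ?nnegrE ?(ltW Delta0) ?(ltW e0)// enorm_sqr.
  rewrite ler_pdivrMr// -enorm_sqr expr2 mulrA.
  rewrite (le_trans (coord_le_enorm _ _))// ler_peMl ?(ltW e0)//.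
  by rewrite mulrC ler_pdivlMr// mul1r.
have one : bounded_poly 2 1 (fun _ : E => 1 : R).
  apply: (@bounded_poly_ext _ _ _ _ (fun theta => 1 * mono [::] theta)).
    by move=> theta; rewrite mono_nil mulr1.
  apply: (bounded_poly_le (n := 1) (B := `|1 : R|)) => //; first by rewrite normr1.
  exact: (bounded_poly_mono (1 : R) ([::] : seq 'I_d)).
have := bounded_polyM Q (bounded_polyD one (bounded_polyZ (-1) Z)).
rewrite normrN1 mul1r => H.
apply: (@bounded_poly_ext _ _ _ _ _ _ _ (bounded_poly_le _ _ H)).
- by move=> theta; rewrite /interp mulN1r.
- by rewrite addSn -addnS.
rewrite /interp_weight (_ : 2 * m + 3 = 2 * m.+1 + 1)%N; last by rewrite mulnS addnAC [LHS]addnC.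
rewrite exprD expr1 exprM /B exprMn.
have -> : (d%:R * (1 + rad) ^+ 2) ^+ m.+1 * (2 * rad + m.+1%:R * (d%:R * (2 * (1 + rad)))) *
   (Delta^-1 ^+ 2 ^+ m.+1 * Delta^-1) =
  (d%:R * (1 + rad) ^+ 2) ^+ m.+1 * Delta^-1 ^+ 2 ^+ m.+1 *
    (2 * rad * Delta^-1 + m.+1%:R * (d%:R * (2 * (1 + rad) * Delta^-1))) by ring.
rewrite ler_wpM2l ?lerD2r//; last by rewrite ler_pdivlMr// mul1r.
apply: mulr_ge0; apply: exprn_ge0; last exact: sqr_ge0.
by apply: mulr_ge0 => //; exact: sqr_ge0.
Qed.

End interpolation_polynomial.

(** * Discrete couplings and their transport cost *)

Section discrete_measure.
Context d (T : measurableType d) (R : realType) (I : finType).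
Variables (w : I -> R) (p : I -> T).
Hypothesis w0 : forall i, 0 <= w i.
Hypothesis w1 : \sum_i w i = 1.

(** [msum] runs over natural numbers, so the points are enumerated and the zero measure fills the
    indices that have no point. *)
Let m_ (k : nat) : {measure set T -> \bar R} :=
  if insub k is Some i then
    mscale (NngNum (w0 (@enum_val I predT i))) (dirac (p (@enum_val I predT i)))
  else mzero.

Definition discrete_measure : set T -> \bar R := msum m_ #|I|.

HB.instance Definition _ := Measure.on discrete_measure.

Lemma discrete_measureE A : discrete_measure A = (\sum_i (w i)%:E * \d_(p i) A)%E.
Proof.
rewrite /discrete_measure /msum [RHS](reindex_onto enum_val enum_rank)/=; last first.
  by move=> i _; rewrite enum_rankK.
rewrite [RHS](eq_bigl predT) => [|k]; last by rewrite enum_valK eqxx.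
by apply: eq_bigr => k _; rewrite /m_ valK.
Qed.

Lemma discrete_measureT : discrete_measure setT = 1%E.
Proof.
rewrite discrete_measureE (eq_bigr (fun i => (w i)%:E)).
  by rewrite sumEFin w1.
by move=> i _; rewrite diracT mule1.
Qed.

HB.instance Definition _ :=
  @Measure_isProbability.Build _ _ _ discrete_measure discrete_measureT.

Definition discrete_probability : probability T R := discrete_measure.

Lemma discrete_probabilityE A : discrete_probability A = (\sum_i (w i)%:E * \d_(p i) A)%E.
Proof. exact: discrete_measureE. Qed.

Lemma integral_discrete_probability (f : T -> \bar R) : measurable_fun setT f ->
  (forall x, 0 <= f x)%E ->
  (\int[discrete_probability]_x f x = \sum_i (w i)%:E * f (p i))%E.
Proof.
move=> mf f0; rewrite ge0_integral_measure_sum//.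
rewrite [RHS](reindex_onto enum_val enum_rank)/=; last first.
  by move=> i _; rewrite enum_rankK.
rewrite [RHS](eq_bigl predT) => [|k]; last by rewrite enum_valK eqxx.
apply: eq_bigr => k _; rewrite /m_ valK ge0_integral_mscale//.
by rewrite integral_dirac// diracT mul1e.
Qed.

End discrete_measure.

Section transport.
Variables (R : realType) (A B : finType).
Variables (x : A -> R) (y : B -> R) (f : A -> B).
Hypothesis x0 : forall a, 0 <= x a.
Hypothesis y0 : forall b, 0 <= y b.
Hypothesis x1 : \sum_a x a = 1.
Hypothesis y1 : \sum_b y b = 1.

Let g b := \sum_(a | f a == b) x a.
Let mn b := Num.min (g b) (y b).
(** Fraction of the mass of the cell of [b] that stays in it. For a cell without mass the convention
    [x / 0 = 0] is consistent, since [mn b] is then 0. *)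
Let frac b := mn b / g b.
Let r a := x a * (1 - frac (f a)).
Let s b := y b - mn b.
Let tot := \sum_b s b.

(* Mass stays in its cell as far as possible; the excess is spread proportionally. *)
Definition transport_plan (ab : A * B) : R :=
  x ab.1 * (f ab.1 == ab.2)%:R * frac ab.2 + r ab.1 * s ab.2 / tot.

Let g0 b : 0 <= g b. Proof. exact: sumr_ge0. Qed.
Let mn0 b : 0 <= mn b. Proof. by rewrite /mn le_min g0 y0. Qed.
Let frac0 b : 0 <= frac b. Proof. by rewrite /frac divr_ge0. Qed.
Let frac1 b : frac b <= 1.
Proof.
rewrite /frac; have [->|gb] := eqVneq (g b) 0; first by rewrite invr0 mulr0.
by rewrite ler_pdivrMr ?mul1r ?ge_min ?lexx// lt_neqAle eq_sym gb g0.
Qed.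
Let r0 a : 0 <= r a. Proof. by rewrite mulr_ge0// subr_ge0. Qed.
Let s0 b : 0 <= s b. Proof. by rewrite subr_ge0 /mn ge_min lexx orbT. Qed.
Let tot0 : 0 <= tot. Proof. exact: sumr_ge0. Qed.

Let cell_sum (h : B -> R) : \sum_a x a * h (f a) = \sum_b g b * h b.
Proof.
rewrite (partition_big f predT)//=; apply: eq_bigr => b _.
by rewrite mulr_suml; apply: eq_bigr => a /eqP ->.
Qed.

Let gfrac b : g b * frac b = mn b.
Proof.
rewrite /frac; have [gb|gb] := eqVneq (g b) 0; last by rewrite mulrC divfK.
by rewrite gb mul0r /mn gb; apply/esym/min_idPl.
Qed.

Let sum_r : \sum_a r a = tot.
Proof.
rewrite /r; under eq_bigr do rewrite mulrBr mulr1.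
rewrite sumrB x1 cell_sum /tot /s sumrB y1; congr (_ - _).
by apply: eq_bigr => b _; exact: gfrac.
Qed.

Lemma transport_plan_ge0 ab : 0 <= transport_plan ab.
Proof.
apply: addr_ge0; first by apply: mulr_ge0 => //; exact: mulr_ge0.
by apply: divr_ge0 => //; exact: mulr_ge0.
Qed.

Lemma transport_plan_fst a : \sum_b transport_plan (a, b) = x a.
Proof.
rewrite /transport_plan /= big_split/= (bigD1 (f a))//= eqxx mulr1 big1 => [|b ba]; last first.
  by rewrite eq_sym (negbTE ba) mulr0 mul0r.
rewrite addr0 -mulr_suml -mulr_sumr -/tot.
(* If [tot] is 0, nothing is left over, and the second summand of the plan is 0 by the convention on
   division. *)
have [t0|t0] := eqVneq tot 0; last by rewrite mulfK// /r; ring.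
have : r a = 0 by apply: psumr_eq0P (etrans sum_r t0) _ _.
by rewrite /r t0 mulr0 mul0r => /eqP; rewrite mulrBr mulr1 subr_eq0 addr0 => /eqP <-.
Qed.

Lemma transport_plan_snd b : \sum_a transport_plan (a, b) = y b.
Proof.
rewrite /transport_plan /= big_split/=.
have -> : \sum_a x a * (f a == b)%:R * frac b = mn b.
  rewrite -mulr_suml -gfrac; congr (_ * _).
  rewrite /g [RHS]big_mkcond; apply: eq_bigr => a _.
  by case: eqP; rewrite ?mulr1 ?mulr0.
rewrite -mulr_suml -mulr_suml sum_r.
have [t0|t0] := eqVneq tot 0; last by rewrite mulrAC mulfV// mul1r /s; ring.
have : s b = 0 by apply: psumr_eq0P t0 _ _.
by rewrite t0 mul0r mul0r addr0 => /eqP; rewrite subr_eq0 => /eqP <-.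
Qed.

(** Mass kept in its cell pays [c a (f a)]. The leftover pays at most [K] per unit, and its total,
    the sum of the positive parts of [y b - g b], is at most the sum of the absolute differences. *)
Lemma transport_plan_cost (c : A -> B -> R) (K : R) :
  (forall a b, 0 <= c a b <= K) ->
  \sum_ab transport_plan ab * c ab.1 ab.2 <=
  \sum_a x a * c a (f a) + K * \sum_b `|g b - y b|.
Proof.
move=> cK; rewrite -(pair_bigA _ (fun a b => transport_plan (a, b) * c a b))/=.
apply: (@le_trans _ _ (\sum_a (x a * c a (f a) + K * r a))); last first.
  rewrite big_split/= lerD2l -mulr_sumr sum_r.
  (* [A] is inhabited because the [x a] sum to 1, which yields [0 <= K]. *)
  have [a _|noA] := pickP A; last first.
    move: x1; rewrite big1 => [/esym/eqP|a _]; last by have := noA a.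
    by rewrite oner_eq0.
  have /andP[c0 c1] := cK a (f a); rewrite ler_wpM2l ?(le_trans c0 c1)//.
  apply: ler_sum => b _; rewrite /s /mn.
  have [gy|yg] := leP (g b) (y b); last by rewrite subrr normr_ge0.
  by rewrite distrC ler_norm.
apply: ler_sum => a _; rewrite /transport_plan /=.
apply: (@le_trans _ _ (\sum_b ((x a * (f a == b)%:R * frac b) * c a b + r a * s b / tot * K))).
  apply: ler_sum => b _; have /andP[c0 c1] := cK a b.
  rewrite mulrDl lerD2l; apply: ler_wpM2l => //.
  by apply: divr_ge0 => //; exact: mulr_ge0.
have /andP[c0 c1] := cK a (f a).
rewrite big_split/= lerD//.
  rewrite (bigD1 (f a))//= eqxx mulr1 big1 => [|b ba]; last first.
    by rewrite eq_sym (negbTE ba) mulr0 !mul0r.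
  by rewrite addr0 ler_wpM2r// ler_piMr.
rewrite -mulr_suml -mulr_suml -mulr_sumr -/tot mulrC ler_wpM2l ?(le_trans c0 c1)//.
have [->|t0] := eqVneq tot 0; first by rewrite mulr0 mul0r.
by rewrite mulfK.
Qed.

End transport.

Section wasserstein.
Variables (R : realType) (d : nat).
Local Notation E := 'rV[R]_d.

Lemma measurable_sqdist : measurable_fun [set: E * E] (fun z => (sqnorm (z.1 - z.2))%:E).
Proof.
apply/measurable_EFinP; apply: measurable_sum => i.
rewrite (_ : (fun _ => _) = fun z : E * E => (z.1 ord0 i - z.2 ord0 i) ^+ 2); last first.
  by apply/funext => z; rewrite !mxE.
apply: measurable_funX; apply: measurable_funB.
  by apply: (measurableT_comp (measurable_coord i)); exact: measurable_fst.
by apply: (measurableT_comp (measurable_coord i)); exact: measurable_snd.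
Qed.

Lemma wasserstein2_sqrE (G H : mixing R d) : (wasserstein2 G H ^+ 2)%E =
  ereal_inf [set (\int[gamma]_z (enorm (z.1 - z.2) ^+ 2)%:E)%E | gamma in couplings G H].
Proof.
rewrite /wasserstein2; set e := ereal_inf _.
have e0 : (0 <= e)%E.
  by apply: le_ereal_inf_tmp => _ [gamma _ <-]; apply: integral_ge0 => z _; rewrite lee_fin sqr_ge0.
by rewrite poweR12_sqrt// sqr_sqrte.
Qed.

Lemma wasserstein2_transport (G H : mixing R d)
    (f : 'I_(Defs.order G) -> 'I_(Defs.order H)) (K : R) :
  (forall i, 0 <= @weight _ _ G i) -> (forall j, 0 <= @weight _ _ H j) ->
  \sum_i @weight _ _ G i = 1 -> \sum_j @weight _ _ H j = 1 ->
  (forall i j, sqnorm (@atom _ _ G i - @atom _ _ H j) <= K) ->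
  (wasserstein2 G H ^+ 2 <=
   (\sum_i weight i * sqnorm (@atom _ _ G i - atom (f i)) +
    K * \sum_j `|\sum_(i | f i == j) @weight _ _ G i - weight j|)%:E)%E.
Proof.
move=> G0 H0 G1 H1 KGH; rewrite wasserstein2_sqrE.
pose pl := transport_plan (@weight _ _ G) (@weight _ _ H) f.
have pl0 ab : 0 <= pl ab by exact: transport_plan_ge0.
have pl_fst a : \sum_b pl (a, b) = weight a by exact: transport_plan_fst.
have pl_snd b : \sum_a pl (a, b) = weight b by exact: transport_plan_snd.
have pl1 : \sum_ab pl ab = 1.
  rewrite -(pair_bigA _ (fun a b => pl (a, b)))/= -G1.
  by apply: eq_bigr => a _; rewrite pl_fst.
pose pt (ab : 'I_(Defs.order G) * 'I_(Defs.order H)) : E * E := (atom ab.1, atom ab.2).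
pose gamma : probability (E * E)%type R := discrete_probability pt pl0 pl1.
apply: ge_ereal_inf; exists (\int[gamma]_z (enorm (z.1 - z.2) ^+ 2)%:E)%E.
  exists gamma => // A mA.
  rewrite /gamma !discrete_probabilityE /mixing_measure; split.
    under eq_bigr do rewrite diracE -EFinM.
    under [RHS]eq_bigr do rewrite diracE -EFinM.
    rewrite !sumEFin -(pair_bigA _ (fun a b => pl (a, b) * (pt (a, b) \in A `*` setT)%:R))/=.
    congr EFin; apply: eq_bigr => a _; rewrite -pl_fst mulr_suml.
    apply: eq_bigr => b _; congr (_ * (nat_of_bool _)%:R).
    by apply/idP/idP; rewrite !inE /= => // -[].
  under eq_bigr do rewrite diracE -EFinM.
  under [RHS]eq_bigr do rewrite diracE -EFinM.
  rewrite !sumEFin -(pair_bigA _ (fun a b => pl (a, b) * (pt (a, b) \in setT `*` A)%:R))/=.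
  rewrite exchange_big/=; congr EFin; apply: eq_bigr => b _; rewrite -pl_snd mulr_suml.
  apply: eq_bigr => a _; congr (_ * (nat_of_bool _)%:R).
  by apply/idP/idP; rewrite !inE /= => // -[].
under eq_integral do rewrite enorm_sqr.
rewrite integral_discrete_probability; last 2 first.
- exact: measurable_sqdist.
- by move=> z; rewrite lee_fin sqnorm_ge0.
under eq_bigr do rewrite -EFinM.
rewrite sumEFin lee_fin.
apply: (@transport_plan_cost _ _ _ _ _ f G0 H0 G1 H1
  (fun a b => sqnorm (@atom _ _ G a - @atom _ _ H b)) K) => a b.
by rewrite sqnorm_ge0 KGH.
Qed.

End wasserstein.

(** * Wasserstein bound for a separated mixture *)

Section separated_mixings.
Variables (R : realType) (d : nat) (S : 'M[R]_d).
Hypothesis pdS : posdef S.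
Local Notation E := 'rV[R]_d.

Lemma separation_le (G : mixing R d) (i j : 'I_(Defs.order G)) :
  i != j -> separation G <= enorm (atom i - atom j).
Proof.
move=> ij; apply: ge_inf; last by exists i, j.
by exists 0 => _ [i' [j' [_ ->]]]; exact: sqrtr_ge0.
Qed.

(* A parameter close to the minimiser of the distances stays away from the
   other atoms, so the product of the squared distances controls the smallest one. *)
Lemma sqdist_prod_ge m (a : 'I_m.+1 -> E) (Delta : R) (theta : E) (j : 'I_m.+1) :
  0 < Delta ->
  (forall i l, i != l -> Delta ^+ 2 <= sqnorm (a i - a l)) ->
  (forall l, sqnorm (theta - a j) <= sqnorm (theta - a l)) ->
  sqnorm (theta - a j) * (Delta ^+ 2 / 4) ^+ m <= \prod_l sqnorm (theta - a l).
Proof.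
move=> D0 sep near; rewrite (bigD1 j)//= ler_wpM2l ?sqnorm_ge0//.
have -> : (Delta ^+ 2 / 4) ^+ m = \prod_(l | l != j) (Delta ^+ 2 / 4).
  by rewrite prodr_const cardC1 card_ord.
apply: ler_prod => l lj; apply/andP; split; first by rewrite divr_ge0 ?sqr_ge0.
have := sep _ _ lj; have := near l.
have -> : a l - a j = (theta - a j) + - (theta - a l) by rewrite opprB [RHS]addrC addrA subrK.
by have := sqnormD_le (theta - a j) (- (theta - a l)); rewrite sqnormN; lra.
Qed.

(** Origin of the exponent, with [m + 2] atoms in [H]: the mean squared distance [D2] is of order
    [Delta^-(2m+2) h], and each cell mass errs by order [Delta^-(2m+3) (h + D2)], so the worst power
    of [1 / Delta] is the sum [4m + 5]. Smaller powers are raised to this one by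
    [Delta <= 2 * rad]. *)
Lemma wasserstein2_hell2 (rad : R) m : 0 < rad -> exists2 C : R, 0 < C &
  forall G H : mixing R d, Defs.order H = m.+2 -> in_ball rad G -> in_ball rad H ->
  0 < separation H ->
  (wasserstein2 G H ^+ 2 <=
    (C * (separation H)^-1 ^+ (4 * m + 5) * Num.sqrt (hell2 S G H))%:E)%E.
Proof.
move=> rad0.
(* Large enough for the product over all [m + 2] atoms and for [interp], counting four units of
   degree per squared distance. *)
pose D := (m.+2 * 4 + 3)%N.
have [C0 C00 mC] := moment_comparison pdS rad D.
pose BQ := (d%:R * (1 + rad) ^+ 2) ^+ m.+2.
have BQ0 : 0 <= BQ by apply: exprn_ge0; apply: mulr_ge0 => //; exact: sqr_ge0.
pose X := 4 ^+ m.+1 * (BQ * C0).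
have X0 : 0 <= X.
  by apply: mulr_ge0; [exact: exprn_ge0|apply: mulr_ge0 => //; exact: ltW].
pose W := interp_weight d m rad.
have W0 : 0 <= W.
  have r1 : 0 <= 1 + rad by rewrite addr_ge0// ltW.
  rewrite /W /interp_weight; apply: mulr_ge0.
    by apply: exprn_ge0; apply: mulr_ge0 => //; exact: sqr_ge0.
  by apply: addr_ge0; rewrite ?mulr_ge0 ?(ltW rad0).
pose K := interp_cst m rad.
have K0 : 0 <= K.
  apply: mulr_ge0; last by rewrite exprn_ge0// mulr_ge0// ltW.
  by apply: addr_ge0; apply: mulr_ge0 => //; apply: mulr_ge0.
pose C := X * (2 * rad) ^+ (2 * m + 3) +
  4 * rad ^+ 2 * (m.+2%:R * (W * C0 * (2 * rad) ^+ (2 * m + 2) + K * X)).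
have C_ge0 : 0 <= C.
  have r20 n : 0 <= (2 * rad) ^+ n by rewrite exprn_ge0// mulr_ge0// ltW.
  apply: addr_ge0; first exact: mulr_ge0.
  apply: mulr_ge0; first by rewrite mulr_ge0// sqr_ge0.
  apply: mulr_ge0 => //; apply: addr_ge0; last exact: mulr_ge0.
  by apply: mulr_ge0 => //; apply: mulr_ge0 => //; exact: ltW.
(* The added 1 makes the constant positive. *)
exists (C + 1); first by rewrite ltr_wpDl.
move=> G [n p a] nE; rewrite /= in nE; subst n => GB HB sep0.
set H := Mixing p a in HB sep0 *.
set Delta := separation H in sep0 *; set h := Num.sqrt (hell2 S G H).
have h0 : 0 <= h by exact: sqrtr_ge0.
have [Ga G0 G1] := GB; have [Ha H0 H1] := HB; rewrite /= in Ha H0 H1.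
have sepa i j : i != j -> Delta ^+ 2 <= sqnorm (a i - a j).
  move=> ij; rewrite -enorm_sqr lerXn2r ?nnegrE ?sqrtr_ge0 ?(ltW sep0)//.
  exact: (@separation_le H).
have D2rad : Delta <= 2 * rad.
  have := @separation_le H ord0 (lift ord0 ord0) isT => /le_trans; apply.
  rewrite -(@ler_pXn2r _ 2)// ?nnegrE ?sqrtr_ge0 ?mulr_ge0 ?(ltW rad0)//.
  by rewrite enorm_sqr (le_trans (sqnormB_ball (Ha _) (Ha _)))// exprMn -natrX.
have [f fP] : exists f : 'I_(Defs.order G) -> 'I_m.+2,
    forall i l, sqnorm (atom i - a (f i)) <= sqnorm (atom i - a l).
  exists (fun i => [arg min_(j < ord0) sqnorm (@atom _ _ G i - a j)]%O) => i l.
  by case: arg_minP => // j _; apply.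
pose D2 := \sum_i weight i * sqnorm (@atom _ _ G i - a (f i)).
have z0 : 0 < Delta^-1 by rewrite invr_gt0.
have D2_ge0 : 0 <= D2 by apply: sumr_ge0 => i _; rewrite mulr_ge0// sqnorm_ge0.
have D2le : D2 <= X * Delta^-1 ^+ (2 * m + 2) * h.
  pose Q theta := \prod_(l <- enum 'I_m.+2) sqnorm (theta - a l).
  have QE theta : Q theta = \prod_l sqnorm (theta - a l) by rewrite /Q big_enum.
  have QB : bounded_poly (m.+2 * 4).+1 BQ Q.
    rewrite /BQ -[in (m.+2 * 4)%N](size_enum_ord m.+2) -[in _ ^+ m.+2](size_enum_ord m.+2).
    by apply: bounded_poly_prod => l _; exact: bounded_poly_sqdist.
  have QB' := bounded_poly_le (_ : (_ <= D)%N) (lexx _) QB.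
  have {QB'} := meanB_bounded_poly (mulr_ge0 (ltW C00) h0) (mC G H GB HB)
    (QB' ltac:(by rewrite /D -addn1 leq_add2l)).
  (* [Q] vanishes at every atom of [H], so the comparison of moments bounds its mean under [G]. *)
  have -> : mean H Q = 0.
    rewrite /mean big1// => j _; rewrite QE (bigD1 j)//= subrr.
    by rewrite sqnorm0 mul0r mulr0.
  rewrite subr0 => /(le_trans (ler_norm _)) GQ.
  have : D2 * (Delta ^+ 2 / 4) ^+ m.+1 <= BQ * (C0 * h).
    apply: le_trans GQ; rewrite mulr_suml; apply: ler_sum => i _.
    rewrite -mulrA ler_wpM2l// QE; exact: sqdist_prod_ge.
  rewrite -ler_pdivlMr ?exprn_gt0// ?divr_gt0 ?exprn_gt0// => /le_trans; apply.
  rewrite le_eqVlt; apply/orP; left; apply/eqP.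
  rewrite /X expr_div_n -exprM invf_div exprVn (_ : (2 * m + 2 = 2 * m.+1)%N); last by rewrite mulnS addnC.
  by ring.
have cell j : `|\sum_(i | f i == j) @weight _ _ G i - p j| <=
    (W * Delta^-1 ^+ (2 * m + 3)) * (C0 * h) + K * Delta^-1 ^+ (2 * m + 3) * D2.
  pose P := interp a j.
  have PB : bounded_poly D (W * Delta^-1 ^+ (2 * m + 3)) P.
    apply: bounded_poly_le (interp_poly sep0 D2rad Ha sepa j) => //.
    by rewrite leq_add2r leq_mul2r /= leqnSn.
  have PGH := meanB_bounded_poly (mulr_ge0 (ltW C00) h0) (mC G H GB HB) PB.
  have mHP : mean H P = p j.
    rewrite /mean (bigD1 j)//= /P (interp_node sep0 sepa) mulr1 big1 ?addr0// => l lj.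
    by rewrite (interp_other _ lj) mulr0.
  have near : `|mean G P - \sum_(i | f i == j) @weight _ _ G i| <= K * Delta^-1 ^+ (2 * m + 3) * D2.
    rewrite [X in _ - X]big_mkcond -sumrB /D2 mulr_sumr.
    apply: le_trans (ler_norm_sum _ _ _) _; apply: ler_sum => i _.
    have -> : weight i * P (atom i) - (if f i == j then weight i else 0) =
        @weight _ _ G i * (P (atom i) - (f i == j)%:R).
      by case: eqP => _ /=; rewrite ?subr0// mulrBr mulr1.
    rewrite normrM (ger0_norm (G0 i)) mulrCA ler_wpM2l//.
    apply: le_trans (interp_bound sep0 D2rad Ha sepa j (f i) (Ga i)) _.
    by rewrite le_eqVlt; apply/orP; left; apply/eqP; rewrite /K; ring.
  rewrite -mHP.
  have -> : \sum_(i | f i == j) @weight _ _ G i - mean H P =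
     (mean G P - mean H P) - (mean G P - \sum_(i | f i == j) @weight _ _ G i) by ring.
  by apply: le_trans (ler_normB _ _) _; rewrite lerD.
have KGH i j : sqnorm (@atom _ _ G i - @atom _ _ H j) <= 4 * rad ^+ 2.
  exact: sqnormB_ball.
have WT := @wasserstein2_transport _ _ G H f _ G0 H0 G1 H1 KGH.
apply: (le_trans WT); rewrite lee_fin -/D2.
have cells : \sum_j `|\sum_(i | f i == j) @weight _ _ G i - p j| <=
    m.+2%:R * ((W * Delta^-1 ^+ (2 * m + 3)) * (C0 * h) + K * Delta^-1 ^+ (2 * m + 3) * D2).
  apply: le_trans (ler_sum _ (fun j _ => cell j)) _.
  by rewrite sumr_const card_ord mulr_natl.
have r2 : 0 <= 4 * rad ^+ 2 by rewrite mulr_ge0// sqr_ge0.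
apply: (@le_trans _ _ (X * Delta^-1 ^+ (2 * m + 2) * h + 4 * rad ^+ 2 *
  (m.+2%:R * ((W * Delta^-1 ^+ (2 * m + 3)) * (C0 * h) +
     K * Delta^-1 ^+ (2 * m + 3) * (X * Delta^-1 ^+ (2 * m + 2) * h))))).
  apply: lerD => //; apply: ler_wpM2l => //; apply: le_trans cells _.
  apply: ler_wpM2l => //; rewrite lerD2l; apply: ler_wpM2l => //.
  by apply: mulr_ge0 => //; rewrite exprn_ge0// ltW.
have pw q r : (q + r = 4 * m + 5)%N -> Delta^-1 ^+ q <= (2 * rad) ^+ r * Delta^-1 ^+ (4 * m + 5).
  move=> <-; rewrite exprD mulrCA -exprMn; apply: ler_peMr; first by rewrite exprn_ge0// ltW.
  by apply: exprn_ege1; rewrite ler_pdivlMr// mul1r.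
have pw1 := pw (2 * m + 2)%N (2 * m + 3)%N ltac:(by rewrite addnACA -mulnDl).
have pw2 := pw (2 * m + 3)%N (2 * m + 2)%N ltac:(by rewrite addnACA -mulnDl).
have zz : Delta^-1 ^+ (2 * m + 3) * Delta^-1 ^+ (2 * m + 2) = Delta^-1 ^+ (4 * m + 5).
  by rewrite -exprD; congr (_ ^+ _); rewrite addnACA -mulnDl.
have z5 : 0 <= Delta^-1 ^+ (4 * m + 5) by rewrite exprn_ge0// ltW.
have -> : K * Delta^-1 ^+ (2 * m + 3) * (X * Delta^-1 ^+ (2 * m + 2) * h) =
  K * X * Delta^-1 ^+ (4 * m + 5) * h by rewrite -zz; ring.
apply: (@le_trans _ _ (X * ((2 * rad) ^+ (2 * m + 3) * Delta^-1 ^+ (4 * m + 5)) * h +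
  4 * rad ^+ 2 * (m.+2%:R * (W * ((2 * rad) ^+ (2 * m + 2) * Delta^-1 ^+ (4 * m + 5)) * (C0 * h) +
    K * X * Delta^-1 ^+ (4 * m + 5) * h)))).
  apply: lerD; first by apply: ler_wpM2r => //; exact: ler_wpM2l.
  apply: ler_wpM2l => //; apply: ler_wpM2l => //; rewrite lerD2r.
  by apply: ler_wpM2r; [rewrite mulr_ge0// ltW|exact: ler_wpM2l].
apply: (@le_trans _ _ (C * Delta^-1 ^+ (4 * m + 5) * h)).
  by rewrite le_eqVlt; apply/orP; left; apply/eqP; rewrite /C; ring.
by apply: ler_wpM2r => //; apply: ler_wpM2r => //; rewrite lerDl.
Qed.

End separated_mixings.

Section global_bound.
Variables (R : realType) (d : nat) (S : 'M[R]_d).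
Hypothesis pdS : posdef S.

Lemma in_ball_true_mixing (Theta : set 'rV[R]_d) (rad : R) kstar (G : mixing R d) :
  Theta `<=` [set theta | enorm theta <= rad] -> true_mixings Theta kstar G -> in_ball rad G.
Proof.
move=> Tr [_ aT w0 w1 _]; split=> // i; first exact/Tr/aT.
exact/ltW.
Qed.

Lemma in_ball_mixing (Theta : set 'rV[R]_d) (rad : R) k (G : mixing R d) :
  Theta `<=` [set theta | enorm theta <= rad] -> mixings Theta k G -> in_ball rad G.
Proof.
move=> Tr [_ aT w0 w1]; split=> // i; first exact/Tr/aT.
by case/andP: (w0 i).
Qed.

Lemma wasserstein2_hellinger (rad : R) kstar : 0 < rad -> (2 <= kstar)%N ->
  exists2 C : R, 0 < C &
  forall G H : mixing R d, Defs.order H = kstar -> in_ball rad G -> in_ball rad H ->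
  0 < separation H ->
  ((C * separation H ^+ (4 * kstar - 3))%:E * wasserstein2 G H ^+ 2 <=
   hellinger (mixture_pdf S G) (mixture_pdf S H))%E.
Proof.
move=> rad0; case: kstar => [|[|m]]// _.
have [C C0 CW] := wasserstein2_hell2 pdS m rad0.
have s2 : 0 < Num.sqrt 2 :> R by rewrite sqrtr_gt0.
(* The square root of 2 comes from the factor one half in the Hellinger distance. *)
exists (C * Num.sqrt 2)^-1; first by rewrite invr_gt0 mulr_gt0.
move=> G H nH GB HB sep0; have := CW G H nH GB HB sep0.
rewrite (_ : 4 * m.+2 - 3 = 4 * m + 5)%N; last by rewrite !mulnS addnA -[(4 + 4)%N]/(5 + 3)%N addnAC addnK addnC.
set D := separation H in sep0 *; rewrite (hellingerE pdS) => W.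
have c0 : 0 <= (C * Num.sqrt 2)^-1 * D ^+ (4 * m + 5).
  by apply: mulr_ge0; [rewrite invr_ge0 ltW// mulr_gt0|rewrite exprn_ge0// ltW].
apply: (le_trans (lee_wpmul2l _ W)); first by rewrite lee_fin.
rewrite -EFinM lee_fin.
have -> : Num.sqrt (hell2 S G H) = Num.sqrt 2 * Num.sqrt (hell2 S G H / 2).
  by rewrite -sqrtrM// mulrC divfK.
have Dn : D ^+ (4 * m + 5) != 0 by rewrite expf_neq0// gt_eqF.
rewrite exprVn le_eqVlt; apply/orP; left; apply/eqP; field.
by rewrite Dn !gt_eqF.
Qed.

End global_bound.

(** * Deviation bound for normalised likelihood ratios *)

Section real_inequalities.
Variable R : realType.

(** [(1 - x) expR x <= 1], and [1 <= (1 - x) (1 + x + 2 x^2)] for [x <= 1/2]. As [x] may be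
    arbitrarily negative, an upper bound on the exponents suffices in the Laplace transforms
    below. *)
Lemma expR_le_quadratic (x : R) : x <= 1 / 2 -> expR x <= 1 + x + 2 * x ^+ 2.
Proof.
move=> x2; have x1 : 0 < 1 - x by lra.
have := expR_ge1Dx (- x); rewrite expRN => h.
have e0 := expR_gt0 x.
have h2 : (1 - x) * expR x <= 1.
  by rewrite -(@ler_pdivlMr _ _ _ 1 e0) mul1r.
have h3 : 1 <= (1 - x) * (1 + x + 2 * x ^+ 2).
  have : 0 <= x ^+ 2 * (1 - 2 * x) by rewrite mulr_ge0 ?sqr_ge0//; lra.
  have -> : (1 - x) * (1 + x + 2 * x ^+ 2) = 1 + x ^+ 2 * (1 - 2 * x) by ring.
  lra.
by rewrite -(ler_pM2l x1) (le_trans h2).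
Qed.

(* [ln y <= 2 (sqrt y - 1)] and [2 (sqrt (1 + x) - 1) = x - (sqrt (1 + x) - 1)^2]. *)
Lemma ln1D_le_quadratic (x : R) : -1 < x -> x <= 1 / 2 -> ln (1 + x) <= x - x ^+ 2 / 5.
Proof.
move=> x1 x2; set y := Num.sqrt (1 + x).
have x0 : 0 < 1 + x by lra.
have y0 : 0 < y by rewrite sqrtr_gt0.
have yy : y ^+ 2 = 1 + x by rewrite sqr_sqrtr// ltW.
have -> : ln (1 + x) = 2 * ln y by rewrite -yy lnXn// mulr_natl.
have ly : ln y <= y - 1.
  by rewrite -{1}[y](subrK 1) addrC; apply: le_ln1Dx; rewrite ltrBrDl subrr.
(* From [y^2 <= 3/2] follows [y <= 1.23], hence [(y + 1)^2 < 5]: this is the origin of the factor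
   1/5. *)
have y5 : y <= 123 / 100 by nra.
have -> : x = y ^+ 2 - 1 by lra.
have : 0 <= (y - 1) ^+ 2 * (5 - (y + 1) ^+ 2).
  by rewrite mulr_ge0 ?sqr_ge0//; nra.
have -> : (y - 1) ^+ 2 * (5 - (y + 1) ^+ 2) =
  5 * (y ^+ 2 - 1 - (y ^+ 2 - 1) ^+ 2 / 5 - 2 * (y - 1)) by field.
lra.
Qed.

(** Concavity of [ln] between [1] and [1 + s], from the tangent at [1 + l * s]. It brings a
    likelihood comparison from the unknown scale [sigma] down to the fixed scale [eps]. *)
Lemma ln_concave_scale (s l : R) : 0 <= l <= 1 -> 0 < 1 + s ->
  l * ln (1 + s) <= ln (1 + l * s).
Proof.
move=> /andP[l0 l1] s0.
have ln_le (z : R) : 0 < z -> ln z <= z - 1.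
  by move=> z0; rewrite -{1}[z](subrK 1) addrC; apply: le_ln1Dx; rewrite ltrBrDl subrr.
have u0 : 0 < 1 + l * s.
  have -> : 1 + l * s = (1 - l) + l * (1 + s) by ring.
  have [->|l_neq0] := eqVneq l 0; first by rewrite subr0 mul0r addr0.
  by rewrite ltr_wpDl ?subr_ge0// mulr_gt0// lt_neqAle eq_sym l_neq0.
set u := 1 + l * s in u0 *.
have h1 : ln (1 + s) <= ln u + ((1 + s) / u - 1).
  have e : 1 + s = u * ((1 + s) / u) by rewrite mulrC divfK// gt_eqF.
  have q0 : 0 < (1 + s) / u by rewrite divr_gt0.
  by rewrite {1}e lnM ?posrE// lerD2l; exact: ln_le.
have h2 : 0 <= ln u + (u^-1 - 1).
  have := ln_le u^-1; rewrite invr_gt0 => /(_ u0).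
  by rewrite lnV ?posrE//; lra.
have e : l * ((1 + s) / u) + (1 - l) * u^-1 = 1.
  rewrite mulrA -mulrDl (_ : l * (1 + s) + (1 - l) = u); last by rewrite /u; ring.
  by rewrite mulfV// gt_eqF.
have := ler_wpM2l l0 h1.
have l10 : 0 <= 1 - l by rewrite subr_ge0.
by have := mulr_ge0 l10 h2; lra.
Qed.

End real_inequalities.

(** * Truncated Laplace transforms under an envelope *)

Section expectation.
Context d (T : measurableType d) (R : realType) (mu : probability T R).
Variables (Env : T -> R) (m8 : R).
Hypothesis mEnv : measurable_fun setT Env.
Hypothesis Env1 : forall x, 1 <= Env x.
Hypothesis Env8 : (\int[mu]_x (Env x ^+ 8)%:E <= m8%:E)%E.
Implicit Types g h : T -> R.

(** The eighth power is the one for which Markov's inequality at the level [n^(1/4)] gives a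
    probability of order [n^-2] per sample; it also dominates the lower powers of the envelope and
    the squares that occur below. *)
Definition dominated g := measurable_fun setT g /\
  exists C, forall x, `|g x| <= C * Env x ^+ 8.

Local Notation Ex g := (Rintegral mu setT g).

Lemma integrable_Env8 : mu.-integrable setT (EFin \o (fun x => Env x ^+ 8)).
Proof.
apply/integrableP; split; first by apply/measurable_EFinP; exact: measurable_funX.
apply: (@le_lt_trans _ _ m8%:E); last exact: ltry.
apply: le_trans Env8; apply: ge0_le_integral => //.
- by apply: measurableT_comp => //; apply/measurable_EFinP; exact: measurable_funX.
- by apply/measurable_EFinP; exact: measurable_funX.
- move=> x _ /=; rewrite ger0_norm//; apply: exprn_ge0; exact: le_trans (Env1 x).
Qed.

Lemma dominated_integrable g : dominated g -> mu.-integrable setT (EFin \o g).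
Proof.
move=> [mg [C gC]].
have iC : mu.-integrable setT (EFin \o (fun x => C * Env x ^+ 8)).
  exact: (integrableZl measurableT C integrable_Env8).
apply: le_integrable iC => //; first exact/measurable_EFinP.
by move=> x _ /=; rewrite lee_fin (le_trans (gC x))// ler_norm.
Qed.

Lemma dominated_le g h C : measurable_fun setT g -> dominated h ->
  (forall x, `|g x| <= C * `|h x|) -> 0 <= C -> dominated g.
Proof.
move=> mg [_ [D hD]] gh C0; split=> //; exists (C * D) => x.
by rewrite (le_trans (gh x))// -mulrA ler_wpM2l.
Qed.

Lemma dominated_Env k : (k <= 8)%N -> dominated (fun x => Env x ^+ k).
Proof.
move=> k8; split; first exact: measurable_funX.
exists 1 => x; rewrite mul1r ger0_norm; last by rewrite exprn_ge0// (le_trans ler01).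
exact: ler_weXn2l.
Qed.

Lemma dominated_cst c : dominated (fun=> c).
Proof.
apply: (dominated_le (C := `|c|)) (dominated_Env (leq0n 8)) _ _ => // x.
by rewrite expr0 normr1 mulr1.
Qed.

Lemma dominatedD g h : dominated g -> dominated h -> dominated (fun x => g x + h x).
Proof.
move=> [mg [C gC]] [mh [D hD]]; split; first exact: measurable_funD.
by exists (C + D) => x; rewrite (le_trans (ler_normD _ _))// mulrDl lerD.
Qed.

Lemma dominatedZ c g : dominated g -> dominated (fun x => c * g x).
Proof.
move=> dg; have [mg _] := dg; apply: (dominated_le (C := `|c|)) dg _ _ => // [|x].
  exact: measurable_funM.
by rewrite normrM.
Qed.

Lemma dominatedB g h : dominated g -> dominated h -> dominated (fun x => g x - h x).
Proof.
move=> dg dh; rewrite (_ : (fun x => _) = fun x => g x + -1 * h x).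
  by apply: dominatedD => //; exact: dominatedZ.
by apply/funext => x; rewrite mulN1r.
Qed.

Lemma ExD g h : dominated g -> dominated h -> Ex (fun x => g x + h x) = Ex g + Ex h.
Proof. by move=> dg dh; rewrite RintegralD//; exact: dominated_integrable. Qed.

Lemma ExB g h : dominated g -> dominated h -> Ex (fun x => g x - h x) = Ex g - Ex h.
Proof. by move=> dg dh; rewrite RintegralB//; exact: dominated_integrable. Qed.

Lemma ExZ c g : dominated g -> Ex (fun x => c * g x) = c * Ex g.
Proof. by move=> dg; rewrite RintegralZl//; exact: dominated_integrable. Qed.

Lemma Ex_le g h : dominated g -> dominated h -> (forall x, g x <= h x) -> Ex g <= Ex h.
Proof. by move=> dg dh gh; apply: le_Rintegral => //; exact: dominated_integrable. Qed.

Lemma Ex_cst c : Ex (fun=> c) = c.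
Proof. by rewrite Rintegral_cst//= probability_setT /= mulr1. Qed.

Lemma integral_Ex g : dominated g -> (\int[mu]_x (g x)%:E = (Ex g)%:E)%E.
Proof.
move=> dg; rewrite /Rintegral fineK//.
by apply: integrable_fin_num => //; exact: dominated_integrable.
Qed.

Lemma Ex_Env k : (k <= 8)%N -> Ex (fun x => Env x ^+ k) <= m8.
Proof.
move=> k8; rewrite -lee_fin -integral_Ex; last exact: dominated_Env.
apply: le_trans Env8; apply: ge0_le_integral => //.
- by move=> x _; rewrite lee_fin exprn_ge0// (le_trans ler01).
- by apply/measurable_EFinP; exact: measurable_funX.
- by apply/measurable_EFinP; exact: measurable_funX.
- by move=> x _; rewrite lee_fin ler_weXn2l.
Qed.

Lemma m8_ge0 : 0 <= m8.
Proof.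
apply: le_trans (Ex_Env (leq0n 8)); apply: Rintegral_ge0 => x _.
by rewrite expr0.
Qed.

Variable B : R.
Hypothesis B1 : 0 < B.

Definition trunc x : R := ((Env x <= B)%R)%:R.

Lemma measurable_trunc : measurable_fun setT trunc.
Proof.
rewrite (_ : trunc = \1_[set x | Env x <= B]).
  apply: measurable_indic; rewrite -[X in measurable X]setTI.
  by rewrite (_ : [set x | _] = Env @^-1` `]-oo, B]%classic); [exact: mEnv|apply/seteqP; split => x /=; rewrite in_itv].
apply/funext => x; rewrite /trunc indicE; congr (nat_of_bool _)%:R.
by apply/idP/idP; rewrite inE.
Qed.

Lemma trunc01 x : 0 <= trunc x <= 1.
Proof. by rewrite /trunc ler0n lern1 leq_b1. Qed.

Lemma dominated_trunc g : dominated g -> dominated (fun x => g x * trunc x).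
Proof.
move=> dg; have [mg _] := dg; apply: (dominated_le (C := 1)) dg _ _ => // [|x].
  by apply: measurable_funM => //; exact: measurable_trunc.
have /andP[t0 t1] := trunc01 x.
by rewrite mul1r normrM (ger0_norm t0) ler_piMr.
Qed.

Lemma tail_le k x : (k <= 4)%N -> Env x ^+ k * (1 - trunc x) <= Env x ^+ 8 / B ^+ 4.
Proof.
move=> k4; rewrite /trunc; have [_|BE] := leP (Env x) B.
  by rewrite subrr mulr0 divr_ge0 ?exprn_ge0 ?(ltW B1)// (le_trans ler01).
rewrite subr0 mulr1 ler_pdivlMr ?exprn_gt0//.
apply: (@le_trans _ _ (Env x ^+ 4 * Env x ^+ 4)); last by rewrite -exprD.
have E0 : 0 <= Env x := le_trans ler01 (Env1 x).
have B0 := ltW B1.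
by rewrite ler_pM ?exprn_ge0 ?ler_weXn2l ?lerXn2r// ltW.
Qed.

Lemma Ex_tail k : (k <= 4)%N -> Ex (fun x => Env x ^+ k * (1 - trunc x)) <= m8 / B ^+ 4.
Proof.
move=> k4; have dE : dominated (fun x => Env x ^+ k).
  by apply: dominated_Env; rewrite (leq_trans k4).
have dt : dominated (fun x => Env x ^+ k * (1 - trunc x)).
  rewrite (_ : (fun x => _) = fun x => Env x ^+ k - Env x ^+ k * trunc x).
    by apply: dominatedB => //; exact: dominated_trunc.
  by apply/funext => x; ring.
apply: (@le_trans _ _ (Ex (fun x => (B ^+ 4)^-1 * Env x ^+ 8))).
  apply: Ex_le => // [|x]; first exact/dominatedZ/dominated_Env.
  by rewrite [leRHS]mulrC; exact: tail_le.
rewrite ExZ; last exact: dominated_Env.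
by rewrite mulrC ler_wpM2r ?Ex_Env// invr_ge0 exprn_ge0// ltW.
Qed.

(** As the full mean is 0, the truncated mean is minus the mean of the tail, which the envelope
    bounds. *)
Lemma Ex_centered_trunc g c : measurable_fun setT g -> 0 <= c ->
  (forall x, `|g x| <= c * Env x) -> Ex g = 0 ->
  Ex (fun x => g x * trunc x) <= c * (m8 / B ^+ 4).
Proof.
move=> mg c0 gc g0.
have dg : dominated g.
  apply: (dominated_le (C := c)) (dominated_Env (isT : 1 <= 8)%N) _ _ => // x.
  by rewrite expr1 (ger0_norm (le_trans ler01 (Env1 x))).
have dt : dominated (fun x => Env x ^+ 1 * (1 - trunc x)).
  rewrite (_ : (fun x => _) = fun x => Env x ^+ 1 - Env x ^+ 1 * trunc x).
    by apply: dominatedB => //; [exact: dominated_Env|exact/dominated_trunc/dominated_Env].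
  by apply/funext => x; ring.
have -> : Ex (fun x => g x * trunc x) = - Ex (fun x => g x - g x * trunc x).
  by rewrite ExB ?g0//; [ring|exact: dominated_trunc].
rewrite -[leLHS]mulN1r -ExZ; last by apply: dominatedB => //; exact: dominated_trunc.
apply: (@le_trans _ _ (Ex (fun x => c * (Env x ^+ 1 * (1 - trunc x))))).
  apply: Ex_le => [||x].
  - by apply: dominatedZ; apply: dominatedB => //; exact: dominated_trunc.
  - exact: dominatedZ.
  have /andP[t0 t1] := trunc01 x; rewrite expr1 mulrA.
  rewrite (_ : -1 * _ = (- g x) * (1 - trunc x)); last by ring.
  rewrite ler_wpM2r ?subr_ge0// (le_trans _ (gc x))//.
  by rewrite -normrN ler_norm.
by rewrite ExZ// ler_wpM2l// Ex_tail.
Qed.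

(** On the truncation set the quadratic bound on [expR] applies; off it the integrand is 0 and the
    majorant is 1. *)
Lemma trunc_laplace g v : dominated g -> dominated (fun x => g x ^+ 2) ->
  (forall x, Env x <= B -> g x <= 1 / 2) ->
  Ex (fun x => g x * trunc x) + 2 * Ex (fun x => g x ^+ 2 * trunc x) <= v ->
  (\int[mu]_x (expR (g x) * trunc x)%:E <= (expR v)%:E)%E.
Proof.
move=> dg dg2 gB gv.
have de : dominated (fun x => expR (g x) * trunc x).
  apply: (dominated_le (C := expR (1 / 2))) (dominated_cst 1) _ _.
  - apply: measurable_funM; last exact: measurable_trunc.
    by apply: measurableT_comp => //; case: dg.
  - move=> x; rewrite normr1 mulr1 normrM (ger0_norm (expR_ge0 _)) /trunc.
    case: (boolP (Env x <= B)) => [/gB gx|_]; last by rewrite normr0 mulr0 expR_ge0.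
    by rewrite normr1 mulr1 ler_expR.
  - exact: expR_ge0.
rewrite integral_Ex// lee_fin.
have dq : dominated (fun x => 1 + (g x * trunc x + 2 * (g x ^+ 2 * trunc x))).
  apply: dominatedD; first exact: dominated_cst.
  by apply: dominatedD; [exact: dominated_trunc|exact/dominatedZ/dominated_trunc].
apply: (@le_trans _ _ (Ex (fun x => 1 + (g x * trunc x + 2 * (g x ^+ 2 * trunc x))))).
  apply: Ex_le => // x; rewrite /trunc; case: (boolP (Env x <= B)) => [/gB gx|_].
    by rewrite !mulr1 addrA; exact: expR_le_quadratic.
  by rewrite !mulr0 !addr0.
rewrite ExD; [|exact: dominated_cst|]; last first.
  by apply: dominatedD; [exact: dominated_trunc|exact/dominatedZ/dominated_trunc].
rewrite Ex_cst ExD; [|exact: dominated_trunc|exact/dominatedZ/dominated_trunc].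
rewrite ExZ; last exact: dominated_trunc.
by apply: le_trans (expR_ge1Dx _) _; rewrite ler_expR.
Qed.

End expectation.

(** * Union bound with truncation *)

Section union.
Context d (T : measurableType d) (R : realType) (mu : probability T R).
Variables (Env : T -> R) (m B : R).
Hypothesis mEnv : measurable_fun setT Env.
Hypothesis Env1 : forall x, 1 <= Env x.
Hypothesis Env8 : (\int[mu]_x (Env x ^+ 8)%:E <= m%:E)%E.
Hypothesis B0 : 0 < B.
Context d1 (Omega : measurableType d1) (P : probability Omega R) (n : nat).
Variable X : 'I_n -> {RV P >-> T}.
Hypothesis lawX : forall i A, measurable A -> P (X i @^-1` A) = mu A.
Hypothesis indX : forall A : 'I_n -> set T, (forall i, measurable (A i)) ->
  P [set w | forall i, A i (X i w)] = (\prod_(i < n) P (X i @^-1` A i))%E.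

Local Notation t := (trunc Env B).

Lemma chernoff_prod g v : measurable_fun setT g ->
  (\int[mu]_x (expR (g x) * t x)%:E <= (expR v)%:E)%E ->
  (\int[P]_w (\prod_(i < n) (expR (g (X i w)) * t (X i w)))%:E <= (expR (n%:R * v))%:E)%E.
Proof.
move=> mg gv; pose f x := expR (g x) * t x.
have mt := measurable_trunc mEnv B.
have mf : measurable_fun setT f.
  by apply: measurable_funM => //; exact: measurableT_comp.
have f0 x : 0 <= f x.
  by rewrite mulr_ge0 ?expR_ge0//; case/andP: (trunc01 Env B x).
have I0 : (0 <= \int[mu]_x (f x)%:E)%E by apply: integral_ge0 => x _; rewrite lee_fin.
have fin : (\int[mu]_x (f x)%:E)%E \is a fin_num.
  by rewrite ge0_fin_numE//; apply: le_lt_trans gv _; exact: ltry.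
have fe : (\int[mu]_x (f x)%:E = (fine (\int[mu]_x (f x)%:E))%:E)%E by rewrite fineK.
rewrite (iid_expectation_prod lawX indX mf f0 fe) lee_fin mulrC expRM_natr.
apply: lerXn2r; rewrite ?nnegrE ?expR_ge0 ?fine_ge0//.
by rewrite -lee_fin fineK.
Qed.

Lemma outside_le (w : Omega) :
  (exists i, B < Env (X i w)) -> 1 <= \sum_(i < n) Env (X i w) ^+ 8 / B ^+ 8.
Proof.
move=> [i Bi]; rewrite (bigD1 i)//= ler_wpDr//.
  by apply: sumr_ge0 => j _; rewrite divr_ge0 ?exprn_ge0 ?(ltW B0) ?(le_trans ler01).
rewrite ler_pdivlMr ?exprn_gt0// mul1r lerXn2r ?nnegrE ?(ltW B0) ?(ltW Bi)//.
exact: le_trans ler01 (Env1 _).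
Qed.

Lemma chernoff_union (I : finType) (g : I -> T -> R) (v a : I -> R) (A : set Omega) :
  (forall c, measurable_fun setT (g c)) ->
  (forall c, (\int[mu]_x (expR (g c x) * t x)%:E <= (expR (v c))%:E)%E) ->
  (forall w, A w -> (forall i, Env (X i w) <= B) ->
     exists c, a c <= \sum_(i < n) g c (X i w)) ->
  ((P^*)%mu A <= (\sum_c expR (n%:R * v c - a c) + n%:R * (m / B ^+ 8))%:E)%E.
Proof.
move=> mg gv AE.
pose F1 c w := expR (- a c) * \prod_(i < n) (expR (g c (X i w)) * t (X i w)).
pose F2 i w := Env (X i w) ^+ 8 / B ^+ 8.
pose F w := (\sum_c (F1 c w)%:E + \sum_(i < n) (F2 i w)%:E)%E.
have t01 x := trunc01 Env B x.
have F10 c w : 0 <= F1 c w.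
  apply: mulr_ge0; first exact: expR_ge0.
  apply: prodr_ge0 => i _; apply: mulr_ge0; first exact: expR_ge0.
  by case/andP: (t01 (X i w)).
have F20 i w : 0 <= F2 i w.
  by rewrite divr_ge0 ?exprn_ge0 ?(ltW B0) ?(le_trans ler01).
have mF1 c : measurable_fun setT (fun w => (F1 c w)%:E).
  apply/measurable_EFinP; apply: measurable_funM => //.
  apply: measurable_prod => i _; apply: measurable_funM.
    by apply: measurableT_comp => //; apply: measurableT_comp => //; exact: measurable_funPT.
  apply: measurableT_comp; first exact: measurable_trunc.
  exact: measurable_funPT.
have mF2 i : measurable_fun setT (fun w => (F2 i w)%:E).
  apply/measurable_EFinP; apply: measurable_funM => //.
  apply: measurable_funX; apply: measurableT_comp => //; exact: measurable_funPT.
have mF : measurable_fun setT F.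
  by apply: emeasurable_funD; apply: emeasurable_sum.
have F0 w : (0 <= F w)%E.
  by apply: adde_ge0; apply: sume_ge0 => c _; rewrite lee_fin.
have FA w : A w -> (1 <= F w)%E.
  move=> Aw; rewrite /F !sumEFin -EFinD lee_fin.
  case: (pselect (exists i, B < Env (X i w))) => [ex|nex].
    by rewrite ler_wpDl ?sumr_ge0//; exact: outside_le.
  have EB i : Env (X i w) <= B by rewrite leNgt; apply/negP => h; apply: nex; exists i.
  have [c ac] := AE w Aw EB.
  rewrite (bigD1 c)//= -addrA ler_wpDr ?addr_ge0 ?sumr_ge0//.
  rewrite /F1 (eq_bigr (fun i => expR (g c (X i w)))); last first.
    by move=> i _; rewrite /trunc EB mulr1.
  rewrite -expR_sum -expRD (le_trans _ (expR_ge1Dx _))// lerDl.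
  by rewrite addrC subr_ge0.
apply: (le_trans (outer_markov P mF F0 FA)).
rewrite ge0_integralD//; [|by move=> w _; apply: sume_ge0 => c _; rewrite lee_fin|exact: emeasurable_sum
  |by move=> w _; apply: sume_ge0 => c _; rewrite lee_fin|exact: emeasurable_sum].
rewrite !ge0_integral_sum//; try by move=> c w _; rewrite lee_fin.
rewrite EFinD; apply: leeD.
  rewrite -sumEFin; apply: lee_sum => c _.
  under eq_integral do rewrite EFinM.
  rewrite ge0_integralZl//; first last.
  - move=> w _; rewrite lee_fin; apply: prodr_ge0 => i _.
    by apply: mulr_ge0; [exact: expR_ge0|case/andP: (t01 (X i w))].
  - apply/measurable_EFinP; apply: measurable_prod => i _; apply: measurable_funM.
      by apply: measurableT_comp => //; apply: measurableT_comp => //; exact: measurable_funPT.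
    by apply: measurableT_comp; [exact: measurable_trunc|exact: measurable_funPT].
  rewrite addrC expRD EFinM; apply: lee_wpmul2l; first by rewrite lee_fin expR_ge0.
  exact: chernoff_prod.
rewrite (_ : (n%:R * (m / B ^+ 8))%:E = \sum_(i < n) (m / B ^+ 8)%:E)%E; last first.
  by rewrite sumEFin sumr_const card_ord mulr_natl.
apply: lee_sum => i _.
have mE8 : measurable_fun setT (fun x => (Env x ^+ 8 / B ^+ 8)%:E).
  by apply/measurable_EFinP; apply: measurable_funM => //; exact: measurable_funX.
have E80 x : (0 <= (Env x ^+ 8 / B ^+ 8)%:E)%E.
  by rewrite lee_fin divr_ge0 ?exprn_ge0 ?(ltW B0) ?(le_trans ler01).
have tr : (\int[mu]_x (Env x ^+ 8 / B ^+ 8)%:E =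
   \int[P]_w ((Env (X i w) ^+ 8 / B ^+ 8)%:E * 1%:E))%E.
  apply: (@transfer_ge0 _ _ _ _ _ _ _ (X i) (fun=> 1)) => //.
    move=> A' mA'; rewrite integral_cst//; last first.
      by rewrite -[X in measurable X]setTI; exact: measurable_funPT.
    by rewrite mul1e; apply/esym/lawX.
under eq_integral do rewrite /F2 -[X in X%:E]mulr1 EFinM.
rewrite -tr; under eq_integral do rewrite mulrC EFinM.
rewrite ge0_integralZl//.
- rewrite [in leRHS]mulrC EFinM; apply: lee_wpmul2l => //.
  by rewrite lee_fin invr_ge0 exprn_ge0// ltW.
- by apply/measurable_EFinP; exact: measurable_funX.
- by move=> x _; rewrite lee_fin exprn_ge0 ?(le_trans ler01).
- by rewrite lee_fin invr_ge0 exprn_ge0// ltW.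
Qed.

End union.

(** * Laplace transforms of centred functions and of penalised scores *)

Section laplace.
Context d (T : measurableType d) (R : realType) (mu : probability T R).
Variables (Env : T -> R) (m : R).
Hypothesis mEnv : measurable_fun setT Env.
Hypothesis Env1 : forall x, 1 <= Env x.
Hypothesis Env8 : (\int[mu]_x (Env x ^+ 8)%:E <= m%:E)%E.
Variable B : R.
Hypothesis B1 : 1 <= B.

Implicit Types g S : T -> R.
Local Notation Ex g := (Rintegral mu setT g).
Local Notation t := (trunc Env B).

Let B0 : 0 < B. Proof. exact: lt_le_trans ltr01 B1. Qed.
Let Env0 x : 0 <= Env x. Proof. exact: le_trans ler01 (Env1 x). Qed.
Let m0 : 0 <= m. Proof. exact: m8_ge0 mEnv Env1 Env8. Qed.

Lemma dominated_pow g c k : (k <= 8)%N -> measurable_fun setT g ->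
  (forall x, `|g x| <= c * Env x ^+ k) -> dominated Env g.
Proof.
move=> k8 mg gc.
apply: (@dominated_le _ _ _ Env g (fun x => Env x ^+ k) `|c|) => //; first exact: dominated_Env.
move=> x; rewrite (le_trans (gc x))// (ger0_norm (exprn_ge0 _ (Env0 x))).
by rewrite ler_wpM2r ?exprn_ge0 ?ler_norm.
Qed.

Lemma Ex_trunc_le g : dominated Env g -> (forall x, 0 <= g x) ->
  Ex (fun x => g x * t x) <= Ex g.
Proof.
move=> dg g0; apply: (Ex_le mEnv Env1 Env8) (dominated_trunc mEnv B dg) dg _ => // x.
by have /andP[t0 t1] := trunc01 Env B x; rewrite ler_piMr.
Qed.

Lemma sqr_le_of_norm (a c e : R) : 0 <= c -> 0 <= e -> `|a| <= c * e -> a ^+ 2 <= c ^+ 2 * e ^+ 2.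
Proof.
move=> c0 e0 ac; rewrite -exprMn -(real_normK (num_real a)).
by rewrite lerXn2r ?nnegrE ?mulr_ge0.
Qed.

(** The condition [1 <= B^4 q] brings the truncation bias [c m / B^4] below [q c^2 m]. This
    contributes once and the second moment twice, whence the factor 3. *)
Lemma centered_laplace g c q : measurable_fun setT g -> 1 <= c ->
  (forall x, `|g x| <= c * Env x) -> Ex g = 0 ->
  0 < q -> q * c * B <= 1 / 2 -> 1 <= B ^+ 4 * q ->
  (\int[mu]_x (expR (q * g x) * t x)%:E <= (expR (3 * q ^+ 2 * c ^+ 2 * m))%:E)%E.
Proof.
move=> mg c1 gc g0 q0 qB Bq.
have c0 : 0 <= c by exact: le_trans ler01 c1.
have gc2 x : g x ^+ 2 <= c ^+ 2 * Env x ^+ 2 by exact: sqr_le_of_norm.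
have dg : dominated Env g by apply: (dominated_pow (isT : 1 <= 8)%N).
have dg2 : dominated Env (fun x => g x ^+ 2).
  apply: (@dominated_pow _ (c ^+ 2) 2) => // [|x]; first exact: measurable_funX.
  by rewrite ger0_norm ?sqr_ge0.
have e2 : (fun x => (q * g x) ^+ 2) = (fun x => q ^+ 2 * g x ^+ 2).
  by apply/funext => x; rewrite exprMn.
apply: (trunc_laplace mEnv Env1 Env8) => //.
- exact: dominatedZ.
- by rewrite e2; exact: dominatedZ.
- move=> x EB; apply: le_trans qB; rewrite -mulrA ler_pM2l//.
  by rewrite (le_trans (ler_norm _))// (le_trans (gc x))// ler_wpM2l.
have -> : (fun x => q * g x * t x) = (fun x => q * (g x * t x)).
  by apply/funext => x; rewrite mulrA.
have -> : (fun x => (q * g x) ^+ 2 * t x) = (fun x => q ^+ 2 * (g x ^+ 2 * t x)).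
  by apply/funext => x; ring.
rewrite !(ExZ mEnv Env1 Env8); [|exact: dominated_trunc|exact: dominated_trunc].
have h1 := Ex_centered_trunc mEnv Env1 Env8 B0 mg c0 gc g0.
have h2 : Ex (fun x => g x ^+ 2 * t x) <= c ^+ 2 * m.
  apply: le_trans (Ex_trunc_le dg2 _) _; first by move=> x; exact: sqr_ge0.
  apply: (@le_trans _ _ (Ex (fun x => c ^+ 2 * Env x ^+ 2))).
    apply: (Ex_le mEnv Env1 Env8) => //; exact/dominatedZ/dominated_Env.
  rewrite (ExZ mEnv Env1 Env8); last exact: dominated_Env.
  by rewrite ler_wpM2l ?sqr_ge0// (Ex_Env mEnv Env1 Env8).
have h3 : c * (m / B ^+ 4) <= q * (c ^+ 2 * m).
  rewrite [leLHS]mulrA ler_pdivrMr ?exprn_gt0//.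
  apply: (@le_trans _ _ (c * m * (B ^+ 4 * q))); first by rewrite ler_peMr ?mulr_ge0.
  have -> : q * (c ^+ 2 * m) * B ^+ 4 = (c * m * (B ^+ 4 * q)) * c by ring.
  by rewrite ler_peMr// !mulr_ge0// ?exprn_ge0// ltW.
have := ler_wpM2l (ltW q0) (le_trans h1 h3).
have := ler_wpM2l (sqr_ge0 q) h2.
have -> : 3 * q ^+ 2 * c ^+ 2 * m = q * (q * (c ^+ 2 * m)) + 2 * (q ^+ 2 * (c ^+ 2 * m)) by ring.
lra.
Qed.

(** For a score [S0] within [delta * Env] of [S], one has [S0^2 >= S^2 / 2 - delta^2 Env^2]; the
    last two terms therefore bound [- (eps S0)^2 / 5] from above. The linear difference
    [eps (S0 - S)] is treated separately. *)
Definition penalized (eps delta : R) (S : T -> R) x :=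
  eps * S x - eps ^+ 2 / 10 * S x ^+ 2 + eps ^+ 2 * delta ^+ 2 / 5 * Env x ^+ 2.

Lemma measurable_penalized eps delta S : measurable_fun setT S ->
  measurable_fun setT (penalized eps delta S).
Proof.
move=> mS; apply: measurable_funD; last first.
  by apply: measurable_funM => //; exact: measurable_funX.
apply: measurable_funB; first exact: measurable_funM.
by apply: measurable_funM => //; exact: measurable_funX.
Qed.

(** Since [S] is centred with second moment 1, the penalty creates a drift close to [- eps^2 / 10].
    The hypotheses keep the truncation errors and the envelope term small against it. The factor
    [200^-1] does the same for the second-order term of the exponential, in which it enters squared;
    [eps^2 / 40] is what safely remains. *)
Lemma penalized_laplace S C eps delta : measurable_fun setT S -> 1 <= C ->
  (forall x, `|S x| <= C * Env x) -> Ex S = 0 -> Ex (fun x => S x ^+ 2) = 1 ->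
  0 < eps -> eps * C * B <= 1 / 2 -> 1000 * C * m <= B ^+ 4 * eps ->
  10 * C ^+ 2 * m <= B ^+ 4 -> 2 * eps ^+ 2 * C ^+ 4 * m <= 1 ->
  0 <= delta <= 1 -> delta ^+ 2 * m <= 1 / 16 ->
  (\int[mu]_x (expR (200^-1 * penalized eps delta S x) * t x)%:E <=
     (expR (- (eps ^+ 2 / 40 / 200)))%:E)%E.
Proof.
move=> mS C1 SC S0 S1 e0 eCB CmB C2mB eCm /andP[dl0 dl1] dm.
have C0 : 0 <= C by exact: le_trans ler01 C1.
set U := penalized eps delta S.
have mU : measurable_fun setT U by exact: measurable_penalized.
have SC2 x : S x ^+ 2 <= C ^+ 2 * Env x ^+ 2 by exact: sqr_le_of_norm.
have dS : dominated Env S by apply: (dominated_pow (isT : 1 <= 8)%N).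
have dS2 : dominated Env (fun x => S x ^+ 2).
  apply: (@dominated_pow _ (C ^+ 2) 2) => // [|x]; first exact: measurable_funX.
  by rewrite ger0_norm ?sqr_ge0.
have dE2 : dominated Env (fun x => Env x ^+ 2) by exact: dominated_Env.
have dE4 : dominated Env (fun x => Env x ^+ 4) by exact: dominated_Env.
have UE : U = (fun x => eps * S x - eps ^+ 2 / 10 * S x ^+ 2 + eps ^+ 2 * delta ^+ 2 / 5 * Env x ^+ 2) by [].
have dU : dominated Env U.
  rewrite UE; apply: dominatedD; last exact: dominatedZ.
  by apply: dominatedB; exact: dominatedZ.
have dl2 : 0 <= delta ^+ 2 <= 1 by rewrite sqr_ge0 exprn_ile1.
(* Split [U = eps S - h], where [h] is of order [eps^2 C^2 Env^2], and use that the square of a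
   difference is at most twice the sum of the squares. *)
have U2 x : U x ^+ 2 <= 2 * eps ^+ 2 * S x ^+ 2 + 2 * eps ^+ 4 * C ^+ 4 * Env x ^+ 4.
  have {}SC2 := SC2 x.
  set h := eps ^+ 2 / 10 * S x ^+ 2 - eps ^+ 2 * delta ^+ 2 / 5 * Env x ^+ 2.
  have -> : U x = eps * S x - h by rewrite UE /h; ring.
  have E2 : 0 <= Env x ^+ 2 by exact: sqr_ge0.
  have CE : Env x ^+ 2 <= C ^+ 2 * Env x ^+ 2.
    by rewrite ler_peMl// exprn_ege1.
  have hb : `|h| <= eps ^+ 2 * (C ^+ 2 * Env x ^+ 2).
    have -> : h = eps ^+ 2 * (S x ^+ 2 / 10 - delta ^+ 2 * Env x ^+ 2 / 5) by rewrite /h; ring.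
    rewrite normrM (ger0_norm (sqr_ge0 eps)) ler_wpM2l ?sqr_ge0//.
    have := sqr_ge0 (S x); case/andP: dl2 => a1 a2.
    have := mulr_ge0 a1 E2; have := ler_wpM2r E2 a2.
    move: SC2 CE E2; move: (Env x ^+ 2) (S x ^+ 2) (C ^+ 2 * Env x ^+ 2) (delta ^+ 2 * Env x ^+ 2).
    by move=> e s r p *; rewrite ler_norml; apply/andP; split; lra.
  have := sqr_le_of_norm (sqr_ge0 eps) (mulr_ge0 (sqr_ge0 C) E2) hb.
  have -> : (eps ^+ 2) ^+ 2 * (C ^+ 2 * Env x ^+ 2) ^+ 2 = eps ^+ 4 * C ^+ 4 * Env x ^+ 4 by ring.
  have -> : (eps * S x - h) ^+ 2 = 2 * eps ^+ 2 * S x ^+ 2 + 2 * h ^+ 2 - (eps * S x + h) ^+ 2 by ring.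
  by have := sqr_ge0 (eps * S x + h); lra.
have dU2 : dominated Env (fun x => U x ^+ 2).
  apply: (@dominated_pow _ (2 * eps ^+ 2 * C ^+ 2 + 2 * eps ^+ 4 * C ^+ 4) 4) => // [|x].
    exact: measurable_funX.
  rewrite ger0_norm ?sqr_ge0// (le_trans (U2 x))// [leRHS]mulrDl lerD2r.
  have e20 : 0 <= 2 * eps ^+ 2 by apply: mulr_ge0 => //; exact: sqr_ge0.
  rewrite -[leRHS]mulrA ler_wpM2l// (le_trans (SC2 x))//.
  by rewrite ler_wpM2l ?sqr_ge0// ler_weXn2l.
have e2 : (fun x => (200^-1 * U x) ^+ 2) = (fun x => 200^-1 ^+ 2 * U x ^+ 2).
  by apply/funext => x; rewrite exprMn.
have := trunc_laplace mEnv Env1 Env8 (g := fun x => 200^-1 * U x) (B := B).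
apply.
- exact: dominatedZ.
- by rewrite e2; exact: dominatedZ.
- move=> x EB.
  have h1 : eps * S x <= 1 / 2.
    apply: le_trans eCB; rewrite -mulrA ler_pM2l//.
    by rewrite (le_trans (ler_norm _))// (le_trans (SC x))// ler_wpM2l.
  have h2 : eps ^+ 2 * delta ^+ 2 * Env x ^+ 2 <= 1.
    have : eps * Env x <= 1.
      apply: (@le_trans _ _ (eps * C * B)); last by apply: le_trans eCB _; lra.
      by rewrite -mulrA ler_pM2l// (le_trans EB)// ler_peMl// ltW.
    move=> h; rewrite -!exprMn exprn_ile1//.
      by rewrite !mulr_ge0// ltW.
    rewrite mulrAC mulr_ile1//; by rewrite mulr_ge0// ltW.
  have h3 : 0 <= eps ^+ 2 * S x ^+ 2 by rewrite mulr_ge0 ?sqr_ge0.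
  rewrite UE; move: h1 h2 h3.
  have -> : eps * S x - eps ^+ 2 / 10 * S x ^+ 2 + eps ^+ 2 * delta ^+ 2 / 5 * Env x ^+ 2 =
    eps * S x - (eps ^+ 2 * S x ^+ 2) / 10 + (eps ^+ 2 * delta ^+ 2 * Env x ^+ 2) / 5 by field.
  move: (eps * S x) (eps ^+ 2 * S x ^+ 2) (eps ^+ 2 * delta ^+ 2 * Env x ^+ 2) => a b c *.
  lra.
have ExZ' := ExZ mEnv Env1 Env8.
have -> : (fun x => 200^-1 * U x * t x) = (fun x => 200^-1 *
   (eps * (S x * t x) - eps ^+ 2 / 10 * (S x ^+ 2 * t x) + eps ^+ 2 * delta ^+ 2 / 5 * (Env x ^+ 2 * t x))).
  by apply/funext => x; rewrite UE; ring.
have -> : (fun x => (200^-1 * U x) ^+ 2 * t x) = (fun x => 200^-1 ^+ 2 * (U x ^+ 2 * t x)).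
  by apply/funext => x; ring.
have dSt := dominated_trunc mEnv B dS.
have dS2t := dominated_trunc mEnv B dS2.
have dE2t := dominated_trunc mEnv B dE2.
have dU2t := dominated_trunc mEnv B dU2.
rewrite (ExZ' _ _ dU2t) (ExZ' 200^-1); last first.
  by apply: dominatedD; [apply: dominatedB|]; exact: dominatedZ.
rewrite (ExD mEnv Env1 Env8); [|by apply: dominatedB; exact: dominatedZ|exact: dominatedZ].
rewrite (ExB mEnv Env1 Env8); [|exact: dominatedZ|exact: dominatedZ].
rewrite (ExZ' _ _ dSt) (ExZ' _ _ dS2t) (ExZ' _ _ dE2t).
have b1 : Ex (fun x => S x * t x) <= eps / 1000.
  apply: le_trans (Ex_centered_trunc mEnv Env1 Env8 B0 mS C0 SC S0) _.
  rewrite [leLHS]mulrA ler_pdivrMr ?exprn_gt0//; move: CmB.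
  have -> : 1000 * C * m = 1000 * (C * m) by ring.
  rewrite [B ^+ 4 * eps]mulrC; move: (C * m) (B ^+ 4) => a b h.
  by rewrite mulrAC; move: (eps * b) h => c h; lra.
have b2 : 1 - 1 / 10 <= Ex (fun x => S x ^+ 2 * t x).
  have : Ex (fun x => C ^+ 2 * (Env x ^+ 2 * (1 - t x))) <= 1 / 10.
    have dd : dominated Env (fun x => Env x ^+ 2 * (1 - t x)).
      rewrite (_ : (fun x => _) = fun x => Env x ^+ 2 - Env x ^+ 2 * t x).
        exact: dominatedB.
      by apply/funext => x; ring.
    rewrite (ExZ' _ _ dd).
    apply: (@le_trans _ _ (C ^+ 2 * (m / B ^+ 4))).
      by rewrite ler_wpM2l ?sqr_ge0// (Ex_tail mEnv Env1 Env8).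
    rewrite [leLHS]mulrA ler_pdivrMr ?exprn_gt0//; move: C2mB; rewrite -mulrA; lra.
  have : Ex (fun x => S x ^+ 2 - S x ^+ 2 * t x) <= Ex (fun x => C ^+ 2 * (Env x ^+ 2 * (1 - t x))).
    apply: (Ex_le mEnv Env1 Env8).
    - exact: dominatedB.
    - apply: dominatedZ; rewrite (_ : (fun x => _) = fun x => Env x ^+ 2 - Env x ^+ 2 * t x).
        exact: dominatedB.
      by apply/funext => x; ring.
    - move=> x; have -> : S x ^+ 2 - S x ^+ 2 * t x = S x ^+ 2 * (1 - t x) by ring.
      rewrite mulrA ler_wpM2r// subr_ge0; by case/andP: (trunc01 Env B x).
  rewrite (ExB mEnv Env1 Env8)// S1; lra.
have b3 : Ex (fun x => Env x ^+ 2 * t x) <= m.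
  apply: le_trans (Ex_trunc_le dE2 _) _; first by move=> x; exact: sqr_ge0.
  by rewrite (Ex_Env mEnv Env1 Env8).
have b4 : Ex (fun x => U x ^+ 2 * t x) <= 2 * eps ^+ 2 + 2 * eps ^+ 4 * C ^+ 4 * m.
  apply: le_trans (Ex_trunc_le dU2 _) _; first by move=> x; exact: sqr_ge0.
  apply: le_trans (Ex_le mEnv Env1 Env8 dU2 _ U2) _.
    by apply: dominatedD; exact: dominatedZ.
  rewrite (ExD mEnv Env1 Env8); [|exact: dominatedZ|exact: dominatedZ].
  rewrite (ExZ' _ _ dS2) (ExZ' _ _ dE4) S1 mulr1 lerD2l.
  rewrite ler_wpM2l ?(Ex_Env mEnv Env1 Env8)//.
  by apply: mulr_ge0; [apply: mulr_ge0 => //|]; apply: exprn_ge0 => //; exact: ltW.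
have c1 := ler_wpM2l (ltW e0) b1.
have c2 := ler_wpM2l (sqr_ge0 eps) b2.
have c3 : eps ^+ 2 * delta ^+ 2 / 5 * Ex (fun x => Env x ^+ 2 * t x) <= eps ^+ 2 / 80.
  apply: (@le_trans _ _ (eps ^+ 2 * delta ^+ 2 / 5 * m)).
    by rewrite ler_wpM2l// divr_ge0// mulr_ge0 ?sqr_ge0.
  have := ler_wpM2l (sqr_ge0 eps) dm.
  have -> : eps ^+ 2 * delta ^+ 2 / 5 * m = eps ^+ 2 * (delta ^+ 2 * m) / 5 by ring.
  lra.
have c4 : 2 * eps ^+ 4 * C ^+ 4 * m <= eps ^+ 2.
  have := ler_wpM2l (sqr_ge0 eps) eCm; rewrite mulr1.
  by apply: le_trans; rewrite le_eqVlt; apply/orP; left; apply/eqP; ring.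
move: b1 b2 b3 b4 c1 c2 c3 c4.
have -> : eps * (eps / 1000) = eps ^+ 2 / 1000 by field.
rewrite mulrBr mulr1.
move: (Ex (fun x => S x * t x)) (Ex (fun x => S x ^+ 2 * t x)) => p r.
move: (Ex (fun x => Env x ^+ 2 * t x)) (Ex (fun x => U x ^+ 2 * t x)) => s u.
have -> : eps ^+ 2 / 10 * r = (eps ^+ 2 * r) / 10 by ring.
move: (_ / 5 * s) (2 * eps ^+ 4 * C ^+ 4 * m) (eps * p) (eps ^+ 2 * r) (sqr_ge0 eps).
move: (eps ^+ 2) => E' z1 z2 z3 z4 E0 *.
have -> : 200^-1 * (z3 - z4 / 10 + z1) + 2 * (200^-1 ^+ 2 * u) =
  200^-1 * (z3 - z4 / 10 + z1 + 2 * (200^-1 * u)) by ring.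
rewrite -mulrN mulrC -[leRHS]mulNr ler_pM2r//; lra.
Qed.

End laplace.

(** * Series and sample size *)

Section series.
Variable R : realFieldType.

Lemma sum_geometric_half J : \sum_(j < J) 2^-1 ^+ j = 2 - 2 * 2^-1 ^+ J :> R.
Proof.
elim: J => [|J IH]; first by rewrite big_ord0 expr0; ring.
by rewrite big_ord_recr/= IH exprS; field.
Qed.

Lemma sum_arith_geometric_half J :
  \sum_(j < J) 2^-1 ^+ j * (1 + j%:R) = 4 - (2 * J%:R + 4) * 2^-1 ^+ J :> R.
Proof.
elim: J => [|J IH]; first by rewrite big_ord0 expr0; ring.
by rewrite big_ord_recr/= IH exprS -natr1; field.
Qed.

Lemma natr_half_le1 n : n%:R * 2^-1 ^+ n <= 1 :> R.
Proof.
rewrite exprVn ler_pdivrMr ?exprn_gt0// mul1r -natrX ler_nat.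
exact/ltnW/ltn_expl.
Qed.

End series.

(** With [B = n^(1/4)], truncation loses a probability of order [n / B^8 = 1 / n], while [q B] tends
    to 0 and [n q] dominates [B^2]. As [ln n = 4 ln B <= 4 B], the single condition [4 K^2 <= B]
    makes this explicit. *)
Lemma large_sample (R : realType) (K : R) (n : nat) (B q : R) :
  B = Num.sqrt (Num.sqrt n%:R) -> q = Num.sqrt (ln n%:R / n%:R) ->
  1 <= K -> 4 * K ^+ 2 <= B ->
  [/\ n%:R = B ^+ 4, K <= B, 1 <= ln (n%:R : R), 0 < q &
      [/\ q ^+ 2 * n%:R = ln n%:R, K * q * B <= 1 & B ^+ 2 <= n%:R * q]].
Proof.
move=> BE qE K1 KB.
have K2 : K <= K ^+ 2 by rewrite expr2 ler_peMl// (le_trans ler01).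
have B4 : 4 <= B by lra.
have B0 : 0 < B by lra.
have nE : n%:R = B ^+ 4 :> R.
  rewrite (_ : B ^+ 4 = (B ^+ 2) ^+ 2); last by rewrite -exprM.
  by rewrite BE !sqr_sqrtr ?sqrtr_ge0.
have n0 : 0 < n%:R :> R by rewrite nE exprn_gt0.
have lnB : ln B <= B - 1.
  by rewrite -{1}[B](subrK 1) addrC; apply: le_ln1Dx; lra.
have lnV : 1 - B^-1 <= ln B.
  have : ln B^-1 <= B^-1 - 1.
    by rewrite -{1}[B^-1](subrK 1) addrC; apply: le_ln1Dx; rewrite ltrBrDl subrr invr_gt0.
  by rewrite lnV ?posrE//; lra.
have LE : ln (n%:R : R) = 4 * ln B by rewrite nE lnXn// mulr_natl.
have Bi : B^-1 <= 4^-1 by rewrite lef_pV2 ?posrE.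
have L1 : 1 <= ln (n%:R : R) by rewrite LE; lra.
have LB : ln (n%:R : R) <= 4 * B by rewrite LE; lra.
have q0 : 0 < q by rewrite qE sqrtr_gt0 divr_gt0// (lt_le_trans ltr01).
have q2 : q ^+ 2 * n%:R = ln n%:R.
  by rewrite qE sqr_sqrtr ?divr_ge0 ?divfK ?gt_eqF// ?(le_trans ler01)// ltW.
split=> //; first by lra.
have K0 : 0 <= K by lra.
split=> //.
- have h : (K * q * B) ^+ 2 <= 1 ^+ 2.
    have -> : (K * q * B) ^+ 2 = K ^+ 2 * (q ^+ 2 * n%:R) / B ^+ 2.
      by rewrite nE; field; rewrite gt_eqF.
    rewrite q2 expr1n ler_pdivrMr ?exprn_gt0// mul1r.
    apply: (@le_trans _ _ (K ^+ 2 * (4 * B))); first by rewrite ler_wpM2l ?sqr_ge0.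
    by rewrite mulrA [K ^+ 2 * 4]mulrC [B ^+ 2]expr2 ler_pM2r.
  by rewrite -(@ler_pXn2r _ 2) ?nnegrE// !mulr_ge0// ltW.
- have h : (B ^+ 2) ^+ 2 <= (n%:R * q) ^+ 2.
    have -> : (n%:R * q) ^+ 2 = n%:R * (q ^+ 2 * n%:R) by ring.
    by rewrite q2 -exprM -nE ler_peMr// ltW.
  by rewrite -(@ler_pXn2r _ 2) ?nnegrE ?sqr_ge0// mulr_ge0// ltW.
Qed.

(** * Sums of functions with a geometric expansion *)

Section localized.
Context d (T : measurableType d) (R : realType) (mu : probability T R).
Variables (Env : T -> R) (m : R).
Hypothesis mEnv : measurable_fun setT Env.
Hypothesis Env1 : forall x, 1 <= Env x.
Hypothesis Env8 : (\int[mu]_x (Env x ^+ 8)%:E <= m%:E)%E.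
Hypothesis m1 : 1 <= m.
Variables (K : nat -> finType) (D : nat) (psi : forall j, K j -> T -> R).
Hypothesis D0 : (0 < D)%N.
Hypothesis cardK : forall j, (#|K j| <= D ^ j)%N.
Hypothesis mpsi : forall j u, measurable_fun setT (@psi j u).
Hypothesis psi_le : forall j u x, `|@psi j u x| <= Env x.

Local Notation Ex g := (Rintegral mu setT g).

Let Env0 x : 0 <= Env x. Proof. exact: le_trans ler01 (Env1 x). Qed.

Lemma dominated_sum (J : Type) (s : seq J) (g : J -> T -> R) :
  (forall j, dominated Env (g j)) -> dominated Env (fun x => \sum_(j <- s) g j x).
Proof.
move=> dg; elim: s => [|j s IH].
  under eq_fun do rewrite big_nil; exact: dominated_cst.
by under eq_fun do rewrite big_cons; exact: dominatedD.
Qed.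

Lemma Ex_sum (J : Type) (s : seq J) (g : J -> T -> R) :
  (forall j, dominated Env (g j)) ->
  Ex (fun x => \sum_(j <- s) g j x) = \sum_(j <- s) Ex (g j).
Proof.
move=> dg; elim: s => [|j s IH].
  by rewrite big_nil; under eq_Rintegral do rewrite big_nil; rewrite Ex_cst.
rewrite big_cons -IH -(ExD mEnv Env1 Env8)//; last exact: dominated_sum.
by under eq_Rintegral do rewrite big_cons.
Qed.

Let dpsi j u : dominated Env (@psi j u).
Proof. by apply: (dominated_pow mEnv Env1 (isT : 1 <= 8)%N (c := 1)) => // x; rewrite mul1r. Qed.

(** The decay [(2 D)^-j] beats the number of words, at most [D ^ j]: the coefficients of length [j]
    sum to at most [delta 2^-j]. They may depend on the order [J] of the expansion. *)
Definition expandable (delta : R) (r : T -> R) :=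
  forall J : nat, exists a : forall j, K j -> R,
    (forall j u, `|a j u| <= delta * (2 * D%:R) ^- j) /\
    forall x, `|r x - \sum_(j < J) \sum_u a j u * psi u x| <= delta * 2^-1 ^+ J * Env x.

(** Expand to order [n]. Up to the factor [delta], the word sums contribute [t] times a partial sum
    of [(1 + j) 2^-j], at most 4, and the [n] remainders of size [2^-n] add up to at most [B + m].
    As [r] is centred, the word sums can be centred too. *)
Lemma expandable_sum_le (delta B t : R) (n : nat) (r : T -> R) (x : 'I_n -> T) :
  0 <= delta -> 0 <= t -> 0 <= B -> measurable_fun setT r -> Ex r = 0 -> expandable delta r ->
  (forall i, Env (x i) <= B) ->
  (forall (j : 'I_n) (u : K j), `|\sum_(i < n) (psi u (x i) - Ex (psi u))| <= t * (1 + j%:R)) ->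
  `|\sum_(i < n) r (x i)| <= delta * (4 * t + B + m).
Proof.
move=> dl0 t0 B0 mr r0 /(_ n)[a [aD ra]] xB ut.
pose main x := \sum_(j < n) \sum_u a j u * psi u x.
pose rem x := r x - main x.
have dt j u : dominated Env (fun x => a j u * psi u x) by exact: dominatedZ.
have dmain : dominated Env main.
  by apply: dominated_sum => j; apply: dominated_sum => u.
have mrem : measurable_fun setT rem by apply: measurable_funB => //; case: dmain.
have drem : dominated Env rem.
  apply: (dominated_pow mEnv Env1 (isT : 1 <= 8)%N (c := delta * 2^-1 ^+ n)) => // y.
have rE y : r y = main y + rem y by rewrite /rem addrC subrK.
have mainE : Ex main = \sum_(j < n) \sum_u a j u * Ex (psi u).
  rewrite Ex_sum; last by move=> j; exact: dominated_sum.
  apply: eq_bigr => j _; rewrite Ex_sum//; apply: eq_bigr => u _.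
  by rewrite (ExZ mEnv Env1 Env8).
have Er : Ex rem = - Ex main.
  by rewrite (ExB mEnv Env1 Env8)// ?r0 ?sub0r//; rewrite (_ : r = fun y => main y + rem y); [exact: dominatedD|exact/funext].
have p0 : 0 <= 2^-1 ^+ n :> R by exact: exprn_ge0.
have remle : `|Ex rem| <= delta * 2^-1 ^+ n * m.
  have := @le_normr_Rintegral _ _ _ mu setT rem measurableT (dominated_integrable mEnv Env1 Env8 drem).
  move=> /le_trans; apply.
  apply: (@le_trans _ _ (Ex (fun x => (delta * 2^-1 ^+ n) * Env x ^+ 1))).
    apply: (Ex_le mEnv Env1 Env8) => [||y].
    - apply: (dominated_pow mEnv Env1 (isT : 1 <= 8)%N (c := delta * 2^-1 ^+ n)) => // [|y].
        exact: measurableT_comp.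
      by rewrite normr_id; exact: ra.
    - exact/dominatedZ/dominated_Env.
    - by rewrite expr1; exact: ra.
  rewrite (ExZ mEnv Env1 Env8); last exact: dominated_Env.
  by rewrite ler_wpM2l ?mulr_ge0// (Ex_Env mEnv Env1 Env8).
have -> : \sum_(i < n) r (x i) =
   \sum_(j < n) \sum_u a j u * (\sum_(i < n) (psi u (x i) - Ex (psi u)))
   + \sum_(i < n) (rem (x i) - Ex rem).
  transitivity (\sum_(i < n) ((main (x i) - Ex main) + (rem (x i) - Ex rem))).
    by apply: eq_bigr => i _; rewrite rE Er; ring.
  rewrite big_split /=; congr (_ + _).
  under [RHS]eq_bigr do under eq_bigr do rewrite mulr_sumr.
  under [RHS]eq_bigr do rewrite exchange_big /=.
  rewrite [RHS]exchange_big /=; apply: eq_bigr => i _.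
  rewrite mainE -sumrB; apply: eq_bigr => j _; rewrite -sumrB; apply: eq_bigr => u _.
  by rewrite mulrBr.
apply: (le_trans (ler_normD _ _)).
have h1 : `|\sum_(j < n) \sum_u a j u * (\sum_(i < n) (psi u (x i) - Ex (psi u)))|
    <= delta * (4 * t).
  apply: (le_trans (ler_norm_sum _ _ _)).
  apply: (@le_trans _ _ (\sum_(j < n) delta * t * (2^-1 ^+ j * (1 + j%:R)))).
    apply: ler_sum => j _; apply: (le_trans (ler_norm_sum _ _ _)).
    apply: (@le_trans _ _ (\sum_(u : K j) delta * (2 * D%:R) ^- j * (t * (1 + j%:R)))).
      by apply: ler_sum => u _; rewrite normrM ler_pM.
    rewrite sumr_const -[leLHS]mulr_natr.
    have D1 : 0 < D%:R :> R by rewrite ltr0n.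
    have tj : 0 <= delta * t * (1 + j%:R) by rewrite !mulr_ge0.
    have -> : delta * (2 * D%:R) ^- j * (t * (1 + j%:R)) * #|K j|%:R =
       (delta * t * (1 + j%:R)) * ((2 * D%:R) ^- j * #|K j|%:R) by ring.
    rewrite (_ : delta * t * (2^-1 ^+ j * (1 + j%:R)) = (delta * t * (1 + j%:R)) * 2^-1 ^+ j); last by ring.
    rewrite ler_wpM2l//.
    rewrite exprMn invfM -exprVn -mulrA ler_piMr ?exprn_ge0//.
    rewrite mulrC ler_pdivrMr ?exprn_gt0// mul1r -natrX ler_nat; exact: cardK.
  rewrite -mulr_sumr sum_arith_geometric_half -mulrA ler_wpM2l//.
  rewrite mulrC ler_wpM2r// gerBl; apply: mulr_ge0 => //.
have h2 : `|\sum_(i < n) (rem (x i) - Ex rem)| <= delta * (B + m).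
  apply: (le_trans (ler_norm_sum _ _ _)).
  apply: (@le_trans _ _ (\sum_(i < n) delta * 2^-1 ^+ n * (B + m))).
    apply: ler_sum => i _; apply: (le_trans (ler_normB _ _)); rewrite mulrDr.
    apply: lerD => //; apply: (le_trans (ra (x i))).
    by rewrite ler_wpM2l ?mulr_ge0.
  rewrite sumr_const card_ord -[leLHS]mulr_natr.
  have Bm : 0 <= B + m by rewrite addr_ge0// (le_trans ler01).
  have -> : delta * 2^-1 ^+ n * (B + m) * n%:R = delta * (B + m) * (n%:R * 2^-1 ^+ n) by ring.
  by rewrite ler_piMr ?natr_half_le1// mulr_ge0.
rewrite -addrA mulrDr; exact: lerD.
Qed.

End localized.

(** * Deviation bound at a fixed precision *)

Section deviation.
Context d (T : measurableType d) (R : realType) (mu : probability T R).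
Variables (Env : T -> R) (m : R).
Hypothesis mEnv : measurable_fun setT Env.
Hypothesis Env1 : forall x, 1 <= Env x.
Hypothesis Env8 : (\int[mu]_x (Env x ^+ 8)%:E <= m%:E)%E.
Hypothesis m1 : 1 <= m.
Variables (K : nat -> finType) (D : nat) (psi : forall j, K j -> T -> R).
Hypothesis D0 : (0 < D)%N.
Hypothesis cardK : forall j, (#|K j| <= D ^ j)%N.
Hypothesis mpsi : forall j u, measurable_fun setT (@psi j u).
Hypothesis psi_le : forall j u x, `|@psi j u x| <= Env x.

Local Notation Ex g := (Rintegral mu setT g).

Let Env0 x : 0 <= Env x. Proof. exact: le_trans ler01 (Env1 x). Qed.

Definition standardized C (S : T -> R) := [/\ measurable_fun setT S,
  forall x, `|S x| <= C * Env x, Ex S = 0 & Ex (fun x => S x ^+ 2) = 1].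

(** Concavity lowers the scale from [sigma] to [eps], where [eps S] is at most 1/2 in absolute value
    on the truncation set and the logarithm has a quadratic bound; then [S] is exchanged for its
    representative [S']. *)
Lemma likelihood_le (n : nat) (B C eps delta sigma : R) (S S' : T -> R) (x : 'I_n -> T) :
  0 < eps -> eps < sigma -> 0 <= C -> 0 <= delta -> eps * C * B <= 1 / 2 ->
  (forall y, `|S y| <= C * Env y) -> (forall y, `|S y - S' y| <= delta * Env y) ->
  (forall i, Env (x i) <= B) -> (forall y, 0 < 1 + sigma * S y) ->
  0 <= \sum_(i < n) ln (1 + sigma * S (x i)) ->
  0 <= \sum_(i < n) penalized Env eps delta S' (x i) + eps * \sum_(i < n) (S (x i) - S' (x i)).
Proof.
move=> e0 es C0 dl0 eCB SC SS' xB S0 /(ler_wpM2l (ltW (divr_gt0 e0 (lt_trans e0 es)))).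
rewrite mulr0 => /le_trans; apply; rewrite !mulr_sumr -big_split /=.
apply: ler_sum => i _; set y := x i.
have s0 : 0 < sigma by exact: lt_trans es.
have l01 : 0 <= eps / sigma <= 1.
  by rewrite divr_ge0 ?(ltW e0) ?(ltW s0)// ler_pdivrMr// mul1r ltW.
apply: (le_trans (ln_concave_scale l01 (S0 y))).
rewrite mulrA divfK ?gt_eqF//.
have eS : `|eps * S y| <= 1 / 2.
  apply: le_trans eCB; rewrite normrM (ger0_norm (ltW e0)) -mulrA ler_pM2l//.
  by rewrite (le_trans (SC y))// ler_wpM2l//; exact: xB.
have [eS1 eS2] : -1 < eps * S y /\ eps * S y <= 1 / 2.
  by move: eS; rewrite ler_norml => /andP[]; split; lra.
apply: (le_trans (ln1D_le_quadratic eS1 eS2)).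
rewrite /penalized.
have r2 := sqr_le_of_norm dl0 (Env0 y) (SS' y).
have h : S' y ^+ 2 / 2 - (S y - S' y) ^+ 2 <= S y ^+ 2.
  have := sqr_ge0 (S' y - 2 * (S' y - S y)).
  have -> : (S' y - 2 * (S' y - S y)) ^+ 2 = 2 * (S y ^+ 2 - (S' y ^+ 2 / 2 - (S y - S' y) ^+ 2)) by field.
  lra.
have := ler_wpM2l (sqr_ge0 eps) (le_trans (lerB (lexx (S' y ^+ 2 / 2)) r2) h).
have -> : (eps * S y) ^+ 2 = eps ^+ 2 * S y ^+ 2 by ring.
have -> : eps ^+ 2 * (S' y ^+ 2 / 2 - delta ^+ 2 * Env y ^+ 2) =
   eps ^+ 2 / 10 * S' y ^+ 2 * 5 - eps ^+ 2 * delta ^+ 2 / 5 * Env y ^+ 2 * 5 by field.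
rewrite mulrBr; move: (eps ^+ 2 * S y ^+ 2) (eps ^+ 2 / 10 * S' y ^+ 2) (_ / 5 * _) (eps * S y) (eps * S' y).
move=> a b c e f; lra.
Qed.

(* The sum attached to a word of length [j] is compared with the threshold
   [resolution * (1 + j) * sqrt (n ln n)]; the factor [1 + j] makes the union
   bound over all words summable. *)
Definition resolution : R := 3 * (1 + m) ^+ 2 * m + 1.

(** Normalised by [precision * resolution = 1/800], so that the sum of the remainders stays below
    [n eps / 80] and, multiplied by [eps], uses at most half of the drift [n eps^2 / 40]. *)
Definition precision : R := (800 * resolution)^-1.

Let A1 : m <= resolution.
Proof.
have := m1 => m1'; rewrite /resolution ler_wpDr// -[leLHS]mul1r ler_wpM2r ?(le_trans ler01)//.
have : 1 <= (1 + m) ^+ 2 by rewrite exprn_ege1// lerDl (le_trans ler01).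
lra.
Qed.

Let A0 : 0 < resolution.
Proof. exact: lt_le_trans (lt_le_trans ltr01 m1) A1. Qed.

Let precision_gt0 : 0 < precision.
Proof. by rewrite /precision invr_gt0; apply: mulr_gt0; rewrite ?ltr0n. Qed.

Let precisionA : precision * resolution = 800^-1.
Proof. by rewrite /precision invfM divfK// gt_eqF. Qed.

Let precision_le : precision * m <= 800^-1.
Proof. by rewrite -precisionA ler_wpM2l// ltW. Qed.

Let precision_le1 : precision <= 800^-1.
Proof. by apply: le_trans precision_le; rewrite ler_peMr// ltW. Qed.

Variables (I : finType) (C w : R) (Sc : I -> T -> R).
Hypothesis C1 : 1 <= C.
Hypothesis w1 : 1 <= w.
Hypothesis std_Sc : forall c, standardized C (Sc c).

Context d1 (Omega : measurableType d1) (P : probability Omega R) (n : nat).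
Variable X : 'I_n -> {RV P >-> T}.
Hypothesis lawX : forall i A, measurable A -> P (X i @^-1` A) = mu A.
Hypothesis indX : forall A : 'I_n -> set T, (forall i, measurable (A i)) ->
  P [set w | forall i, A i (X i w)] = (\prod_(i < n) P (X i @^-1` A i))%E.

(** A crude threshold from which all smallness conditions of the Laplace and union bounds follow at
    once. *)
Definition sample_size_bound : R := 1000 * w * C ^+ 2 * (1 + m) + 2 * D%:R.

Lemma sample_conditions (B q eps : R) : B = Num.sqrt (Num.sqrt n%:R) ->
  q = Num.sqrt (ln n%:R / n%:R) -> eps = w * q -> 4 * sample_size_bound ^+ 2 <= B ->
  [/\ [/\ n%:R = B ^+ 4, 1 <= B, B <= n%:R * q, m <= B & 2 * D%:R <= n%:R :> R],
      [/\ 0 < q, 1 <= ln (n%:R : R), q ^+ 2 * n%:R = ln n%:R & q * (1 + m) * B <= 1 / 2] &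
      [/\ eps * C * B <= 1 / 2, 1000 * C * m <= B ^+ 4 * eps, 10 * C ^+ 2 * m <= B ^+ 4 &
          2 * eps ^+ 2 * C ^+ 4 * m <= 1]].
Proof.
move=> BE qE epsE; set N0 := sample_size_bound; move=> nB.
have w0 : 0 < w := lt_le_trans ltr01 w1.
have C0 : 0 < C := lt_le_trans ltr01 C1.
have m0 : 0 < m := lt_le_trans ltr01 m1.
have CC : C <= C ^+ 2 by rewrite expr2 ler_peMl// ltW.
have C21 : 1 <= C ^+ 2 by rewrite exprn_ege1.
have D1 : 1 <= D%:R :> R by rewrite ler1n.
have wC : 1 <= w * C ^+ 2 by rewrite mulr_ege1.
have [k kE] : exists k : R, k = 1000 by exists 1000.
have k0 : 0 < k by lra.
have N0E : N0 = k * (w * C ^+ 2 * (1 + m)) + 2 * D%:R by rewrite /N0 /sample_size_bound -kE; ring.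
have N0m : k * (1 + m) + 2 * D%:R <= N0.
  by rewrite N0E lerD2r ler_pM2l// ler_peMl// addr_ge0// ltW.
have N0lin : 10 * m + 10 + 2 * D%:R <= N0 by have := m1; move: N0m; rewrite kE; lra.
have N01 : 1 <= N0 by have := m1; lra.
have N0wC : k * (w * C ^+ 2) <= N0.
  rewrite N0E ler_wpDr ?mulr_ge0// ler_pM2l// ler_peMr ?lerDl ?(ltW m0)//.
  by rewrite mulr_ge0 ?(ltW w0) ?sqr_ge0.
have N0wC10 : 10 * (w * C ^+ 2) <= N0.
  by apply: le_trans N0wC; rewrite ler_wpM2r ?(le_trans ler01)// kE; lra.
have [nE NB L1 q0 [q2 NqB Bnq]] := large_sample BE qE N01 nB.
have B1 : 1 <= B by exact: le_trans NB.
have B0 : 0 < B by exact: lt_le_trans ltr01 B1.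
have n0 : 0 < n%:R :> R by rewrite nE exprn_gt0.
have e0 : 0 < eps by rewrite epsE; exact: mulr_gt0.
have BnqB : B <= n%:R * q by apply: le_trans Bnq; rewrite expr2 ler_peMl// ltW.
have qeps : q <= eps by rewrite epsE ler_peMl// ltW.
have nq_eps : n%:R * q <= n%:R * eps by rewrite ler_pM2l.
have qB0 : 0 < q * B by exact: mulr_gt0.
have Nle (a : R) : a <= N0 -> a * (q * B) <= 1.
  by move=> aN; apply: le_trans NqB; rewrite -mulrA ler_wpM2r// ltW.
have m0' := ltW m0.
have eCB : eps * C * B <= 1 / 2.
  have h : w * C <= w * C ^+ 2 by rewrite ler_pM2l.
  have : 2 * (w * C) <= N0.
    have : 0 <= w * C by rewrite mulr_ge0 ?ltW.
    by lra.
  move/Nle; have -> : eps * C * B = w * C * (q * B) by rewrite epsE; ring.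
  rewrite -[in X in X -> _]mulrA; lra.
have CmB : 1000 * C * m <= B ^+ 4 * eps.
  rewrite -nE; apply: le_trans nq_eps; apply: le_trans BnqB; apply: le_trans NB.
  rewrite N0E ler_wpDr ?mulr_ge0//.
  rewrite -kE -[leLHS]mulrA.
  rewrite ler_pM2l//; apply: ler_pM; [exact: ltW|exact: ltW| |by rewrite lerDr].
  by apply: le_trans CC _; rewrite ler_peMl ?sqr_ge0.
have B4 : B <= B ^+ 4.
  by rewrite exprS ler_peMr ?exprn_ege1// ltW.
have C2mB : 10 * C ^+ 2 * m <= B ^+ 4.
  apply: le_trans B4; apply: le_trans NB.
  rewrite N0E ler_wpDr ?mulr_ge0//.
  have h : C ^+ 2 * m <= w * C ^+ 2 * (1 + m).
    apply: ler_pM; [exact: sqr_ge0|exact: ltW| |by rewrite lerDr].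
    by rewrite ler_peMl ?sqr_ge0.
  have : 0 <= C ^+ 2 * m by rewrite mulr_ge0 ?sqr_ge0.
  have -> : 10 * C ^+ 2 * m = 10 * (C ^+ 2 * m) by ring.
  by rewrite kE; lra.
have eCm : 2 * eps ^+ 2 * C ^+ 4 * m <= 1.
  pose z := w * C ^+ 2 * q.
  have z0 : 0 <= z by rewrite !mulr_ge0 ?sqr_ge0 ?ltW.
  have h1 : z * (2 * m) <= 1.
    have : w * C ^+ 2 * (2 * m) <= N0.
      rewrite N0E ler_wpDr ?mulr_ge0//.
      have : w * C ^+ 2 * (2 * m) <= 2 * (w * C ^+ 2 * (1 + m)).
        by move: (le_trans ler01 wC); move: (w * C ^+ 2) => y y0; lra.
      have : 0 <= w * C ^+ 2 * (1 + m).
        by rewrite !mulr_ge0 ?sqr_ge0 ?addr_ge0 ?ltW.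
      by rewrite kE; lra.
    move/Nle; apply: le_trans.
    have -> : z * (2 * m) = w * C ^+ 2 * (2 * m) * q by rewrite /z; ring.
    have q1 : q <= q * B by rewrite ler_peMr// ltW.
    apply: ler_wpM2l q1; apply: mulr_ge0; last by lra.
    by rewrite mulr_ge0 ?sqr_ge0 ?ltW.
  have h2 : z <= 1.
    by apply: le_trans h1; rewrite ler_peMr//; have := m1; lra.
  have -> : 2 * eps ^+ 2 * C ^+ 4 * m = z * (z * (2 * m)) by rewrite /z epsE; ring.
  by rewrite mulr_ile1// mulr_ge0// mulr_ge0.
have qmB : q * (1 + m) * B <= 1 / 2.
  have : 2 * (1 + m) <= N0 by lra.
  move/Nle; rewrite -mulrA; have -> : q * (1 + m) * B = (1 + m) * (q * B) by ring.
  by move: ((1 + m) * (q * B)) => z; lra.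
have nD : 2 * D%:R <= n%:R :> R.
  by rewrite nE; apply: le_trans B4; apply: le_trans NB; lra.
by split; split=> //; apply: le_trans NB; lra.
Qed.

Lemma localized_deviation (E : set Omega) :
  4 * sample_size_bound ^+ 2 <= Num.sqrt (Num.sqrt n%:R) ->
  (forall o, E o -> exists (S : T -> R) (c : I) (sigma : R),
    [/\ standardized C S,
        (forall x, `|S x - Sc c x| <= precision * Env x)
          /\ expandable Env D psi precision (fun x => S x - Sc c x),
        w * Num.sqrt (ln n%:R / n%:R) < sigma,
        forall x, 0 < 1 + sigma * S x &
        0 <= \sum_(i < n) ln (1 + sigma * S (X i o))]) ->
  ((P^*)%mu E <= ((#|I|%:R + 4 + m) * expR (- (ln n%:R / 80 / 200)))%:E)%E.
Proof.
set B := Num.sqrt (Num.sqrt n%:R); set q := Num.sqrt (ln n%:R / n%:R).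
move=> nB EE.
have [[nE B1 BnqB mB nD] [q0 L1 q2 qmB] [eCB CmB C2mB eCm]] :=
  sample_conditions (erefl B) (erefl q) (erefl (w * q)) nB.
set L := ln n%:R in L1 q2 *; set eps := w * q in EE eCB CmB eCm.
have w0 : 0 < w := lt_le_trans ltr01 w1.
have C0 : 0 < C := lt_le_trans ltr01 C1.
have m0 : 0 < m := lt_le_trans ltr01 m1.
have B0 : 0 < B by exact: lt_le_trans ltr01 B1.
have n0 : 0 < n%:R :> R by rewrite nE exprn_gt0.
have e0 : 0 < eps by exact: mulr_gt0.
have nq_eps : n%:R * q <= n%:R * eps by rewrite ler_pM2l// ler_peMl// ltW.
have m0' := ltW m0.
have dl01 : 0 <= precision <= 1.
  by rewrite (ltW precision_gt0)/=; have := precision_le1; lra.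
have dm : precision ^+ 2 * m <= 1 / 16.
  apply: (@le_trans _ _ (precision * m)); last by have := precision_le; lra.
  by rewrite ler_wpM2r// expr2 ler_piMr// ?(ltW precision_gt0)//; case/andP: dl01.
(* Two families of exponentials: one per representative, and one per sign and word of length less
   than [n], the order to which the remainders are expanded. *)
pose J := (I + {j : 'I_n & K j} * bool)%type.
pose cpsi (p : {j : 'I_n & K j}) (b : bool) x :=
  (-1) ^+ b * (psi (tagged p) x - Ex (psi (tagged p))).
pose g (c : J) x := match c with
  | inl c => 200^-1 * penalized Env eps precision (Sc c) x
  | inr (p, b) => q * cpsi p b x
  end.
pose v (c : J) := match c with
  | inl c => - (eps ^+ 2 / 40 / 200)
  | inr _ => 3 * q ^+ 2 * (1 + m) ^+ 2 * m
  end.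
(* The threshold of a representative leaves half of its drift as a margin for the remainder. *)
pose a (c : J) := match c with
  | inl c => - (n%:R * eps ^+ 2 / 80 / 200)
  | inr (p, b) => L * resolution * (1 + (tag p)%:R)
  end.
have dpsi j u : dominated Env (@psi j u).
  by apply: (dominated_pow mEnv Env1 (isT : 1 <= 8)%N (c := 1)) => // x; rewrite mul1r.
have mcpsi p b : measurable_fun setT (cpsi p b).
  by apply: measurable_funM => //; exact: measurable_funB.
have Expsi j u : `|Ex (@psi j u)| <= m.
  have := @le_normr_Rintegral _ _ _ mu setT (@psi j u) measurableT (dominated_integrable mEnv Env1 Env8 (dpsi j u)).
  move=> /le_trans; apply; apply: (@le_trans _ _ (Ex (fun x => Env x ^+ 1))).
    apply: (Ex_le mEnv Env1 Env8) => [||x]; last by rewrite expr1.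
      apply: (dominated_pow mEnv Env1 (isT : 1 <= 8)%N (c := 1)) => // [|x].
        exact: measurableT_comp.
      by rewrite normr_id mul1r.
    exact: dominated_Env.
  by rewrite (Ex_Env mEnv Env1 Env8).
have mg c : measurable_fun setT (g c).
  case: c => [c|[p b]] /=; apply: measurable_funM => //.
  by apply: measurable_penalized => //; case: (std_Sc c).
have gv c : (\int[mu]_x (expR (g c x) * trunc Env B x)%:E <= (expR (v c))%:E)%E.
  case: c => [c|[p b]] /=.
    by have [mS SC S0 S1] := std_Sc c; apply: (penalized_laplace mEnv Env1 Env8 B1 mS C1).
  apply: (centered_laplace mEnv Env1 Env8 B1) => //.
  - by rewrite lerDl.
  - move=> x; rewrite /cpsi normrM normrX normrN1 expr1n mul1r.
    rewrite (le_trans (ler_normB _ _))// mulrDl mul1r lerD//.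
    by rewrite (le_trans (Expsi _ _))// ler_peMr.
  - rewrite (ExZ mEnv Env1 Env8); last by apply: dominatedB => //; exact: dominated_cst.
    rewrite (ExB mEnv Env1 Env8)//; last exact: dominated_cst.
    by rewrite Ex_cst subrr mulr0.
  - by rewrite -nE; exact: le_trans BnqB.
have AE o : E o -> (forall i, Env (X i o) <= B) -> exists c, a c <= \sum_(i < n) g c (X i o).
  move=> /EE[S [c [sigma [[mS SC ES0 ES1] [SSc xSSc] es S0 lnS]]]] XB.
  have [mSc ScC ESc0 ESc1] := std_Sc c.
  (* If no word sum reaches its threshold, the remainder is small and the penalised sum of the
     representative must be at least [- n eps^2 / 80]. *)
  case: (pselect (exists p b, a (inr (p, b)) <= \sum_(i < n) g (inr (p, b)) (X i o))).
    by move=> [p [b h]]; exists (inr (p, b)).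
  move=> nex; exists (inl c) => /=; rewrite -mulr_sumr [leRHS]mulrC -[leLHS]mulNr.
  rewrite ler_pM2r ?invr_gt0//.
  have dl0 := ltW precision_gt0.
  have := likelihood_le e0 es (ltW C0) dl0 eCB SC SSc XB S0 lnS.
  set U := \sum_(i < n) penalized _ _ _ _ _; set r := \sum_(i < n) _.
  suff : `|r| <= n%:R * eps / 80.
    move=> /(le_trans (ler_norm _)) /(ler_wpM2l (ltW e0)).
    have -> : eps * (n%:R * eps / 80) = n%:R * eps ^+ 2 / 80 by field.
    by lra.
  pose t := n%:R * q * resolution.
  have nq0 : 0 <= n%:R * q by rewrite mulr_ge0 ?ltW.
  have t0 : 0 <= t := mulr_ge0 nq0 (ltW A0).
  have mr : measurable_fun setT (fun x => S x - Sc c x) by exact: measurable_funB.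
  have dS (f : T -> R) : measurable_fun setT f -> (forall x, `|f x| <= C * Env x) -> dominated Env f.
    by move=> mf fC; apply: (dominated_pow mEnv Env1 (isT : 1 <= 8)%N (c := C)).
  have r0 : Ex (fun x => S x - Sc c x) = 0.
    by rewrite (ExB mEnv Env1 Env8) ?ES0 ?ESc0 ?subrr//; exact: dS.
  have ut (j : 'I_n) (u : K j) :
      `|\sum_(i < n) (psi u (X i o) - Ex (psi u))| <= t * (1 + j%:R).
    set z := \sum_(i < n) _.
    have zb b : \sum_(i < n) g (inr (Tagged (fun j : 'I_n => K j) u, b)) (X i o) = q * ((-1) ^+ b * z).
      by rewrite /z !mulr_sumr; apply: eq_bigr.
    have h (b : bool) : (-1) ^+ b * z <= t * (1 + j%:R).
      rewrite leNgt; apply/negP => h; apply: nex.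
      exists (Tagged (fun j : 'I_n => K j) u), b; rewrite zb /=.
      rewrite -q2; have -> : q ^+ 2 * n%:R * resolution * (1 + j%:R) = q * (t * (1 + j%:R)).
        by rewrite /t; ring.
      by rewrite ler_pM2l// ltW.
    rewrite ler_norml; have := h true; have := h false.
    by rewrite expr0 expr1 mul1r mulN1r lerNl => -> ->.
  have := expandable_sum_le mEnv Env1 Env8 m1 D0 cardK mpsi psi_le dl0 t0 (ltW B0) mr r0 xSSc XB ut.
  move=> /le_trans; apply.
  have -> : precision * (4 * t + B + m) =
    4 * (precision * resolution) * (n%:R * q) + precision * (B + m) by rewrite /t; ring.
  rewrite precisionA.
  have : precision * (B + m) <= 800^-1 * (n%:R * q + n%:R * q).
    apply: ler_pM => //; first by rewrite addr_ge0// ltW.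
    by apply: lerD => //; exact: le_trans BnqB.
  by lra.
apply: (le_trans (chernoff_union mEnv Env1 Env8 B0 lawX indX mg gv AE)).
rewrite lee_fin.
have n_inv : expR (- L) = n%:R^-1 by rewrite expRN lnK// posrE.
set X0 := expR (- (L / 80 / 200)).
have cL : n%:R^-1 <= X0 by rewrite -n_inv ler_expR; lra.
rewrite 2!mulrDl lerD//; last first.
  rewrite -(_ : m * n%:R^-1 = n%:R * (m / B ^+ 8)); first by rewrite ler_pM2l.
  have -> : B ^+ 8 = (B ^+ 4) ^+ 2 by rewrite -exprM.
  by rewrite -nE; field; rewrite gt_eqF.
rewrite big_sumType /= lerD//.
  rewrite sumr_const -[leLHS]mulr_natl ler_wpM2l// ler_expR.
  have -> : n%:R * - (eps ^+ 2 / 40 / 200) - - (n%:R * eps ^+ 2 / 80 / 200) =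
    - (w ^+ 2 * (q ^+ 2 * n%:R) / 80 / 200) by rewrite /eps; field.
  rewrite q2 lerN2 !ler_pM2r ?invr_gt0// ler_peMl ?exprn_ege1//.
  exact: le_trans L1.
pose h (j : nat) := 2 * (n%:R^-1 * n%:R^-1 ^+ j) : R.
apply: (@le_trans _ _ (\sum_(j < n) \sum_(u : K j) h j)).
  have -> : \sum_(j < n) \sum_(u : K j) h j = \sum_(p : {j : 'I_n & K j}) h (tag p).
    by rewrite (@sig_big_dep _ _ _ 'I_n (fun j => K j) xpredT (fun _ _ => true) (fun j _ => h j)).
  pose F (p : {j : 'I_n & K j}) (b : bool) := expR (n%:R * (3 * q ^+ 2 * (1 + m) ^+ 2 * m)
     - L * resolution * (1 + (tag p)%:R)).
  rewrite (_ : \sum_i _ = \sum_p \sum_b F p b); last first.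
    by rewrite pair_bigA; apply: eq_bigr => -[p b].
  apply: ler_sum => p _; rewrite /F /h sumr_const card_bool -[leLHS]mulr_natl ler_pM2l//.
  (* [resolution] is chosen so that the Chernoff exponent is [- L] for the empty word, with a
     further [- L * resolution] for each letter. *)
  have -> : n%:R * (3 * q ^+ 2 * (1 + m) ^+ 2 * m) - L * resolution * (1 + (tag p)%:R) =
     - L - L * resolution * (tag p)%:R by rewrite -q2 /resolution; ring.
  rewrite expRD n_inv ler_pM2l ?invr_gt0// -n_inv -expRM_natr ler_expR mulNr lerN2.
  rewrite ler_wpM2r// ler_peMr ?(le_trans ler01)//; exact: le_trans A1.
(* [h j] carries [n^-j] against at most [D ^ j] words, and [2 * D <= n] leaves a geometric
   series. *)
apply: (@le_trans _ _ (\sum_(j < n) 2 * n%:R^-1 * 2^-1 ^+ j)).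
  apply: ler_sum => j _; rewrite sumr_const -[leLHS]mulr_natr /h mulrA -[leLHS]mulrA ler_pM2l; last first.
    by rewrite mulr_gt0// invr_gt0.
  apply: (@le_trans _ _ (n%:R^-1 ^+ j * D%:R ^+ j)).
    by rewrite ler_wpM2l ?exprn_ge0 ?invr_ge0// -natrX ler_nat.
  rewrite -exprMn lerXn2r ?nnegrE ?mulr_ge0 ?invr_ge0// mulrC ler_pdivrMr//.
  lra.
rewrite -mulr_sumr sum_geometric_half; apply: (@le_trans _ _ (4 * n%:R^-1)); last by rewrite ler_pM2l.
have -> : 4 * n%:R^-1 = 2 * n%:R^-1 * 2 :> R by ring.
rewrite ler_pM2l ?mulr_gt0 ?invr_gt0// gerBl mulr_ge0// exprn_ge0//.
Qed.

End deviation.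

(** * Scores of finite mixtures *)

Section node_recurrence.
Variable R : realFieldType.

(** The coefficients are those of the monic polynomial with roots in [s], moved to the other side;
    multiplication by ['X - t%:P] enlarges their absolute sum by a factor of at most [1 + |t|]. *)
Lemma node_recurrence (rad : R) (s : seq R) : (forall t, t \in s -> `|t| <= rad) ->
  exists2 c : nat -> R, \sum_(k < size s) `|c k| <= (1 + rad) ^+ size s &
    forall t, t \in s -> t ^+ size s = \sum_(k < size s) c k * t ^+ k.
Proof.
move=> srad; pose p : {poly R} := \prod_(t <- s) ('X - t%:P).
have sp : size p = (size s).+1 by rewrite size_prod_XsubC.
have pl : p`_(size s) = 1.
  by have := monic_prod_XsubC s xpredT id; rewrite monicE lead_coefE -/p sp => /eqP.
have np : \sum_(k < (size s).+1) `|p`_k| <= (1 + rad) ^+ size s.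
  rewrite /p; elim: s srad {p sp pl} => [|t s IH] srad.
    by rewrite big_nil big_ord1 coef1 normr1.
  have t0 : 0 <= `|t| by [].
  have tr : `|t| <= rad by rewrite srad ?mem_head.
  rewrite big_cons /= exprS; set q := \prod_(j <- s) _ in IH *.
  have {}IH : \sum_(k < (size s).+1) `|q`_k| <= (1 + rad) ^+ size s.
    by apply: IH => u us; rewrite srad// in_cons us orbT.
  have sq : size q = (size s).+1 by rewrite size_prod_XsubC.
  apply: (@le_trans _ _ ((1 + `|t|) * \sum_(k < (size s).+1) `|q`_k|)); last first.
    apply: ler_pM; [exact: addr_ge0|exact: sumr_ge0|by rewrite lerD2l|exact: IH].
  rewrite [leRHS]mulrDl mul1r.
  have -> : \sum_(k < (size s).+1) `|q`_k| + `|t| * \sum_(k < (size s).+1) `|q`_k| =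
     \sum_(k < (size s).+2) (`|('X * q)`_k| + `|t * q`_k|).
    rewrite big_split /= [X in _ = X + _]big_ord_recl /= coefXM eqxx normr0 add0r.
    congr (_ + _); first by apply: eq_bigr => k _; rewrite coefXM.
    rewrite [RHS]big_ord_recr /= (_ : q`_(size s).+1 = 0) ?mulr0 ?normr0 ?addr0; last first.
      by rewrite nth_default// sq.
    by rewrite mulr_sumr; apply: eq_bigr => k _; rewrite normrM.
  apply: ler_sum => k _; rewrite mulrBl coefB coefCM; exact: ler_normB.
exists (fun k => - p`_k).
  apply: le_trans np; rewrite big_ord_recr /= ler_wpDr//.
  by apply: ler_sum => k _; rewrite normrN.
move=> t ts; have : root p t by rewrite root_prod_XsubC.
rewrite rootE horner_coef sp big_ord_recr /= pl mul1r addrC addr_eq0 => /eqP ->.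
by rewrite -sumrN; apply: eq_bigr => k _; rewrite mulNr.
Qed.

End node_recurrence.

(** * Signed measures controlled by finitely many moments *)

Section moment_bound.
Variables (R : realType) (d N : nat) (rad : R) (I : finType) (a : I -> 'rV[R]_d).
Hypothesis N0 : (0 < N)%N.
Hypothesis rad0 : 0 <= rad.
Hypothesis cardI : (#|I| <= N)%N.
Hypothesis a_rad : forall i l, `|a i ord0 l| <= rad.
Local Notation E := 'rV[R]_d.
Implicit Types (g : E -> R) (wt : I -> R) (c : R).

Definition pw (b : {ffun 'I_d -> 'I_N}) (theta : E) : R := \prod_l theta ord0 l ^+ b l.

Definition pair wt g : R := \sum_i wt i * g (a i).

Definition moments_le wt c := forall b, `|pair wt (pw b)| <= c.

(* Multiplication by [g] has norm at most [K] on the signed measures carried by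
   the nodes, where a measure is normed by its mixed moments of degree less than
   [N] in each coordinate. *)
Definition opb g K := forall wt c, moments_le wt c -> moments_le (fun i => wt i * g (a i)) (K * c).

Lemma moments_le_ge0 wt c : moments_le wt c -> 0 <= c.
Proof. by move=> /(_ [ffun=> Ordinal N0]); exact: le_trans. Qed.

Lemma opb_ext g h K : g =1 h -> opb g K -> opb h K.
Proof.
move=> gh gK wt c wc b; have := gK wt c wc b.
by congr (`|_| <= _); apply: eq_bigr => i _; rewrite gh.
Qed.

Lemma opb_le g K L : K <= L -> opb g K -> opb g L.
Proof.
move=> KL gK wt c wc b; apply: le_trans (gK wt c wc b) _.
by rewrite ler_wpM2r// (moments_le_ge0 wc).
Qed.

Lemma opb_cst c : opb (fun=> c) `|c|.
Proof.
move=> wt e we b; have -> : pair (fun i => wt i * c) (pw b) = c * pair wt (pw b).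
  by rewrite /pair mulr_sumr; apply: eq_bigr => i _; ring.
by rewrite normrM ler_wpM2l.
Qed.

Lemma opbM g h K L : opb g K -> opb h L -> opb (fun t => g t * h t) (K * L).
Proof.
move=> gK hL wt c wc b; have := gK _ _ (hL _ _ wc) b.
by rewrite mulrA; congr (`|_| <= _); apply: eq_bigr => i _; ring.
Qed.

Lemma opbD g h K L : opb g K -> opb h L -> opb (fun t => g t + h t) (K + L).
Proof.
move=> gK hL wt c wc b.
have -> : pair (fun i => wt i * (g (a i) + h (a i))) (pw b) =
   pair (fun i => wt i * g (a i)) (pw b) + pair (fun i => wt i * h (a i)) (pw b).
  by rewrite /pair -big_split; apply: eq_bigr => i _; rewrite /=; ring.
rewrite mulrDl (le_trans (ler_normD _ _))// lerD//; [exact: gK|exact: hL].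
Qed.

Lemma opb_sum (J : Type) (s : seq J) (g : J -> E -> R) (K : J -> R) :
  (forall j, opb (g j) (K j)) -> opb (fun t => \sum_(j <- s) g j t) (\sum_(j <- s) K j).
Proof.
move=> gK; elim: s => [|j s IH].
  rewrite big_nil; have := opb_cst 0; rewrite normr0.
  by apply: opb_ext => t; rewrite big_nil.
by rewrite big_cons; apply: opb_ext (opbD (gK j) IH) => t; rewrite big_cons.
Qed.

Lemma opb_prod (J : Type) (s : seq J) (g : J -> E -> R) (K : J -> R) :
  (forall j, opb (g j) (K j)) -> opb (fun t => \prod_(j <- s) g j t) (\prod_(j <- s) K j).
Proof.
move=> gK; elim: s => [|j s IH].
  rewrite big_nil; have := opb_cst 1; rewrite normr1.
  by apply: opb_ext => t; rewrite big_nil.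
by rewrite big_cons; apply: opb_ext (opbM (gK j) IH) => t; rewrite big_cons.
Qed.

Lemma opbX n g K : opb g K -> opb (fun t => g t ^+ n) (K ^+ n).
Proof.
move=> gK; have := @opb_prod _ (index_enum 'I_n) (fun=> g) (fun=> K) (fun=> gK).
rewrite prodr_const card_ord; apply: opb_ext => t.
by rewrite prodr_const card_ord.
Qed.

(** The measures have finitely many atoms and the bound is uniform in [n], so pointwise convergence
    is enough; this gives access to the exponential series. *)
Lemma opb_lim (u : nat -> E -> R) g K :
  (forall t, u n t @[n --> \oo] --> g t) -> (forall n, opb (u n) K) -> opb g K.
Proof.
move=> ug uK wt c wc b.
have cv : pair (fun i => wt i * u n (a i)) (pw b) @[n --> \oo] -->
    pair (fun i => wt i * g (a i)) (pw b).
  apply: cvg_big => [|i _]; first exact: add_continuous.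
  by apply: cvgMl; apply: cvgMr; exact: ug.
have cvn : `|pair (fun i => wt i * u n (a i)) (pw b)| @[n --> \oo] --> `|pair (fun i => wt i * g (a i)) (pw b)|.
  exact: cvg_norm.
rewrite -(cvg_lim (@Rhausdorff R) cvn); apply: limr_le; first by apply/cvg_ex; eexists; exact: cvn.
by apply: nearW => n; exact: uK.
Qed.

Definition node_bound : R := (1 + rad) ^+ N.

(** Multiplication by a coordinate raises one exponent. If it stays below [N], the result is again
    one of the controlled moments; if it reaches [N], the recurrence at the nodes rewrites it in
    smaller powers, with coefficients of absolute sum at most [node_bound]. *)
Lemma opb_coord l : opb (fun t : E => t ord0 l) node_bound.
Proof.
(* Zeros pad the list of coordinates to length exactly [N], so that the recurrence has degree
   [N]. *)
pose s := [seq a i ord0 l | i <- enum I] ++ nseq (N - #|I|) 0.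
have ss : size s = N by rewrite size_cat size_map size_nseq -cardE subnKC.
have srad t : t \in s -> `|t| <= rad.
  rewrite mem_cat => /orP[/mapP[i _ ->]//|]; by rewrite mem_nseq => /andP[_ /eqP ->]; rewrite normr0.
have [p pN ps] := node_recurrence srad; rewrite ss in pN ps.
move=> wt c wc b; have c0 := moments_le_ge0 wc.
pose rest (t : E) : R := \prod_(j | j != l) t ord0 j ^+ b j.
pose upd (k : 'I_N) : {ffun 'I_d -> 'I_N} := [ffun j => if j == l then k else b j].
have updE k t : pw (upd k) t = t ord0 l ^+ k * rest t.
  rewrite /pw (bigD1 l)//= ffunE eqxx; congr (_ * _).
  by apply: eq_bigr => j /negPf jl; rewrite ffunE jl.
have pE : pair (fun i => wt i * a i ord0 l) (pw b) = \sum_i wt i * (a i ord0 l ^+ (b l).+1 * rest (a i)).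
  apply: eq_bigr => i _; rewrite /pw (bigD1 l)//= exprS; rewrite /rest; ring.
rewrite pE; have [bN|] := ltnP (b l).+1 N.
  have := wc (upd (Ordinal bN)).
  have -> : pair wt (pw (upd (Ordinal bN))) = \sum_i wt i * (a i ord0 l ^+ (b l).+1 * rest (a i)).
    by apply: eq_bigr => i _; rewrite updE.
  move=> /le_trans; apply; rewrite ler_peMl// exprn_ege1// lerDl//.
rewrite leq_eqVlt ltnNge ltn_ord orbF => /eqP bN.
rewrite -bN.
have -> : \sum_i wt i * (a i ord0 l ^+ N * rest (a i)) = \sum_(k < N) p k * pair wt (pw (upd k)).
  rewrite /pair; under [RHS]eq_bigr do rewrite mulr_sumr.
  rewrite exchange_big /=; apply: eq_bigr => i _.
  rewrite ps; last first.
    by rewrite mem_cat; apply/orP; left; apply/mapP; exists i => //; rewrite mem_enum.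
  by rewrite mulr_suml mulr_sumr; apply: eq_bigr => k _; rewrite updE; ring.
apply: le_trans (ler_norm_sum _ _ _) _.
apply: (@le_trans _ _ (\sum_(k < N) `|p k| * c)).
  by apply: ler_sum => k _; rewrite normrM ler_wpM2l.
by rewrite -mulr_suml ler_wpM2r.
Qed.

(** For [j >= J], [K^j / j! <= 2^-J (2 K)^j / j!], and the right-hand sides sum to at most
    [2^-J expR (2 K)]; the bound passes from the partial sums to the limit. *)
Lemma opb_expR_remainder g K J : 0 <= K -> opb g K ->
  opb (fun t : E => expR (g t) - \sum_(j < J) g t ^+ j / j`!%:R) (2^-1 ^+ J * expR (2 * K)).
Proof.
move=> K0 gK.
apply: (@opb_lim (fun n t => \sum_(J <= j < n + J) g t ^+ j / j`!%:R)).
  move=> t.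
  have cv : series (exp_coeff (g t)) (n + J)%N @[n --> \oo] --> expR (g t).
    by rewrite (cvg_shiftn J); exact: is_cvg_series_exp_coeff.
  have -> : (fun n => \sum_(J <= j < n + J) g t ^+ j / j`!%:R) =
      (fun n => series (exp_coeff (g t)) (n + J)%N - \sum_(j < J) g t ^+ j / j`!%:R).
    apply/funext => n; rewrite /series /= [X in _ = X - _](@big_cat_nat _ _ _ J)//= ?leq_addl//.
    by rewrite [X in _ = X + _ - _]big_mkord [RHS]addrC addKr.
  by apply: cvgB => //; exact: cvg_cst.
move=> n.
have gj j : opb (fun t => g t ^+ j / j`!%:R) (K ^+ j / j`!%:R).
  have := opbM (opbX j gK) (opb_cst j`!%:R^-1).
  by rewrite ger0_norm// invr_ge0.
apply: opb_le (opb_sum (index_iota J (n + J)) gj).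
have K20 : 0 <= 2 * K by rewrite mulr_ge0.
apply: (@le_trans _ _ (2^-1 ^+ J * \sum_(J <= j < n + J) (2 * K) ^+ j / j`!%:R)).
  rewrite mulr_sumr !big_seq; apply: ler_sum => j.
  rewrite mem_index_iota => /andP[Jj _].
  have -> : 2^-1 ^+ J * ((2 * K) ^+ j / j`!%:R) = (2^-1 ^+ J * 2 ^+ j) * (K ^+ j / j`!%:R).
    by rewrite exprMn; ring.
  rewrite ler_peMl//; first by rewrite mulr_ge0 ?exprn_ge0// invr_ge0.
  by rewrite -(subnKC Jj) exprD mulrA -exprMn mulVf// expr1n mul1r exprn_ege1// ler1n.
rewrite ler_wpM2l ?exprn_ge0//.
apply: (@le_trans _ _ (series (exp_coeff (2 * K)) (n + J)%N)).
  rewrite /series /= [leRHS](@big_cat_nat _ _ _ J)//= ?leq_addl// lerDr.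
  by apply: sumr_ge0 => j _; exact: exp_coeff_ge0.
apply: nondecreasing_cvgn_le; last exact: is_cvg_series_exp_coeff.
by apply: nondecreasing_series => j _ _; exact: exp_coeff_ge0.
Qed.

Lemma opb_expR g K : 0 <= K -> opb g K -> opb (fun t => expR (g t)) (expR (2 * K)).
Proof.
move=> K0 gK; have := opb_expR_remainder 0 K0 gK.
by rewrite expr0 mul1r; apply: opb_ext => t; rewrite big_ord0 subr0.
Qed.

Lemma opb_pair_le g K wt c : opb g K -> moments_le wt c -> `|pair wt g| <= K * c.
Proof.
move=> gK wc; have := gK _ _ wc [ffun=> Ordinal N0].
congr (`|_| <= _); apply: eq_bigr => i _.
by rewrite /pw big1 ?mulr1// => l _; rewrite ffunE expr0.
Qed.

End moment_bound.

Lemma exp_coeff_le_expR (R : realType) (x : R) n : 0 <= x -> x ^+ n / n`!%:R <= expR x.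
Proof.
move=> x0; apply: (@le_trans _ _ (series (exp_coeff x) n.+1)).
  rewrite /series /= big_nat_recr//= lerDr.
  by apply: sumr_ge0 => i _; exact: exp_coeff_ge0.
apply: nondecreasing_cvgn_le; last exact: is_cvg_series_exp_coeff.
by apply: nondecreasing_series => j _ _; exact: exp_coeff_ge0.
Qed.

(** * Expansion of scores into words *)

Section score_expansion.
Variables (R : realType) (d : nat) (S : 'M[R]_d).
Hypothesis pdS : posdef S.
Hypothesis d0 : (0 < d)%N.
Variables (rad : R) (N : nat).
Hypothesis rad0 : 0 < rad.
Hypothesis N0 : (0 < N)%N.
Local Notation E := 'rV[R]_d.
Local Notation A := (invmx S).
Local Notation M := (node_bound N rad).
Implicit Types (x theta : E) (G : mixing R d).

(** Rate of a two-sided bound on the logarithm of every mixture ratio with atoms in the ball. *)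
Definition ratio_rate : R := mxsum A * (d%:R * rad) ^+ 2 + mxsum A * (d%:R * rad).

(** [ratio_rate] pays for dividing by the ratio of the true mixture; the second term is [2 d M], the
    weight given to a letter of a word, times the constant [d * mxsum A] that bounds the dual
    norm. *)
Definition envelope_rate : R := ratio_rate + 2 * d%:R * M * (d%:R * mxsum A).

Definition envelope x : R := expR (envelope_rate * (1 + l1norm x)).

Let mxsum_ge0 : 0 <= mxsum A.
Proof. by apply: sumr_ge0 => i _; exact: sumr_ge0. Qed.

Let M1 : 1 <= M.
Proof. by rewrite exprn_ege1// lerDl ltW. Qed.

Let dr : 0 <= d%:R * rad.
Proof. by rewrite mulr_ge0// ltW. Qed.

Lemma ratio_rate_ge0 : 0 <= ratio_rate.
Proof. by rewrite addr_ge0// mulr_ge0// ?sqr_ge0. Qed.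

Lemma envelope_rate_ge0 : 0 <= envelope_rate.
Proof.
have := ratio_rate_ge0; rewrite /envelope_rate => r0.
by rewrite addr_ge0// !mulr_ge0// (le_trans ler01).
Qed.

Lemma l1norm_ball theta : enorm theta <= rad -> l1norm theta <= d%:R * rad.
Proof. by move=> tr; rewrite (le_trans (l1norm_le_enorm theta))// ler_wpM2l. Qed.

Lemma bform_le theta : bform A theta theta <= mxsum A * l1norm theta ^+ 2.
Proof.
rewrite bformE expr2 mulrA [X in _ * X]/l1norm mulr_sumr; apply: ler_sum => l _.
by rewrite (le_trans (ler_norm _))// normrM ler_wpM2r// normr_mulmx_le.
Qed.

Lemma tilt_exponent_ball theta x : enorm theta <= rad ->
  `|tilt_exponent S theta x| <= ratio_rate * (1 + l1norm x).
Proof.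
move=> tr; have l1 := l1norm_ball tr; have lx := l1norm_ge0 x; have lt := l1norm_ge0 theta.
apply: (le_trans (tilt_exponent_le pdS theta x)).
have b1 : bform A theta theta / 2 <= mxsum A * (d%:R * rad) ^+ 2.
  apply: (@le_trans _ _ (bform A theta theta)).
    by have := bform_inv_ge0 pdS theta; lra.
  by apply: (le_trans (bform_le theta)); rewrite ler_wpM2l// lerXn2r.
have b2 : mxsum A * l1norm theta * l1norm x <= mxsum A * (d%:R * rad) * l1norm x.
  by rewrite ler_wpM2r// ler_wpM2l.
have p1 : 0 <= mxsum A * (d%:R * rad) ^+ 2 by rewrite mulr_ge0 ?sqr_ge0.
have p2 : 0 <= mxsum A * (d%:R * rad) by rewrite mulr_ge0.
have := mulr_ge0 p1 lx.
move: b1 b2.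
have -> : ratio_rate * (1 + l1norm x) = mxsum A * (d%:R * rad) ^+ 2 + mxsum A * (d%:R * rad)
  + mxsum A * (d%:R * rad) ^+ 2 * l1norm x + mxsum A * (d%:R * rad) * l1norm x.
  by rewrite /ratio_rate; ring.
by lra.
Qed.

Lemma mixture_ratio_lb G x : in_ball rad G ->
  expR (- (ratio_rate * (1 + l1norm x))) <= mixture_ratio S G x.
Proof.
move=> [aG w0 w1]; rewrite -[leLHS]mul1r -[X in X * expR _ <= _]w1 mulr_suml; apply: ler_sum => i _.
rewrite ler_wpM2l// ler_expR lerNl (le_trans _ (tilt_exponent_ball x (aG i)))//.
by rewrite -normrN ler_norm.
Qed.

Lemma mixture_ratio_ub G x : in_ball rad G ->
  mixture_ratio S G x <= expR (ratio_rate * (1 + l1norm x)).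
Proof.
move=> [aG w0 w1]; rewrite -[leRHS]mul1r -[X in _ <= X * expR _]w1 mulr_suml; apply: ler_sum => i _.
rewrite ler_wpM2l// ler_expR (le_trans _ (tilt_exponent_ball x (aG i)))//.
exact: ler_norm.
Qed.

Lemma mixture_ratio_gt0 G x : in_ball rad G -> 0 < mixture_ratio S G x.
Proof. by move=> /(mixture_ratio_lb x); apply: lt_le_trans; exact: expR_gt0. Qed.

Lemma inv_mixture_ratio_le G x : in_ball rad G ->
  (mixture_ratio S G x)^-1 <= expR (ratio_rate * (1 + l1norm x)).
Proof.
move=> GB; rewrite -[leRHS]invrK -expRN lef_pV2 ?posrE ?expR_gt0//.
  exact: mixture_ratio_lb.
exact: mixture_ratio_gt0.
Qed.

Lemma exp_growth_inv_mixture_ratio G : in_ball rad G ->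
  exp_growth (fun x => (mixture_ratio S G x)^-1).
Proof.
move=> GB; split.
  rewrite (_ : (fun x => _) = (fun x => expR (- ln (mixture_ratio S G x)))).
    apply: measurableT_comp => //; apply: measurableT_comp => //.
    apply: measurableT_comp; first exact: measurable_ln.
    by have [] := exp_growth_mixture_ratio pdS G.
  by apply/funext => x; rewrite expRN lnK// posrE mixture_ratio_gt0.
exists (expR ratio_rate), ratio_rate; split; [exact: expR_ge0|exact: ratio_rate_ge0|move=> x].
rewrite ger0_norm ?invr_ge0 ?(ltW (mixture_ratio_gt0 _ GB))// -expRD.
by rewrite (le_trans (inv_mixture_ratio_le x GB))// mulrDr mulr1.
Qed.

Lemma measurable_envelope : measurable_fun setT envelope.
Proof.
apply: measurableT_comp => //; apply: measurable_funM => //.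
by apply: measurable_funD => //; exact: measurable_l1norm.
Qed.

Lemma envelope_ge1 x : 1 <= envelope x.
Proof.
rewrite /envelope -expR0 ler_expR mulr_ge0 ?envelope_rate_ge0//.
by rewrite addr_ge0// l1norm_ge0.
Qed.

Lemma exp_growth_envelopeX k : exp_growth (fun x => envelope x ^+ k).
Proof.
apply: exp_growthX; apply: (exp_growth_expR (c := envelope_rate) (a := envelope_rate)).
- apply: measurable_funM => //.
  by apply: measurable_funD => //; exact: measurable_l1norm.
- exact: envelope_rate_ge0.
- by move=> x; rewrite mulrDr mulr1.
Qed.

Definition dual_norm x : R := \sum_l `|(x *m A) ord0 l|.

Lemma dual_norm_ge0 x : 0 <= dual_norm x. Proof. exact: sumr_ge0. Qed.

Lemma dual_norm_le x : dual_norm x <= d%:R * mxsum A * l1norm x.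
Proof.
apply: (@le_trans _ _ (\sum_(l < d) mxsum A * l1norm x)).
  by apply: ler_sum => l _; exact: normr_mulmx_le.
by rewrite sumr_const card_ord -[leLHS]mulr_natl mulrA.
Qed.

Lemma expR_dual_norm_le G x : in_ball rad G ->
  expR (2 * d%:R * M * dual_norm x) * (mixture_ratio S G x)^-1 <= envelope x.
Proof.
move=> GB; apply: (@le_trans _ _ (expR (2 * d%:R * M * dual_norm x) * expR (ratio_rate * (1 + l1norm x)))).
  by rewrite ler_wpM2l ?expR_ge0// inv_mixture_ratio_le.
rewrite -expRD ler_expR /envelope_rate [leRHS]mulrDl [leLHS]addrC lerD2l -[leRHS]mulrA.
have c0 : 0 <= 2 * d%:R * M by rewrite !mulr_ge0// (le_trans ler01).
rewrite ler_wpM2l// (le_trans (dual_norm_le x))// ler_wpM2l ?mulr_ge0//.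
by rewrite lerDr.
Qed.

(* The expansion of a score in these functions has coefficients at most
   [(2 d)^-j], which beats the number [d^j] of words of length [j]. *)
Definition word_fun G j (u : {ffun 'I_j -> 'I_d}) x : R :=
  (2 * d%:R * M) ^+ j * (\prod_i (x *m A) ord0 (u i)) / j`!%:R * (mixture_ratio S G x)^-1.

Lemma card_words j : (#|{ffun 'I_j -> 'I_d}| <= d ^ j)%N.
Proof. by rewrite card_ffun !card_ord. Qed.

Lemma measurable_word_fun G j u : in_ball rad G -> measurable_fun setT (@word_fun G j u).
Proof.
move=> GB; apply: measurable_funM; last by have [] := exp_growth_inv_mixture_ratio GB.
apply: measurable_funM => //; apply: measurable_funM => //.
by apply: measurable_prod => i _; have [] := exp_growth_mulmx A (u i).
Qed.

(** A word is bounded by one term of the exponential series of [2 d M * dual_norm x]; the envelope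
    dominates this exponential divided by the ratio. *)
Lemma word_fun_le G j u x : in_ball rad G -> `|@word_fun G j u x| <= envelope x.
Proof.
move=> GB; apply: le_trans (expR_dual_norm_le x GB).
have r0 := mixture_ratio_gt0 x GB.
rewrite normrM [X in _ * X]ger0_norm ?invr_ge0 ?(ltW r0)//.
rewrite ler_wpM2r ?invr_ge0 ?(ltW r0)//.
have c0 : 0 <= 2 * d%:R * M by rewrite !mulr_ge0// (le_trans ler01).
apply: le_trans (exp_coeff_le_expR j (mulr_ge0 c0 (dual_norm_ge0 x))).
rewrite normrM [X in _ * X]ger0_norm ?invr_ge0//.
rewrite ler_wpM2r ?invr_ge0// normrM [X in X * _]ger0_norm ?exprn_ge0// [leRHS]exprMn.
rewrite ler_wpM2l ?exprn_ge0// normr_prod.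
apply: (@le_trans _ _ (\prod_(i < j) dual_norm x)).
  apply: ler_prod => i _; rewrite normr_ge0/= /dual_norm (bigD1 (u i))//= lerDl.
  exact: sumr_ge0.
by rewrite prodr_const card_ord.
Qed.

Section nodes.
Variables (I : finType) (a : I -> E).
Hypothesis cardI : (#|I| <= N)%N.
Hypothesis a_ball : forall i, enorm (a i) <= rad.

Local Notation opb := (@opb R d N I a).
Local Notation pair := (pair a).

(** Bound, from the exponential series, for the operator norm of multiplication by the Gaussian
    factor [quad]. *)
Definition expansion_bound : R := expR (mxsum A * M ^+ 2).

Let a_rad i l : `|a i ord0 l| <= rad.
Proof. exact: le_trans (coord_le_enorm _ _) (a_ball i). Qed.

Let opbc l : opb (fun t : E => t ord0 l) M.
Proof. exact: (opb_coord N0 (ltW rad0) cardI a_rad). Qed.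

Let quad theta : R := expR (- (bform A theta theta / 2)).

Let opb_quad : opb quad expansion_bound.
Proof.
have h l : opb (fun t : E => (t *m A) ord0 l * t ord0 l) ((\sum_k M * `|A k l|) * M).
  apply: opbM (opbc l).
  have hk k : opb (fun t : E => t ord0 k * A k l) (M * `|A k l|).
    by apply: opbM (opbc k) _; exact: opb_cst.
  by apply: opb_ext (opb_sum (index_enum _) hk) => t; rewrite mxE.
have := opbM (opb_cst (N := N) (a := a) (- 2^-1)) (opb_sum (index_enum _) h).
set K := _ * _; move=> oK.
have KE : 2 * K = mxsum A * M ^+ 2.
  rewrite /K normrN ger0_norm// mulrA mulfV// mul1r.
  rewrite -mulr_suml expr2 mulrA; congr (_ * _).
  by rewrite exchange_big /= mulr_suml; apply: eq_bigr => k _; rewrite mulr_suml; apply: eq_bigr => l _; rewrite mulrC.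
have K0 : 0 <= K by have : 0 <= 2 * K; [rewrite KE mulr_ge0 ?sqr_ge0|lra].
have := opb_expR N0 K0 oK; rewrite KE; apply: opb_ext => t.
by rewrite /quad bformE; congr expR; ring.
Qed.

Let lin x theta : R := \sum_l (x *m A) ord0 l * theta ord0 l.

Let opb_lin x : opb (lin x) (M * dual_norm x).
Proof.
rewrite /dual_norm mulr_sumr; apply: opb_sum => l.
by rewrite mulrC; apply: opbM (opbc l); exact: opb_cst.
Qed.

(** The kernel splits as [quad theta * expR (lin x theta)]. The [j]-th power of [lin] is a sum over
    words of a monomial in [x] times a monomial in [theta]: the former goes into [word_fun]; the
    latter, paired with the measure, costs [M ^+ j] and leaves [(2 d)^-j] after normalisation. *)
Lemma score_expandable G wt c : in_ball rad G -> moments_le N a wt c ->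
  expandable envelope d (@word_fun G) (expansion_bound * c)
    (fun x => pair wt (fun t : E => tilt S t x) * (mixture_ratio S G x)^-1).
Proof.
move=> GB wc J; have c0 := moments_le_ge0 N0 wc.
have d1 : 0 < d%:R :> R by rewrite ltr0n.
have M0 : 0 < M := lt_le_trans ltr01 M1.
have e0 : 0 <= expansion_bound by exact: expR_ge0.
exists (fun (j : nat) (u : {ffun 'I_j -> 'I_d}) => pair wt (fun t : E => quad t * \prod_i t ord0 (u i)) / (2 * d%:R * M) ^+ j).
split=> [j u|x].
  have ou : opb (fun t : E => quad t * \prod_i t ord0 (u i)) (expansion_bound * M ^+ j).
    apply: opbM opb_quad _.
    have := @opb_prod R d N I a _ (index_enum 'I_j) (fun i (t : E) => t ord0 (u i)) (fun=> M) (fun i => opbc (u i)).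
    by rewrite prodr_const card_ord.
  have := opb_pair_le N0 ou wc => h.
  rewrite normrM [X in _ * X]ger0_norm; last by rewrite invr_ge0 exprn_ge0// !mulr_ge0// ltW.
  rewrite ler_pdivrMr; last by rewrite exprn_gt0// !mulr_gt0.
  apply: (le_trans h); rewrite le_eqVlt; apply/orP; left; apply/eqP.
  rewrite [(2 * d%:R * M) ^+ j]exprMn.
  have : (2 * d%:R) ^+ j != 0 :> R by rewrite expf_neq0// mulf_neq0// gt_eqF.
  by move: ((2 * d%:R) ^+ j) => C C0; field.
have r0 := mixture_ratio_gt0 x GB.
set rem := fun t : E => expR (lin x t) - \sum_(j < J) lin x t ^+ j / j`!%:R.
have orem : opb (fun t : E => quad t * rem t)
    (expansion_bound * (2^-1 ^+ J * expR (2 * (M * dual_norm x)))).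
  apply: opbM opb_quad _; apply: (opb_expR_remainder N0 J _ (opb_lin x)).
  exact: mulr_ge0 (ltW M0) (dual_norm_ge0 x).
have hrem := opb_pair_le N0 orem wc.
have -> : pair wt (fun t : E => tilt S t x) * (mixture_ratio S G x)^-1 -
   \sum_(j < J) \sum_(u : {ffun 'I_j -> 'I_d}) pair wt (fun t : E => quad t * \prod_i t ord0 (u i)) / (2 * d%:R * M) ^+ j
      * word_fun G u x
   = pair wt (fun t : E => quad t * rem t) * (mixture_ratio S G x)^-1.
  have -> : \sum_(j < J) \sum_(u : {ffun 'I_j -> 'I_d}) pair wt (fun t : E => quad t * \prod_i t ord0 (u i)) / (2 * d%:R * M) ^+ j
      * word_fun G u x =
      pair wt (fun t : E => quad t * (\sum_(j < J) lin x t ^+ j / j`!%:R)) * (mixture_ratio S G x)^-1.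
    transitivity (\sum_(j < J) (pair wt (fun t : E => quad t * (lin x t ^+ j / j`!%:R))) * (mixture_ratio S G x)^-1).
      apply: eq_bigr => j _; rewrite /pair mulr_suml.
      have linX (t : E) : lin x t ^+ j = \sum_(u : {ffun 'I_j -> 'I_d})
          (\prod_i (x *m A) ord0 (u i)) * \prod_i t ord0 (u i).
        transitivity (\prod_(i < j) lin x t); first by rewrite prodr_const card_ord.
        by rewrite bigA_distr_bigA; apply: eq_bigr => u _; rewrite -big_split.
      under [RHS]eq_bigr do rewrite linX mulr_suml mulr_sumr mulr_sumr mulr_suml.
      rewrite [RHS]exchange_big /=; apply: eq_bigr => u _.
      rewrite !mulr_suml; apply: eq_bigr => i _; rewrite /word_fun.
      have cj : (2 * d%:R * M) ^+ j != 0 by rewrite expf_neq0// !mulf_neq0// gt_eqF.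
      move: ((2 * d%:R * M) ^+ j) cj => C cj; field.
      by rewrite cj gt_eqF//= pnatr_eq0 -lt0n fact_gt0.
    rewrite -mulr_suml; congr (_ * _); rewrite /pair exchange_big; apply: eq_bigr => i _.
    by rewrite -mulr_sumr -mulr_sumr.
  rewrite -mulrBl; congr (_ * _); rewrite /pair -sumrB; apply: eq_bigr => i _.
  rewrite /rem mulrBr mulrBr; congr (_ - _).
  by rewrite /tilt /tilt_exponent expRD /quad /lin; congr (_ * _); rewrite mulrC.
rewrite normrM [X in _ * X]ger0_norm ?invr_ge0 ?(ltW r0)//.
apply: (@le_trans _ _ (expansion_bound * (2^-1 ^+ J * expR (2 * (M * dual_norm x))) * c * (mixture_ratio S G x)^-1)).
  by rewrite ler_wpM2r// invr_ge0 ltW.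
have -> : expansion_bound * (2^-1 ^+ J * expR (2 * (M * dual_norm x))) * c * (mixture_ratio S G x)^-1 =
  expansion_bound * c * 2^-1 ^+ J * (expR (2 * (M * dual_norm x)) * (mixture_ratio S G x)^-1) by ring.
rewrite ler_wpM2l ?mulr_ge0 ?exprn_ge0//.
apply: le_trans (expR_dual_norm_le x GB); rewrite ler_wpM2r ?invr_ge0 ?(ltW r0)// ler_expR.
have Md : 0 <= 2 * (M * dual_norm x) by rewrite !mulr_ge0 ?dual_norm_ge0 ?(ltW M0).
have -> : 2 * d%:R * M * dual_norm x = d%:R * (2 * (M * dual_norm x)) by ring.
by rewrite ler_peMl// ler1n.
Qed.

Lemma score_le G wt c x : in_ball rad G -> moments_le N a wt c ->
  `|pair wt (fun t : E => tilt S t x) * (mixture_ratio S G x)^-1| <= expansion_bound * c * envelope x.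
Proof.
move=> GB wc; have [e [_ /(_ x)]] := score_expandable GB wc 0.
by rewrite big_ord0 subr0 expr0 mulr1.
Qed.

End nodes.

End score_expansion.

(** * Normalised scores and their moments *)

Section scores.
Variables (R : realType) (d : nat) (S : 'M[R]_d).
Hypothesis pdS : posdef S.
Hypothesis d0 : (0 < d)%N.
Variables (rad : R) (N : nat).
Hypothesis rad0 : 0 < rad.
Hypothesis N0 : (0 < N)%N.
Local Notation E := 'rV[R]_d.
Local Notation leb := (lebesgue_rV R d).
Local Notation ratio := (mixture_ratio S).
Local Notation Env := (envelope S rad N).
Implicit Types (x theta : E) (G H : mixing R d).

(** Bound for the eighth moment of the envelope, uniform in the true mixture, whose ratio is
    replaced by its exponential upper bound; the added 1 makes it at least 1. *)
Definition envelope_moment : R := 1 + I0 S (fun x =>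
  expR ((8 * envelope_rate S rad N + ratio_rate S rad) * (1 + l1norm x))).

Lemma envelope_moment_ge1 : 1 <= envelope_moment.
Proof. by rewrite lerDl; apply: I0_ge0 => // x; exact: expR_ge0. Qed.

Definition chi2 G H : R := I0 S (fun x => (ratio G x / ratio H x - 1) ^+ 2 * ratio H x).

Definition score G H x : R := (ratio G x / ratio H x - 1) / Num.sqrt (chi2 G H).

Definition difference_node G H (i : 'I_(Defs.order G) + 'I_(Defs.order H)) : E :=
  match i with inl i => @atom _ _ G i | inr i => @atom _ _ H i end.

(** Weights of the signed measure [(G - H) / c] on the disjoint union of the two families of atoms;
    coincident atoms keep separate indices. *)
Definition difference_weight G H (c : R) (i : 'I_(Defs.order G) + 'I_(Defs.order H)) : R :=
  match i with inl i => @weight _ _ G i / c | inr i => - (@weight _ _ H i / c) end.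

Lemma pair_difference G H c g :
  pair (@difference_node G H) (difference_weight c) g = (mean G g - mean H g) / c.
Proof.
rewrite /pair big_sumType /= mulrBl /mean !mulr_suml -sumrN.
by congr (_ + _); apply: eq_bigr => i _; ring.
Qed.

Lemma difference_node_ball G H i : in_ball rad G -> in_ball rad H ->
  enorm (@difference_node G H i) <= rad.
Proof. by move=> [aG _ _] [aH _ _]; case: i. Qed.

Lemma scoreE G H x : in_ball rad H ->
  score G H x = pair (@difference_node G H) (difference_weight (Num.sqrt (chi2 G H)))
    (fun t => tilt S t x) * (ratio H x)^-1.
Proof.
move=> HB; have r0 := mixture_ratio_gt0 pdS rad0 x HB.
rewrite pair_difference (_ : mean G _ = ratio G x)// (_ : mean H _ = ratio H x)//.
by rewrite /score; move: (Num.sqrt _)^-1 => s; field; rewrite gt_eqF.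
Qed.

Lemma exp_growth_ratio G H : in_ball rad H -> exp_growth (fun x => ratio G x / ratio H x).
Proof.
move=> HB; apply: exp_growthM; first exact: exp_growth_mixture_ratio.
exact: exp_growth_inv_mixture_ratio HB.
Qed.

Lemma exp_growth_chi2 G H : in_ball rad H ->
  exp_growth (fun x => (ratio G x / ratio H x - 1) ^+ 2).
Proof.
move=> HB; apply: exp_growthX; apply: exp_growthB; first exact: exp_growth_ratio.
exact: exp_growth_cst.
Qed.

(** With [p] and [q] the square roots of the ratios, [p^2 / q^2 - 1 = (p / q - 1) (p / q + 1)], and
    the last factor is at least 1. *)
Lemma hell2_le_chi2 G H : in_ball rad G -> in_ball rad H -> hell2 S G H <= chi2 G H.
Proof.
move=> GB HB; apply: (I0_le pdS); first exact: exp_growth_hell.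
  by apply: exp_growthM; [exact: exp_growth_chi2|exact: exp_growth_mixture_ratio].
move=> x; have g0 := mixture_ratio_gt0 pdS rad0 x GB; have h0 := mixture_ratio_gt0 pdS rad0 x HB.
set p := Num.sqrt (ratio G x); set q := Num.sqrt (ratio H x).
have q0 : 0 < q by rewrite sqrtr_gt0.
have p0 : 0 <= p by exact: sqrtr_ge0.
have pE : ratio G x = p ^+ 2 by rewrite sqr_sqrtr// ltW.
have qE : ratio H x = q ^+ 2 by rewrite sqr_sqrtr// ltW.
rewrite pE qE.
have -> : (p ^+ 2 / q ^+ 2 - 1) ^+ 2 * q ^+ 2 = (p - q) ^+ 2 * (p / q + 1) ^+ 2.
  by field; rewrite gt_eqF.
by rewrite ler_peMr ?sqr_ge0// exprn_ege1// lerDr divr_ge0// ltW.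
Qed.

Lemma pw_word (b : {ffun 'I_d -> 'I_N}) : exists2 w : seq 'I_d, (size w < (d * N).+1)%N &
  forall theta, pw b theta = mono w theta.
Proof.
exists (flatten [seq nseq (b l) l | l <- enum 'I_d]).
  rewrite ltnS size_flatten /shape -map_comp.
  rewrite (eq_map (g := fun l => b l : nat)); last by move=> l /=; rewrite size_nseq.
  rewrite sumnE big_map big_enum /=.
  apply: (@leq_trans (\sum_(l < d) N)); first by apply: leq_sum => l _; exact: ltnW.
  by rewrite sum_nat_const card_ord.
move=> theta; rewrite /mono big_flatten big_map big_enum /= /pw.
by apply: eq_bigr => l _; rewrite big_nseq; elim: (b l : nat) => //= n <-; rewrite exprS.
Qed.

(** Differences of moments are of the order of the Hellinger distance, hence at most of the order of
    the normalisation. The normalised measures thus range over a set bounded in moments, although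
    their weights may diverge as [G] approaches [H]. *)
Lemma difference_moments (C : R) G H : 0 < chi2 G H -> 0 <= C ->
  in_ball rad G -> in_ball rad H ->
  (forall w, (size w < (d * N).+1)%N -> `|mean G (mono w) - mean H (mono w)| <= C * Num.sqrt (hell2 S G H)) ->
  moments_le N (@difference_node G H) (difference_weight (Num.sqrt (chi2 G H))) C.
Proof.
move=> c0 C0 GB HB CGH b; rewrite pair_difference.
have [w wN bw] := pw_word b; have s0 : 0 < Num.sqrt (chi2 G H) by rewrite sqrtr_gt0.
rewrite normrM [X in _ * X]ger0_norm ?invr_ge0 ?(ltW s0)// ler_pdivrMr//.
have -> : mean G (pw b) = mean G (mono w) by apply: eq_bigr => i _; rewrite bw.
have -> : mean H (pw b) = mean H (mono w) by apply: eq_bigr => i _; rewrite bw.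
by rewrite (le_trans (CGH w wN))// ler_wpM2l// ler_wsqrtr// hell2_le_chi2.
Qed.

Section law.
Variables (Gs : mixing R d) (mu : probability E R).
Hypothesis GsB : in_ball rad Gs.
Hypothesis muE : forall B, measurable B ->
  mu B = (\int[leb]_(x in B) (mixture_pdf S Gs x)%:E)%E.

Lemma law_integral u : exp_growth u -> (forall x, 0 <= u x) ->
  (\int[mu]_x (u x)%:E = (I0 S (fun x => u x * ratio Gs x))%:E)%E.
Proof.
move=> gu u0; have gr := exp_growth_mixture_ratio pdS Gs.
have mpdf : measurable_fun setT (mixture_pdf S Gs).
  rewrite (_ : mixture_pdf S Gs = fun x => ratio Gs x * gauss0 S x); last first.
    by apply/funext => x; exact: mixture_pdf_ratio.
  by apply: measurable_funM; [case: gr|exact: measurable_gauss0].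
have pdf0 x : 0 <= mixture_pdf S Gs x.
  by rewrite (mixture_pdf_ratio pdS) mulr_ge0 ?ltW ?gauss0_gt0 ?(mixture_ratio_gt0 pdS rad0 x GsB).
rewrite (@transfer_ge0 _ _ _ _ _ leb mu id (mixture_pdf S Gs))//; last by apply/measurable_EFinP; case: gu.
rewrite /I0 /Rintegral fineK; last first.
  apply: integrable_fin_num => //; apply: (integrable_gauss0 pdS); exact: exp_growthM.
by apply: eq_integral => x _; rewrite -EFinM (mixture_pdf_ratio pdS) mulrA.
Qed.

(** The total mass of the centred Gaussian is read off from [mu], a probability whose density is a
    convex combination of its translates. *)
Lemma I0_one : I0 S (fun=> 1) = 1.
Proof.
have := law_integral (exp_growth_cst d (1 : R)) (fun=> ler01).
rewrite (_ : (\int[mu]__ _ = 1)%E); last by rewrite integral_cst// mul1e; exact: probability_setT.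
case.
rewrite (I0_mixture_ratio pdS)//; last exact: exp_growth_cst.
by case: GsB => _ _ w1; rewrite /mean -mulr_suml w1 mul1r => <-.
Qed.

Lemma I0_ratio G : in_ball rad G -> I0 S (ratio G) = 1.
Proof.
move=> [_ _ w1]; have := I0_mixture_ratio pdS G (exp_growth_cst d (1 : R)).
rewrite /mean -mulr_suml w1 mul1r I0_one => e; rewrite -[RHS]e.
by congr (I0 S _); apply/funext => x; rewrite mul1r.
Qed.

Lemma envelope_integral : (\int[mu]_x (Env x ^+ 8)%:E <= envelope_moment%:E)%E.
Proof.
rewrite law_integral; [|exact: exp_growth_envelopeX|by move=> x; rewrite exprn_ge0 ?expR_ge0].
rewrite lee_fin /envelope_moment ler_wpDl//; set a := _ + _.
have a0 : 0 <= a.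
  by apply: addr_ge0; [apply: mulr_ge0 => //; exact: envelope_rate_ge0|exact: ratio_rate_ge0].
apply: (I0_le pdS).
- apply: exp_growthM; last exact: exp_growth_mixture_ratio.
  exact: exp_growth_envelopeX.
- apply: (exp_growth_expR (c := a) (a := a)) => // [|x]; last by rewrite mulrDr mulr1.
  apply: measurable_funM => //.
  by apply: measurable_funD => //; exact: measurable_l1norm.
- move=> x; rewrite /a mulrDl expRD ler_pM ?exprn_ge0 ?expR_ge0//.
  + by rewrite ltW// (mixture_ratio_gt0 pdS rad0 x GsB).
  + by rewrite /envelope -expRM_natl mulrA.
  + exact: mixture_ratio_ub.
Qed.

Lemma score_standardized (C : R) G : in_ball rad G -> 0 < chi2 G Gs ->
  (Defs.order G + Defs.order Gs <= N)%N ->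
  moments_le N (@difference_node G Gs) (difference_weight (Num.sqrt (chi2 G Gs))) C ->
  standardized mu Env (expansion_bound S rad N * C) (score G Gs).
Proof.
move=> GB c0 oN GC; set s := Num.sqrt (chi2 G Gs).
have s0 : 0 < s by rewrite sqrtr_gt0.
have gr := exp_growth_ratio G GsB.
have ms : measurable_fun setT (score G Gs).
  have gs : exp_growth (fun x => s^-1 * (ratio G x / ratio Gs x - 1)).
    by apply: exp_growthZ; apply: exp_growthB => //; exact: exp_growth_cst.
  case: gs => + _; congr measurable_fun.
  by apply/funext => x; rewrite /score mulrC.
have sle x : `|score G Gs x| <= expansion_bound S rad N * C * Env x.
  rewrite scoreE//; apply: (score_le pdS d0 rad0 N0) => //.
    by rewrite card_sum !card_ord.
  by move=> i; exact: difference_node_ball.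
have r0 x := mixture_ratio_gt0 pdS rad0 x GB.
have rs0 x := mixture_ratio_gt0 pdS rad0 x GsB.
split=> //.
- have iu : (\int[mu]_x (ratio G x / ratio Gs x)%:E = 1%:E)%E.
    rewrite law_integral//; last by move=> x; rewrite divr_ge0// ltW.
    rewrite -(I0_ratio GB); congr (_%:E); congr (I0 S _); apply/funext => x.
    by rewrite divfK// gt_eqF.
  have ig : mu.-integrable setT (EFin \o (fun x => ratio G x / ratio Gs x)).
    apply/integrableP; split; first by apply/measurable_EFinP; case: gr.
    under eq_integral do rewrite /= ger0_norm ?divr_ge0 ?(ltW (r0 _)) ?(ltW (rs0 _))//.
    by rewrite iu ltry.
  have i1 : mu.-integrable setT (EFin \o (fun=> 1 : R)) by exact: finite_measure_integrable_cst.
  rewrite /score; under eq_Rintegral do rewrite mulrC.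
  rewrite RintegralZl//; last exact: (integrableB measurableT ig i1).
  have e1 : \int[mu]_x (ratio G x / ratio Gs x) = 1 by rewrite /Rintegral iu.
  by rewrite RintegralB// e1 Ex_cst subrr mulr0.
- have i2 : (\int[mu]_x ((ratio G x / ratio Gs x - 1) ^+ 2)%:E = (chi2 G Gs)%:E)%E.
    by rewrite law_integral//; [exact: exp_growth_chi2|move=> x; exact: sqr_ge0].
  have ig : mu.-integrable setT (EFin \o (fun x => (ratio G x / ratio Gs x - 1) ^+ 2)).
    apply/integrableP; split; first by apply/measurable_EFinP; case: (exp_growth_chi2 G GsB).
    under eq_integral do rewrite /= ger0_norm ?sqr_ge0//.
    by rewrite i2 ltry.
  rewrite (_ : (fun x => score G Gs x ^+ 2) = fun x => s ^- 2 * (ratio G x / ratio Gs x - 1) ^+ 2); last first.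
    by apply/funext => x; rewrite /score exprMn exprVn mulrC.
  by rewrite RintegralZl// /Rintegral i2 /= /s sqr_sqrtr ?(ltW c0)// mulVf// gt_eqF.
Qed.

(** The difference of two scores is again a pairing with a signed measure, now on four families of
    atoms, so closeness of the moments becomes a small expansion constant. *)
Lemma score_difference_expandable (h : R) G H : in_ball rad G -> in_ball rad H ->
  (Defs.order G + Defs.order Gs + (Defs.order H + Defs.order Gs) <= N)%N ->
  (forall b : {ffun 'I_d -> 'I_N},
    `|pair (@difference_node G Gs) (difference_weight (Num.sqrt (chi2 G Gs))) (pw b) -
      pair (@difference_node H Gs) (difference_weight (Num.sqrt (chi2 H Gs))) (pw b)| <= h) ->
  (forall x, `|score G Gs x - score H Gs x| <= expansion_bound S rad N * h * Env x) /\
  expandable Env d (fun j u => @word_fun R d S rad N Gs j u) (expansion_bound S rad N * h)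
    (fun x => score G Gs x - score H Gs x).
Proof.
move=> GB HB oN hGH.
pose I : finType := (('I_(Defs.order G) + 'I_(Defs.order Gs)) + ('I_(Defs.order H) + 'I_(Defs.order Gs)))%type.
pose a (i : I) := match i with inl i => difference_node i | inr i => difference_node i end.
pose wt (i : I) := match i with
  | inl i => difference_weight (Num.sqrt (chi2 G Gs)) i
  | inr i => - difference_weight (Num.sqrt (chi2 H Gs)) i end.
have pairE g : pair a wt g =
   pair (@difference_node G Gs) (difference_weight (Num.sqrt (chi2 G Gs))) g -
   pair (@difference_node H Gs) (difference_weight (Num.sqrt (chi2 H Gs))) g.
  rewrite /pair big_sumType /= -sumrN; congr (_ + _).
  by apply: eq_bigr => i _; rewrite mulNr.
have cI : (#|I| <= N)%N by rewrite !card_sum !card_ord.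
have aB i : enorm (a i) <= rad by case: i => i; exact: difference_node_ball.
have wh : moments_le N a wt h by move=> b; rewrite pairE.
have sE : (fun x => score G Gs x - score H Gs x) =
   (fun x => pair a wt (fun t => tilt S t x) * (ratio Gs x)^-1).
  by apply/funext => x; rewrite pairE mulrBl -!scoreE.
split.
  move=> x; rewrite (congr1 (fun f => f x) sE).
  exact: (score_le pdS d0 rad0 N0 cI aB).
rewrite sE; exact: (score_expandable pdS d0 rad0 N0 cI aB).
Qed.

End law.

End scores.

Lemma quantize_close (R : realType) (C h x y : R) (Q : nat) : 0 < h ->
  (2 * C / h < Q.+1%:R) -> `|x| <= C -> `|y| <= C ->
  inord (Num.truncn ((x + C) / h)) = inord (Num.truncn ((y + C) / h)) :> 'I_Q.+1 ->
  `|x - y| <= h.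
Proof.
move=> h0 Qb xC yC /(congr1 (@nat_of_ord _)).
have tb z : `|z| <= C -> 0 <= (z + C) / h /\ (Num.truncn ((z + C) / h) < Q.+1)%N.
  rewrite ler_norml => /andP[z1 z2].
  have z0 : 0 <= (z + C) / h by rewrite divr_ge0 ?(ltW h0)//; lra.
  split=> //; rewrite -(ltr_nat R); have /andP[/le_lt_trans + _] := truncn_itv z0.
  apply; apply: le_lt_trans Qb; rewrite ler_pM2r ?invr_gt0//; lra.
have [x0 xQ] := tb x xC; have [y0 yQ] := tb y yC.
rewrite !inordK// => e.
have /andP[x1 x2] := truncn_itv x0; have /andP[y1 y2] := truncn_itv y0.
rewrite e in x1 x2; rewrite -natr1 in x2; rewrite -natr1 in y2.
have : `|(x + C) / h - (y + C) / h| <= 1.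
  by rewrite ler_norml; apply/andP; split; lra.
have -> : (x + C) / h - (y + C) / h = (x - y) / h by field; rewrite gt_eqF.
by rewrite normrM normfV (gtr0_norm h0) ler_pdivrMr// mul1r.
Qed.

(** * Deviation of the Hellinger distance *)

Section hellinger_deviation.
Variables (R : realType) (d : nat) (S : 'M[R]_d).
Hypothesis pdS : posdef S.
Hypothesis d0 : (0 < d)%N.
Local Notation E := 'rV[R]_d.

(** An absolute constant: the drift 1/80 kept by a representative times the Laplace parameter
    1/200. *)
Definition deviation_exponent : R := 80^-1 / 200.

(** Scores are classified by the quantised values of their mixed moments. The set of codes is fixed
    before [n] and [Gs], which is why [M] is uniform in both; the representatives of the codes are
    chosen afterwards and depend on [Gs]. *)
Lemma hellinger_deviation (rad : R) (k kstar : nat) : 0 < rad -> (0 < k)%N ->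
  exists2 M : R, 0 < M &
  forall (n : nat) (Gs : mixing R d) (dO : measure_display) (Omega : measurableType dO)
    (P : probability Omega R) (X : 'I_n -> {RV P >-> E}) (Ghat : Omega -> mixing R d),
  (1 <= n)%N -> Defs.order Gs = kstar -> in_ball rad Gs ->
  iid_with_density (mixture_pdf S Gs) X ->
  (forall w, [/\ in_ball rad (Ghat w), (Defs.order (Ghat w) <= k)%N &
    mean_loglik S X w Gs <= mean_loglik S X w (Ghat w)]) ->
  ((P^*)%mu [set w | (Num.sqrt d%:R * Num.sqrt (ln n%:R / n%:R) < Num.sqrt (hell2 S (Ghat w) Gs / 2))%R]
    <= (M * n%:R `^ (- deviation_exponent))%:E)%E.
Proof.
(* Two scores are compared at a time, each carried by at most [k + kstar] atoms. *)
move=> rad0 k0; pose N := (2 * (k + kstar))%N.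
have N0 : (0 < N)%N by rewrite muln_gt0/= addn_gt0 k0.
have [C1 C10 CC1] := moment_comparison pdS rad (d * N).+1.
pose Cq := expansion_bound S rad N; have Cq0 : 0 < Cq by exact: expR_gt0.
pose m := envelope_moment S rad N.
have m1 : 1 <= m by exact: envelope_moment_ge1.
pose C := Num.max 1 (Cq * C1); have C1' : 1 <= C by rewrite le_max lexx.
have p0 : 0 < precision m.
  rewrite /precision invr_gt0; apply: mulr_gt0; first by rewrite ltr0n.
  apply: (lt_le_trans ltr01); rewrite /resolution lerDr.
  by apply: mulr_ge0; [apply: mulr_ge0 => //; exact: sqr_ge0|exact: le_trans m1].
(* With this mesh, two scores with the same code have a difference that is expandable with constant
   [precision m]. *)
pose h := precision m / Cq; have h0 : 0 < h by rewrite divr_gt0.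
pose Q := Num.truncn (2 * C1 / h).
have Qb : 2 * C1 / h < Q.+1%:R.
  have : 0 <= 2 * C1 / h by apply: divr_ge0; [apply: mulr_ge0 => //|]; exact: ltW.
  by move=> /truncn_itv /andP[].
pose I := {ffun {ffun 'I_d -> 'I_N} -> 'I_Q.+1}.
pose Env := envelope S rad N.
have w1 : 1 <= Num.sqrt d%:R :> R by rewrite -[leLHS]sqrtr1 ler_wsqrtr// ler1n.
pose ssb := sample_size_bound m d C (Num.sqrt d%:R).
(* From [n0] on, the fourth root of [n] passes the required threshold; below [n0] the claimed bound
   is at least 1, thanks to the second summand of [M]. *)
pose n0 := (4 * ssb ^+ 2) ^+ 4.
pose c := deviation_exponent.
have c0 : 0 < c by rewrite divr_gt0// invr_gt0.
have n00 : 0 <= n0 by rewrite exprn_ge0// mulr_ge0 ?sqr_ge0.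
pose M := (#|I|%:R + 4 + m) + (1 + n0) `^ c.
have M1 : 0 < #|I|%:R + 4 + m by rewrite ltr_wpDl// ?addr_ge0// (lt_le_trans ltr01).
exists M; first by rewrite addr_gt0// powR_gt0// ltr_pwDl.
move=> n Gs dO Omega P X Ghat n1 oGs GsB [dens ind] mle.
have nr0 : 0 < n%:R :> R by rewrite ltr0n.
set A := [set w | _].
have [nn0|nn0] := ltP n%:R n0.
  apply: (@le_trans _ _ 1%E).
    apply: (@le_trans _ _ ((P^*)%mu setT)); first exact: le_outer_measure.
    by rewrite measurable_mu_extE//= probability_setT.
  rewrite lee_fin powRN ler_pdivlMr ?powR_gt0// mul1r.
  apply: (@le_trans _ _ ((1 + n0) `^ c)); last by rewrite lerDr ltW.
  by rewrite ge0_ler_powR ?(ltW c0)// ?nnegrE ?addr_ge0 ?(ltW nr0)// ler_wpDl// ltW.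
pose class G := [/\ in_ball rad G, (Defs.order G <= k)%N & 0 < chi2 S G Gs].
have hell_chi2 w : A w -> class (Ghat w) /\
    Num.sqrt d%:R * Num.sqrt (ln n%:R / n%:R) < Num.sqrt (chi2 S (Ghat w) Gs).
  move=> Aw; have [GB Gk _] := mle w.
  have hc := hell2_le_chi2 pdS rad0 GB GsB.
  have l : Num.sqrt d%:R * Num.sqrt (ln n%:R / n%:R) < Num.sqrt (chi2 S (Ghat w) Gs).
    apply: (lt_le_trans Aw); apply: ler_wsqrtr; apply: le_trans hc.
    by have := hell2_ge0 pdS (Ghat w) Gs; lra.
  split=> //; split=> //; rewrite -sqrtr_gt0; apply: le_lt_trans l.
  by rewrite mulr_ge0 ?sqrtr_ge0.
(* Without any admissible mixture the event is empty; otherwise [G0] is the default representative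
   of the codes that are not attained. *)
case: (pselect (exists G, class G)) => [[G0 cG0]|nG]; last first.
  rewrite (_ : A = set0).
    by rewrite outer_measure0 lee_fin mulr_ge0 ?powR_ge0// addr_ge0 ?powR_ge0// ltW.
  by apply/seteqP; split=> // w /hell_chi2[cw _]; apply: nG; exists (Ghat w).
pose phi G (b : {ffun 'I_d -> 'I_N}) : R :=
  pair (@difference_node _ _ G Gs) (difference_weight (Num.sqrt (chi2 S G Gs))) (pw b).
pose code G : I := [ffun b => inord (Num.truncn ((phi G b + C1) / h))].
have [rep repP] : exists rep : I -> mixing R d, (forall c, class (rep c)) /\
    (forall G, class G -> code (rep (code G)) = code G).
  have ex (i : I) : exists G, class G /\ ((exists2 H, class H & code H = i) -> code G = i).
    case: (pselect (exists2 H, class H & code H = i)) => [[H cH Hi]|nH].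
      by exists H.
    by exists G0.
  have [rep repP] := choice ex; exists rep; split=> [i|G cG]; first by case: (repP i).
  by case: (repP (code G)) => _; apply; exists G.
have phiC G : class G -> moments_le N (@difference_node _ _ G Gs)
    (difference_weight (Num.sqrt (chi2 S G Gs))) C1.
  move=> [GB Gk cG]; apply: (difference_moments pdS rad0 cG (ltW C10) GB GsB).
  by move=> w wN; exact: CC1.
pose i0 : 'I_n := Ordinal n1.
pose mu : probability E R := distribution P (X i0).
have muE B : measurable B -> mu B = (\int[lebesgue_rV R d]_(x in B) (mixture_pdf S Gs x)%:E)%E.
  by move=> mB; exact: dens.
have lawX i B : measurable B -> P (X i @^-1` B) = mu B.
  by move=> mB; rewrite muE// -(dens i).
have std G : class G -> standardized mu Env C (score S G Gs).
  move=> cG; have [GB Gk cG0'] := cG.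
  have oN : (Defs.order G + Defs.order Gs <= N)%N.
    by rewrite oGs /N mul2n -addnn (leq_trans _ (leq_addr _ _))// leq_add2r.
  have [ms sle s0 s1] := score_standardized pdS d0 rad0 N0 GsB muE GB cG0' oN (phiC G cG).
  split=> // x; apply: (le_trans (sle x)); rewrite ler_wpM2r ?expR_ge0//.
  by rewrite le_max lexx orbT.
have Emu : (\int[mu]_x (Env x ^+ 8)%:E <= m%:E)%E by exact: (envelope_integral pdS N rad0 GsB muE).
have Env1 x : 1 <= Env x by exact: envelope_ge1.
have mEnv : measurable_fun setT Env by exact: measurable_envelope.
have nB : 4 * ssb ^+ 2 <= Num.sqrt (Num.sqrt n%:R).
  have x0 : 0 <= 4 * ssb ^+ 2 by apply: mulr_ge0 => //; exact: sqr_ge0.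
  have -> : 4 * ssb ^+ 2 = Num.sqrt (Num.sqrt n0).
    rewrite /n0; move: x0; move: (4 * ssb ^+ 2) => x x0.
    rewrite (_ : x ^+ 4 = (x ^+ 2) ^+ 2); last by rewrite -exprM.
    by rewrite sqrtr_sqr (ger0_norm (sqr_ge0 x)) sqrtr_sqr ger0_norm.
  by rewrite !ler_wsqrtr.
have AE o : A o -> exists (T : E -> R) (i : I) (sigma : R),
    [/\ standardized mu Env C T,
        (forall x, `|T x - score S (rep i) Gs x| <= precision m * Env x)
          /\ expandable Env d (fun j u => @word_fun R d S rad N Gs j u) (precision m)
               (fun x => T x - score S (rep i) Gs x),
        Num.sqrt d%:R * Num.sqrt (ln n%:R / n%:R) < sigma,
        forall x, 0 < 1 + sigma * T x &
        0 <= \sum_(i < n) ln (1 + sigma * T (X i o))].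
  move=> /hell_chi2[cG l]; have [GB Gk cG0'] := cG.
  set G := Ghat o in cG l GB Gk cG0' *.
  (* With [sigma] the square root of [chi2], [1 + sigma * score] is the likelihood ratio itself. *)
  exists (score S G Gs), (code G), (Num.sqrt (chi2 S G Gs)).
  have [HB Hk cH] := repP.1 (code G).
  have s0 : 0 < Num.sqrt (chi2 S G Gs) by rewrite sqrtr_gt0.
  have ratioE x : 1 + Num.sqrt (chi2 S G Gs) * score S G Gs x = mixture_ratio S G x / mixture_ratio S Gs x.
    by rewrite /score mulrC divfK ?gt_eqF// addrC subrK.
  have g0 x := mixture_ratio_gt0 pdS rad0 x GB.
  have gs0 x := mixture_ratio_gt0 pdS rad0 x GsB.
  have oN : (Defs.order G + Defs.order Gs + (Defs.order (rep (code G)) + Defs.order Gs) <= N)%N.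
    by rewrite oGs /N mul2n -addnn leq_add// leq_add2r.
  have close b : `|phi G b - phi (rep (code G)) b| <= h.
    apply: (quantize_close h0 Qb); [exact: phiC|exact: (phiC _ (repP.1 _))|].
    by have := repP.2 G cG => /ffunP /(_ b); rewrite /code !ffunE => ->.
  have Cqh : expansion_bound S rad N * h = precision m.
    by rewrite /h mulrC divfK// gt_eqF.
  split=> //; first exact: std.
  - by rewrite -Cqh; exact: (score_difference_expandable pdS d0 rad0 N0 GsB GB HB oN close).
  - by move=> x; rewrite ratioE divr_gt0.
  (* The Gaussian factors cancel in the difference of the log-likelihoods. *)
  have [_ _] := mle o; rewrite /mean_loglik ler_pM2l ?invr_gt0// -subr_ge0 -sumrB.
  congr (_ <= _); apply: eq_bigr => i _; rewrite ratioE.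
  have ga := gauss0_gt0 pdS (X i o).
  rewrite !(mixture_pdf_ratio pdS) ln_div ?posrE//.
  move: (gauss0 S (X i o)) ga (mixture_ratio S G _) (g0 (X i o)) (mixture_ratio S Gs _) (gs0 (X i o)).
  move=> z z0 p p0' q q0; rewrite !lnM ?posrE//.
  by rewrite opprD addrACA subrr addr0.
have dev := localized_deviation mEnv Env1 Emu m1 d0 (card_words d)
  (fun j u => measurable_word_fun pdS N rad0 u GsB)
  (fun j u x => word_fun_le pdS N rad0 u x GsB) C1' w1
  (fun i => std _ (repP.1 i)) lawX ind nB AE.
apply: (le_trans dev); rewrite lee_fin /powR gt_eqF//.
have -> : - (ln n%:R / 80 / 200) = - deviation_exponent * ln n%:R :> R.
  by rewrite /deviation_exponent; ring.
by rewrite ler_wpM2r ?expR_ge0// lerDl powR_ge0.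
Qed.

End hellinger_deviation.

(** * Assembly of the two bounds *)

Lemma true_mixings_sub (R : realType) (d : nat) (Theta : set 'rV[R]_d) kstar k (G : mixing R d) :
  (0 < kstar)%N -> (kstar <= k)%N -> true_mixings Theta kstar G -> mixings Theta k G.
Proof.
move=> k0 kk [oG aT w0 w1 _]; split=> //; first by rewrite oG k0.
move=> i; rewrite (ltW (w0 i))/= -w1 (bigD1 i)//= lerDl.
by apply: sumr_ge0 => j _; exact: ltW.
Qed.

(* The threshold of the second probability bound is the image of the first one
   under the inequality between the two distances. *)
Lemma threshold_sqr (R : realType) (C e D : R) (kstar : nat) :
  0 < C -> 0 <= e -> 0 < D -> (2 <= kstar)%N ->
  C * D ^+ (4 * kstar - 3) *
    ((1 / C) `^ 2^-1 * e `^ 4^-1 * D `^ (- (2 * kstar%:R - 3 / 2))) ^+ 2 = e `^ 2^-1.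
Proof.
move=> C0 e0 D0 k2.
have sq (x a : R) : 0 <= x -> (x `^ a) ^+ 2 = x `^ (a * 2).
  by move=> x0; rewrite powRrM -powR_mulrn ?powR_ge0.
rewrite !exprMn !sq ?divr_ge0 ?(ltW C0) ?(ltW D0)// mulVf// powRr1 ?divr_ge0 ?(ltW C0)//.
have -> : 4^-1 * 2 = 2^-1 :> R by field.
have k3 : (3 <= 4 * kstar)%N by rewrite (leq_trans (_ : 3 <= 4 * 1)%N)// leq_mul2l/= ltnW.
have -> : - (2 * kstar%:R - 3 / 2) * 2 = - (4 * kstar - 3)%:R :> R.
  by rewrite natrB// natrM; field.
rewrite powRN powR_mulrn ?(ltW D0)//.
have Dn : D ^+ (4 * kstar - 3) != 0 by rewrite expf_neq0// gt_eqF.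
by move: (D ^+ _) Dn => z z0; field; rewrite z0 gt_eqF.
Qed.

Theorem theorem6 (R : realType) (d kstar : nat) (hd : (0 < d)%N)
    (hkstar : (2 <= kstar)%N) :
  exists Cglobal : R -> 'M[R]_d -> R,
  [/\ forall (rad : R) (Sigma : 'M[R]_d),
        0 < rad -> posdef Sigma -> 0 < Cglobal rad Sigma,
      forall (rad : R) (Sigma : 'M[R]_d) (Theta : set 'rV[R]_d) (k : nat),
        0 < rad -> posdef Sigma ->
        compact Theta -> Theta `<=` [set theta | enorm theta <= rad] ->
        (kstar < k)%N ->
        forall Gstar G : mixing R d,
        true_mixings Theta kstar Gstar -> mixings Theta k G ->
        ((Cglobal rad Sigma * separation Gstar ^+ (4 * kstar - 3))%:E
           * wasserstein2 G Gstar ^+ 2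
         <= hellinger (mixture_pdf Sigma G) (mixture_pdf Sigma Gstar))%E &
      forall Theta : set 'rV[R]_d, compact Theta ->
      exists Cdensity cdensity : R,
      [/\ 0 < Cdensity, 0 < cdensity &
        forall (rad : R) (Sigma : 'M[R]_d) (k : nat),
        0 < rad -> posdef Sigma ->
        Theta `<=` [set theta | enorm theta <= rad] ->
        (kstar < k)%N ->
        exists2 M : R, 0 < M &
        forall (n : nat) (Gstar : mixing R d)
          (dO : measure_display) (Omega : measurableType dO)
          (P : probability Omega R) (X : 'I_n -> {RV P >-> 'rV[R]_d})
          (Ghat : Omega -> mixing R d),
        (1 <= n)%N -> true_mixings Theta kstar Gstar ->
        iid_with_density (mixture_pdf Sigma Gstar) X ->
        is_mle Sigma Theta k X Ghat ->
        ((P^*)%mu [set w |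
             ((Cdensity * (d%:R * ln n%:R / n%:R) `^ 2^-1)%:E <
              hellinger (mixture_pdf Sigma (Ghat w))
                        (mixture_pdf Sigma Gstar))%E]
           <= (M * n%:R `^ (- cdensity))%:E)%E /\
        ((P^*)%mu [set w |
             (((Cdensity / Cglobal rad Sigma) `^ 2^-1
               * (d%:R * ln n%:R / n%:R) `^ 4^-1
               * separation Gstar `^ (- (2 * kstar%:R - 3 / 2)))%:E <
              wasserstein2 (Ghat w) Gstar)%E]
           <= (M * expR (- cdensity * ln n%:R))%:E)%E]].

Proof.
have k0 : (0 < kstar)%N by exact: leq_trans hkstar.
(* The constant must be a function on all pairs; 0 is its default outside the admissible ones. *)
have ex (p : R * 'M[R]_d) : exists C : R, 0 < p.1 -> posdef p.2 -> 0 < C /\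
    forall G H : mixing R d, Defs.order H = kstar -> in_ball p.1 G -> in_ball p.1 H ->
    0 < separation H ->
    ((C * separation H ^+ (4 * kstar - 3))%:E * wasserstein2 G H ^+ 2 <=
     hellinger (mixture_pdf p.2 G) (mixture_pdf p.2 H))%E.
  case: p => rad S /=; case: (pselect (0 < rad /\ posdef S)) => [[r0 pdS]|h].
    by have [C C0 CP] := wasserstein2_hellinger pdS r0 hkstar; exists C.
  by exists 0 => r0 pdS; case: h.
have [Cg CgP] := choice ex.
exists (fun rad S => Cg (rad, S)); split.
- by move=> rad S r0 pdS; have [] := CgP (rad, S) r0 pdS.
- move=> rad S Theta k r0 pdS _ Tr kk Gs G Gs_true G_mix.
  have [_ h] := CgP (rad, S) r0 pdS; case: (Gs_true) => oGs _ _ _ sep0.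
  apply: h => //; first exact: in_ball_mixing Tr G_mix.
  exact: in_ball_true_mixing Tr Gs_true.
(* Both constants are absolute; [rad], [Sigma] and [k] enter only the prefactor [M]. *)
move=> Theta _; exists 1, (deviation_exponent R); split=> //.
  by rewrite divr_gt0// invr_gt0.
move=> rad S k r0 pdS Tr kk.
have [M M0 MP] := hellinger_deviation pdS hd kstar r0 (leq_ltn_trans (leq0n _) kk).
exists M => // n Gs dO Omega P X Ghat n1 Gs_true iid mle.
have [oGs _ _ _ sep0] := Gs_true.
have GsB := in_ball_true_mixing Tr Gs_true.
have GB w : in_ball rad (Ghat w) by have [mG _] := mle w; exact: in_ball_mixing Tr mG.
have nr0 : 0 < n%:R :> R by rewrite ltr0n.
have L0 : 0 <= ln n%:R :> R by rewrite ln_ge0// ler1n.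
set e := d%:R * ln n%:R / n%:R.
have e0 : 0 <= e by rewrite divr_ge0 ?mulr_ge0// ltW.
have eE : e `^ 2^-1 = Num.sqrt d%:R * Num.sqrt (ln n%:R / n%:R).
  by rewrite powR12_sqrt// /e -mulrA sqrtrM.
have dev : ((P^*)%mu [set w | ((1 * e `^ 2^-1)%:E <
    hellinger (mixture_pdf S (Ghat w)) (mixture_pdf S Gs))%E] <=
    (M * n%:R `^ (- deviation_exponent R))%:E)%E.
  have h := MP n Gs dO Omega P X Ghat n1 oGs GsB iid.
  apply: le_trans (h _).
    by apply: le_outer_measure => w /=; rewrite mul1r eE (hellingerE pdS) lte_fin.
  move=> w.
  have [mG best] := mle w; split=> //; first by case: mG => /andP[].
  exact/best/(true_mixings_sub k0 (ltnW kk) Gs_true).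
split=> //.
have -> : expR (- deviation_exponent R * ln n%:R) = n%:R `^ (- deviation_exponent R).
  by rewrite /powR gt_eqF.
apply: le_trans dev; apply: le_outer_measure => w /=.
have [C0 h] := CgP (rad, S) r0 pdS; have {h} /= := h _ _ oGs (GB w) GsB sep0.
set C := Cg _ in C0 *; set D := separation Gs in sep0 *.
set t := _ * D `^ _ => h tW; rewrite mul1r -(threshold_sqr C0 e0 sep0 hkstar) -/t.
apply: lt_le_trans h.
have c0 : 0 < C * D ^+ (4 * kstar - 3) by rewrite mulr_gt0// exprn_gt0.
have t0 : 0 <= t by rewrite !mulr_ge0 ?powR_ge0.
rewrite EFinM lte_pmul2l//.
case: (wasserstein2 _ _) tW => [r| |]//=.
- by rewrite lte_fin => tr; rewrite -EFinM lte_fin -expr2 ltrXn2r ?nnegrE// ?(le_trans t0) ?ltW.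
- by move=> _; rewrite mulyy ltry.
Qed.
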